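(* Let $I\subset\mathbb{R}$ be a closed bounded interval. Let $\eta_k,\eta:I\times Q\to\mathbb{R}^n$ ($k\in\mathbb{N}$) be such that $\eta_k(t),\eta(t)\in\mathcal{E}$ for all $t\in I$ and all $k$, and assume that $E(\eta_k(t))\le E_0$ and $E(\eta(t))\le E_0$ for all $t\in I$ and all $k$, with $E_0$ independent of $k$. Furthermore, assume that $\eta_k(t)\to\eta(t)$ in $C^1(Q;\mathbb{R}^n)$ uniformly in $t\in I$, that each $\eta_k$ is Borel measurable in time (as a map from $I$ into $W^{2,p}(Q;\mathbb{R}^n)$), and that $n_\eta\in C(I\times\partial Q;\mathbb{R}^n)$. For every $k$ let $\sigma_k\in M(I\times\partial Q;\mathbb{R}^n)$ be a contact force for $\eta_k$ and assume that $\sup_k\|\sigma_k\|_{M(I\times\partial Q;\mathbb{R}^n)}\le C$ for some constant $C<\infty$. Then there exist a subsequence (not relabelled) and a limit measure $\sigma$ such that $\sigma_k\rightharpoonup^*\sigma$ in $M(I\times\partial Q;\mathbb{R}^n)$. Moreover, $\sigma$ is a contact force for $\eta$, and if $\sigma_k$ satisfies the action-reaction principle at self-contact for all $k$, then so does $\sigma$.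
   Context: **Setting.** $Q\subset\mathbb{R}^n$ is a bounded $C^{1,\alpha}$ domain or a disjoint union of finitely many such domains; $\Omega\subset\mathbb{R}^n$ is a (possibly unbounded) $C^{1,\alpha}$ domain; $\Gamma\subset\partial Q$ is a fixed measurable subset; $p>n$. The class of admissible deformations is $$\mathcal{E}=\Big\{\eta\in W^{2,p}(Q;\mathbb{R}^n):\eta(Q)\subset\Omega,\ \eta|_\Gamma=\eta_0|_\Gamma,\ \det\nabla\eta>0,\ \mathcal{L}^n(\eta(Q))=\int_Q\det\nabla\eta\,dx\Big\},$$ where $\eta_0$ is a given admissible deformation with $\eta_0|_\Gamma$ injective and $\eta_0(\Gamma)\cap\partial\Omega=\emptyset$. Every $\eta\in\mathcal{E}$ is identified with its $C^{1,1-n/p}(\overline Q)$ representative. A subscript $\Gamma$ on a function space means vanishing trace on $\Gamma$. $M(K;\mathbb{R}^n)$ denotes $\mathbb{R}^n$-valued Radon measures on the compact set $K$, $M^+(K)$ non-negative ones. **Elastic energy.** $E:W^{2,p}(Q;\mathbb{R}^n)\to(-\infty,\infty]$ satisfies: (a) there is $E_{\min}>-\infty$ with $E\ge E_{\min}$; and $E(\eta)<\infty$ whenever $\inf_Q\det\nabla\eta>0$; (b) for every $E_0\ge E_{\min}$ there is $\varepsilon_0>0$ with $\det\nabla\eta\ge\varepsilon_0$ for all $\eta$ with $E(\eta)\le E_0$; (c) for every $E_0\ge E_{\min}$ there is $C$ with $\|\nabla^2\eta\|_{L^p}\le C$ for all $\eta$ with $E(\eta)<E_0$; (d) $E$ is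 weakly lower semicontinuous and strongly continuous on $W^{2,p}(Q;\mathbb{R}^n)$; (e) $E$ is differentiable in its effective domain with derivative $DE(\eta)\in(W^{2,p}(Q;\mathbb{R}^n))^*$; $DE$ is bounded on sublevel sets of $E$; and $DE(\eta_k)\langle\varphi\rangle\to DE(\eta)\langle\varphi\rangle$ whenever $\varphi\in W^{2,p}_\Gamma$ and $\eta_k\to\eta$ in $W^{2,p}(K;\mathbb{R}^n)$ for all $K$ compactly contained in $\overline Q$ with $\operatorname{dist}(K,\Gamma)>0$; (f) $\liminf_k(DE(\eta_k)-DE(\eta))\langle(\eta_k-\eta)\psi\rangle\ge0$ for all $\psi\in C^\infty_\Gamma(Q;[0,1])$ and all $\eta_k\rightharpoonup\eta$ in $W^{2,p}$; and if the corresponding $\limsup$ is $\le0$ for all such $\psi$, then $\eta_k\to\eta$ in $W^{2,p}(K;\mathbb{R}^n)$ for all $K$ compactly contained in $\overline Q$ with $\operatorname{dist}(K,\Gamma)>0$. **Normals, contact set, contact forces.** $n_Q$ is the interior unit normal of $\partial Q$; for time-dependent $\eta$ with $\eta(t)\in\mathcal{E}$, $n_\eta(t,x)=\frac{\operatorname{cof}\nabla\eta(t,x)\,n_Q(x)}{|\operatorname{cof}\nabla\eta(t,x)\,n_Q(x)|}$ for $x\in\partial Q$. For a single deformation $\eta\in\mathcal{E}$ the contact set is $C_\eta=\{x\in\overline Q:\eta(x)\in\partial\Omega\text{ or }\eta^{-1}(\eta(x))\ne\{x\}\}$ (preimages in $\overline Q$; known to be contained in $\partial Q$), and for time-dependent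 $\eta$, $C_\eta=\{(t,x)\in I\times\overline Q:x\in C_{\eta(t)}\}$. A contact force for a time-dependent $\eta$ (with $\eta(t)\in\mathcal{E}$ for all $t$, Borel measurable from $I$ into $W^{2,p}(Q;\mathbb{R}^n)$) is $\sigma\in M(I\times\partial Q;\mathbb{R}^n)$ with $\operatorname{supp}\sigma\subset C_\eta$ for which there is $|\sigma|\in M^+(I\times\partial Q)$ with $d\sigma=n_\eta\,d|\sigma|$. It satisfies the action-reaction principle at self-contact if $\int_{I\times\partial Q}\varphi(t,\eta(t,x))\cdot d\sigma(t,x)=0$ for all $\varphi\in C_c(I\times\Omega;\mathbb{R}^n)$.
   Formalization: The limit deformation η is additionally assumed continuous in time with values in C^1(Q;R^n); without this the claim fails (contact at times 1/k only, none at the limit time). A disjoint union of domains Q is read as having pairwise disjoint closures. *)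

(* Defs.v *)
From HB Require Import structures.
From mathcomp Require Import all_boot all_order all_algebra.
From mathcomp Require Import all_classical all_reals all_analysis.
Set Implicit Arguments. Unset Strict Implicit. Unset Printing Implicit Defensive.
Import Order.TTheory GRing.Theory Num.Theory.
Import numFieldNormedType.Exports.
Local Open Scope classical_set_scope.
Local Open Scope ring_scope.

(* Conventions: R^n is 'rV[R]_n, which carries the topology of the max norm
   `|x|; Euclidean quantities are written with [dotv] and [enorm]. *)

(* n-dimensional Lebesgue measure lives on n.-tuple R, whose product
   sigma-algebra is the Borel one, as an iterated product measure; it is
   transported to 'rV[R]_n along [vec]. *)
Section lebesgue_step.
Context (R : realType) (n : nat).
Local Notation T := (n.-tuple (measurableTypeR R)).
Local Notation T1 := (n.+1.-tuple (measurableTypeR R)).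
Variable mu : {sigma_finite_measure set T -> \bar R}.

Definition cons_pair (x : measurableTypeR R * T) : T1 := [tuple of x.1 :: x.2].

Lemma measurable_cons_pair : measurable_fun setT cons_pair.
Proof. exact: measurable_cons. Qed.

Definition lebesgue_cons : set T1 -> \bar R :=
  pushforward (@lebesgue_measure R \x mu)%E cons_pair.

Let lebesgue_cons0 : lebesgue_cons set0 = 0%E.
Proof. by rewrite /lebesgue_cons /pushforward preimage_set0 measure0. Qed.

Let lebesgue_cons_ge0 A : (0 <= lebesgue_cons A)%E.
Proof. exact: (measure_ge0 (lebesgue_measure \x mu)%E). Qed.

Let lebesgue_cons_sigma_additive : semi_sigma_additive lebesgue_cons.
Proof.
move=> F mF tF mUF; rewrite /lebesgue_cons /pushforward preimage_bigcup.
apply: measure_semi_sigma_additive.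
- by move=> k; rewrite -[X in measurable X]setTI; exact: measurable_cons_pair.
- apply/trivIsetP => /= i j _ _ ij; rewrite -preimage_setI.
  by move/trivIsetP : tF => /(_ _ _ _ _ ij) ->//; rewrite preimage_set0.
- by rewrite -preimage_bigcup -[X in measurable X]setTI; exact: measurable_cons_pair.
Qed.

HB.instance Definition _ := isMeasure.Build _ _ _ lebesgue_cons
  lebesgue_cons0 lebesgue_cons_ge0 lebesgue_cons_sigma_additive.

Let lebesgue_cons_sigma_finite : sigma_finite setT lebesgue_cons.
Proof.
have /sigma_finiteP[F [TF ndF Foo]] := sigma_finiteT (@lebesgue_measure R).
have /sigma_finiteP[G [TG ndG Goo]] := sigma_finiteT mu.
have mh : measurable_fun [set: T1] (fun s => thead s) by exact: measurable_tnth.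
have mt : measurable_fun [set: T1] (fun s => [tuple of behead s]).
  exact: measurable_behead.
pose H k := (fun s : T1 => thead s) @^-1` F k `&` (fun s : T1 => [tuple of behead s]) @^-1` G k.
have preH k : cons_pair @^-1` H k = F k `*` G k.
  apply/seteqP; split=> -[x s]; rewrite /H /cons_pair /=; rewrite theadE.
    by move=> [Fx]; rewrite (_ : [tuple of _] = s)//; exact/val_inj.
  by move=> [Fx Gs]; split=> //; rewrite (_ : [tuple of _] = s)//; exact/val_inj.
exists H => [|k].
  apply/seteqP; split=> // s _.
  have [i _ Fi] : (\bigcup_k F k) (thead s) by rewrite -TF.
  have [j _ Gj] : (\bigcup_k G k) [tuple of behead s] by rewrite -TG.
  exists (maxn i j) => //; split.
    by have /subsetPset := ndF _ _ (leq_maxl i j); apply.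
  by have /subsetPset := ndG _ _ (leq_maxr i j); apply.
have [mFk Fk] := Foo k; have [mGk Gk] := Goo k; split.
  apply: measurableI.
    by rewrite -[X in measurable X]setTI; exact: mh.
  by rewrite -[X in measurable X]setTI; exact: mt.
rewrite /lebesgue_cons /pushforward preH product_measure1E//.
by rewrite lte_mul_pinfty// ge0_fin_numE.
Qed.

HB.instance Definition _ := @Measure_isSigmaFinite.Build _ _ _
  lebesgue_cons lebesgue_cons_sigma_finite.
End lebesgue_step.

Fixpoint lebesgue_tuple (R : realType) (n : nat) :
    {sigma_finite_measure set (n.-tuple (measurableTypeR R)) -> \bar R} :=
  if n is m.+1 then lebesgue_cons (lebesgue_tuple R m) else \d_([tuple]).

Section setting.
Context (R : realType) (n : nat).
Local Notation Rn := 'rV[R]_n.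
Local Notation leb := (lebesgue_tuple R n).

Definition vec (s : n.-tuple (measurableTypeR R)) : Rn := \row_i tnth s i.

Definition Ln (A : set Rn) : \bar R := leb (vec @^-1` A).

Definition intL (A : set Rn) (g : Rn -> R) : R :=
  (\int[leb]_(s in vec @^-1` A) g (vec s))%R.

Definition normLp (p : R) (A : set Rn) (g : Rn -> R) : \bar R :=
  'N[leb]_(p%:E)[EFin \o (g \_ A) \o vec]%E.

Definition in_Lp (p : R) (A : set Rn) (g : Rn -> R) : Prop :=
  measurable_fun (vec @^-1` A) (g \o vec) /\ (normLp p A g < +oo)%E.

Definition dotv (u v : Rn) : R := \sum_i u ord0 i * v ord0 i.
Definition enorm (u : Rn) : R := Num.sqrt (dotv u u).

Definition bd {T : topologicalType} (A : set T) : set T := closure A `\` interior A.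

(* Hausdorff outer measure without the normalising constant, which does not
   affect measurability; the surface measure of [bd Q] is [hausdorff n.-1]. *)
Definition diam (A : set Rn) : \bar R :=
  ereal_sup [set (enorm (x - y))%:E | x in A & y in A].

Definition diam_pow (s : nat) (A : set Rn) : \bar R :=
  if `[< A = set0 >] then 0%E else (diam A ^+ s)%E.

Definition hausdorff (s : nat) (A : set Rn) : \bar R :=
  ereal_sup [set ereal_inf [set (\sum_(0 <= k <oo) diam_pow s (B k))%E |
      B in [set B : nat -> set Rn | A `<=` \bigcup_k B k /\
                 forall k, (diam (B k) <= d%:E)%E]]
    | d in [set d : R | 0 < d]].

Definition basis_vec (j : 'I_n) : Rn := delta_mx ord0 j.

Definition partial (j : 'I_n) (g : Rn -> R) (x : Rn) : R :=
  'D_(basis_vec j) g x.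

Definition sgrad (g : Rn -> R) (x : Rn) : Rn := \row_j partial j g x.

Definition C1alpha (alpha : R) (g : Rn -> R) : Prop :=
  (forall x, differentiable g x) /\
  exists L : R, forall x y, `|sgrad g x - sgrad g y| <= L * `|x - y| `^ alpha.

Definition proj_perp (e y : Rn) : Rn := y - dotv y e *: e.

(* Near x0, the set D is the region above a C^{1,alpha} graph in the direction
   e; only the values of g on the hyperplane orthogonal to e matter. *)
Definition graph_chart (alpha : R) (D : set Rn) (x0 e : Rn) (g : Rn -> R) :
    Prop :=
  enorm e = 1 /\ C1alpha alpha g /\
  exists2 r : R, 0 < r &
    forall y, `|y - x0| < r -> (D y <-> g (proj_perp e y) < dotv y e).

Definition C1alpha_domain (alpha : R) (D : set Rn) : Prop :=
  [/\ open D, connected D, D !=set0 &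
      forall x, bd D x -> exists e g, graph_chart alpha D x e g].

Definition bounded_C1alpha_domains (alpha : R) (Q : set Rn) : Prop :=
  exists (N : nat) (D : 'I_N.+1 -> set Rn),
    [/\ forall i, C1alpha_domain alpha (D i) /\ bounded_set (D i),
        forall i j, i != j -> closure (D i) `&` closure (D j) = set0 &
        Q = \bigcup_i D i].

(* [chart_conormal e g x] is the gradient at x of y |-> y.e - g (proj_perp e y),
   a function that is positive inside the domain. *)
Definition chart_conormal (e : Rn) (g : Rn -> R) (x : Rn) : Rn :=
  e - proj_perp e (sgrad g (proj_perp e x)).

Definition normalize (u : Rn) : Rn := (enorm u)^-1 *: u.

Definition inner_normal (alpha : R) (D : set Rn) (x : Rn) : Rn :=
  get [set nu | exists e g, graph_chart alpha D x e g /\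
                  nu = normalize (chart_conormal e g x)].

Definition coordf (f : Rn -> Rn) (i : 'I_n) (x : Rn) : R := f x ord0 i.

(* Row i is the gradient of the i-th component, so [jacobian f x] is the
   transpose of [grad f x]. *)
Definition grad (f : Rn -> Rn) (x : Rn) : 'M[R]_n :=
  \matrix_(i, j) partial j (coordf f i) x.

(* Continuous extension to the closure of Q of the gradient on Q. *)
Definition cgrad (Q : set Rn) (f : Rn -> Rn) (x : Rn) : 'M[R]_n :=
  lim (grad f y @[y --> within Q (nbhs x)]).

Definition cofactor_mx (A : 'M[R]_n) : 'M[R]_n := (\adj A)^T.

Definition deformed_normal (alpha : R) (Q : set Rn) (f : Rn -> Rn) (x : Rn) :
    Rn :=
  normalize (cofactor_mx (cgrad Q f x) *m (inner_normal alpha Q x)^T)^T.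

Fixpoint Ck (k : nat) (g : Rn -> R) : Prop :=
  continuous g /\
  if k is k'.+1 then
    forall j, (forall x, derivable g x (basis_vec j)) /\ Ck k' (partial j g)
  else True.

Definition Csmooth (g : Rn -> R) : Prop := forall k, Ck k g.

Definition test_fun (Q : set Rn) (g : Rn -> R) : Prop :=
  Csmooth g /\
  exists K : set Rn, [/\ compact K, K `<=` Q & forall x, ~ K x -> g x = 0].

Section sobolev.
Variables (p : R) (Q : set Rn).

Definition is_weak_partial (j : 'I_n) (g h : Rn -> R) : Prop :=
  in_Lp p Q h /\
  forall phi, test_fun Q phi ->
    intL Q (fun x => g x * partial j phi x) = - intL Q (fun x => h x * phi x).

Definition weak_partial (j : 'I_n) (g : Rn -> R) : Rn -> R :=
  get [set h | is_weak_partial j g h].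

Definition sobolev2 (g : Rn -> R) : Prop :=
  in_Lp p Q g /\
  forall j, exists2 h, is_weak_partial j g h &
    forall i, exists h', is_weak_partial i h h'.

(* The W^{2,p} norm over a measurable subset A of Q. *)
Definition normW2p_on (A : set Rn) (f : Rn -> Rn) : \bar R :=
  (\sum_(c < n) (normLp p A (coordf f c)
    + \sum_(j < n) normLp p A (weak_partial j (coordf f c))
    + \sum_(i < n) \sum_(j < n)
        normLp p A (weak_partial i (weak_partial j (coordf f c)))))%E.

Definition normW2p (f : Rn -> Rn) : \bar R := normW2p_on Q f.

Definition norm_hess (f : Rn -> Rn) : \bar R :=
  normLp p Q (fun x => Num.sqrt (\sum_(c < n) \sum_(i < n) \sum_(j < n)
    weak_partial i (weak_partial j (coordf f c)) x ^+ 2)).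

(* The C^{1,1-n/p} representative, up to the boundary. *)
Definition C1gamma_closure (f : Rn -> Rn) : Prop :=
  [/\ {within closure Q, continuous f}, forall x, Q x -> differentiable f x &
      exists L : R, forall x y, Q x -> Q y ->
        `|grad f x - grad f y| <= L * `|x - y| `^ (1 - n%:R / p)].

(* For p > n each class of W^{2,p}(Q; R^n) is identified with its
   C^{1,1-n/p} representative, so that a class is a function on closure Q;
   values outside closure Q are irrelevant. *)
Definition W2p : set (Rn -> Rn) :=
  [set f | (forall c, sobolev2 (coordf f c)) /\ C1gamma_closure f].

Definition W2p_dual (l : (Rn -> Rn) -> R) : Prop :=
  (forall (c : R) f g, W2p f -> W2p g ->
     l (fun x => c *: f x + g x) = c * l f + l g) /\
  exists C : R, forall f, W2p f -> (`|l f|%:E <= C%:E * normW2p f)%E.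

Definition W2p_strong_cvg (fk : nat -> Rn -> Rn) (f : Rn -> Rn) : Prop :=
  normW2p (fun x => fk k x - f x) @[k --> \oo] --> 0%E.

Definition W2p_weak_cvg (fk : nat -> Rn -> Rn) (f : Rn -> Rn) : Prop :=
  forall l, W2p_dual l -> l (fk k) @[k --> \oo] --> l f.

(* Convergence in W^{2,p}(K; R^n) for each compact K in closure Q at positive
   distance from Gamma; the boundary of Q is a null set. *)
Definition W2p_cvg_off (Gamma : set Rn) (fk : nat -> Rn -> Rn)
    (f : Rn -> Rn) : Prop :=
  forall K : set Rn, compact K -> K `<=` closure Q ->
    (exists2 d : R, 0 < d & forall x y, K x -> Gamma y -> d <= enorm (x - y)) ->
    normW2p_on (K `&` Q) (fun x => fk k x - f x) @[k --> \oo] --> 0%E.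

Definition W2p_Gamma (Gamma : set Rn) : set (Rn -> Rn) :=
  [set f | W2p f /\ forall x, Gamma x -> f x = 0].

(* C^infty_Gamma(Q; [0,1]), smoothness being up to the boundary. *)
Definition cutoff (Gamma : set Rn) (psi : Rn -> R) : Prop :=
  [/\ Csmooth psi, forall x, Q x -> 0 <= psi x <= 1 &
      forall x, Gamma x -> psi x = 0].

Definition W2p_open (U : set (Rn -> Rn)) : Prop :=
  forall f, W2p f -> U f -> exists2 d : R, 0 < d &
    forall g, W2p g -> (normW2p (fun x => g x - f x)%R < d%:E)%E -> U g.

Definition borel_in_time (J : set R) (eta : R -> Rn -> Rn) : Prop :=
  forall U, W2p_open U ->
    measurable ([set t | J t /\ U (eta t)] : set (measurableTypeR R)).

(* [DE eta] is the Frechet derivative; it is only meaningful where [E eta] is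
   finite. *)
Record elastic_energy (Gamma : set Rn) (E : (Rn -> Rn) -> \bar R)
    (Emin : R) (DE : (Rn -> Rn) -> (Rn -> Rn) -> R) : Prop := ElasticEnergy {
  energy_bounded_below : forall f, W2p f -> (Emin%:E <= E f)%E ;
  energy_finite : forall f, W2p f ->
    0 < inf [set \det (grad f x) | x in Q] -> (E f < +oo)%E ;
  energy_det : forall E0 : R, Emin <= E0 ->
    exists2 eps0 : R, 0 < eps0 & forall f, W2p f -> (E f <= E0%:E)%E ->
      forall x, Q x -> eps0 <= \det (grad f x) ;
  energy_coercive : forall E0 : R, Emin <= E0 ->
    exists C : R, forall f, W2p f -> (E f < E0%:E)%E ->
      (norm_hess f <= C%:E)%E ;
  energy_wlsc : forall fk f, (forall k, W2p (fk k)) -> W2p f ->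
    W2p_weak_cvg fk f -> (E f <= limn_einf (fun k => E (fk k)))%E ;
  energy_continuous : forall fk f, (forall k, W2p (fk k)) -> W2p f ->
    W2p_strong_cvg fk f -> E (fk k) @[k --> \oo] --> E f ;
  energy_dual : forall f, W2p f -> (E f < +oo)%E -> W2p_dual (DE f) ;
  energy_differentiable : forall f, W2p f -> (E f < +oo)%E ->
    forall eps : R, 0 < eps -> exists2 d : R, 0 < d &
      forall phi, W2p phi -> (normW2p phi < d%:E)%E ->
        (`|E (fun x => f x + phi x)%R - E f - (DE f phi)%:E|
           <= eps%:E * normW2p phi)%E ;
  energy_deriv_bounded : forall E0 : R, exists C : R,
    forall f, W2p f -> (E f <= E0%:E)%E ->
      forall phi, W2p phi -> (`|DE f phi|%:E <= C%:E * normW2p phi)%E ;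
  energy_deriv_continuous : forall phi, W2p_Gamma Gamma phi ->
    forall fk f, (forall k, W2p (fk k) /\ (E (fk k) < +oo)%E) ->
      W2p f -> (E f < +oo)%E -> W2p_cvg_off Gamma fk f ->
      DE (fk k) phi @[k --> \oo] --> DE f phi ;
  energy_liminf : forall fk f, (forall k, W2p (fk k) /\ (E (fk k) < +oo)%E) ->
    W2p f -> (E f < +oo)%E -> W2p_weak_cvg fk f ->
    forall psi, cutoff Gamma psi ->
      (0 <= limn_einf (fun k =>
        (DE (fk k) (fun x => psi x *: (fk k x - f x))
         - DE f (fun x => psi x *: (fk k x - f x)))%R%:E))%E ;
  energy_limsup : forall fk f, (forall k, W2p (fk k) /\ (E (fk k) < +oo)%E) ->
    W2p f -> (E f < +oo)%E -> W2p_weak_cvg fk f ->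
    (forall psi, cutoff Gamma psi ->
      (limn_esup (fun k =>
        (DE (fk k) (fun x => psi x *: (fk k x - f x))
         - DE f (fun x => psi x *: (fk k x - f x)))%R%:E) <= 0)%E) ->
    W2p_cvg_off Gamma fk f
}.

End sobolev.

Definition C1_within (Q : set Rn) (eps : R) (f g : Rn -> Rn) : Prop :=
  forall x, Q x -> `|f x - g x| <= eps /\ `|grad f x - grad g x| <= eps.

(* eta in C(J; C^1(closure Q; R^n)).  Continuity of the deformed normal alone
   does not control eta in time: translations of Q that touch bd Omega exactly
   at times t_j -> t, t_j != t, keep the normal constant, but unit contact
   forces at the times t_j converge to one at t, where there is no contact. *)
Definition C1_continuous_in_time (Q : set Rn) (J : set R)
    (eta : R -> Rn -> Rn) : Prop :=
  forall t0, J t0 -> forall eps : R, 0 < eps -> exists2 d : R, 0 < d &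
    forall t, J t -> `|t - t0| < d -> C1_within Q eps (eta t) (eta t0).

Definition C1_uniform_cvg (Q : set Rn) (J : set R)
    (etak : nat -> R -> Rn -> Rn) (eta : R -> Rn -> Rn) : Prop :=
  forall eps : R, 0 < eps -> exists N : nat, forall k t,
    (N <= k)%N -> J t -> C1_within Q eps (etak k t) (eta t).

Definition admissible (p : R) (Q Omega Gamma : set Rn) (eta0 : Rn -> Rn) :
    set (Rn -> Rn) :=
  [set eta | [/\ W2p p Q eta, eta @` Q `<=` Omega,
                 forall x, Gamma x -> eta x = eta0 x,
                 forall x, Q x -> 0 < \det (grad eta x) &
                 Ln (eta @` Q)
                 = (\int[leb]_(s in vec @^-1` Q) (\det (grad eta (vec s)))%:E)%E]].

Definition contact_set (Q Omega : set Rn) (eta : Rn -> Rn) : set Rn :=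
  [set x | closure Q x /\
    (bd Omega (eta x) \/ closure Q `&` eta @^-1` [set eta x] <> [set x])].

Definition contact_set_time (Q Omega : set Rn) (J : set R)
    (eta : R -> Rn -> Rn) : set (R * Rn) :=
  [set z | J z.1 /\ contact_set Q Omega (eta z.1) z.2].

(* R^n-valued Radon measures on a compact set K of R x R^n are n-tuples of
   finite signed Borel measures that vanish off K; regularity is automatic. *)

Definition spacetime := g_sigma_algebraType (@open (R * Rn)%type).

Definition vcharge := 'I_n -> {charge set spacetime -> \bar R}.

Definition vmeasure_on (K : set spacetime) (sigma : vcharge) : Prop :=
  forall i A, measurable A -> A `&` K = set0 -> sigma i A = 0%E.

Definition vcharge_val (sigma : vcharge) (A : set spacetime) : Rn :=
  \row_i fine (sigma i A).

Definition tv_norm (sigma : vcharge) : \bar R :=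
  ereal_sup [set v | exists (m : nat) (A : nat -> set spacetime),
    [/\ forall k, measurable (A k), trivIset setT A &
        v = (\sum_(k < m) enorm (vcharge_val sigma (A k)))%:E]].

Definition vsupp (sigma : vcharge) : set (R * Rn) :=
  [set z | forall U : set (R * Rn), open U -> U z ->
     exists A : set spacetime,
       [/\ measurable A, A `<=` U & vcharge_val sigma A <> 0]].

(* Integral against a signed measure, through a Hahn decomposition (the Jordan
   parts do not depend on its choice). *)
Definition int_charge (nu : {charge set spacetime -> \bar R})
    (K : set spacetime) (f : spacetime -> R) : R :=
  let cP := cid (Hahn_decomposition nu) in
  let cN := cid (projT2 cP) in
  \int[jordan_pos (projT2 cN)]_(z in K) f z
  - \int[jordan_neg (projT2 cN)]_(z in K) f z.

Definition int_vcharge (sigma : vcharge) (K : set spacetime)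
    (phi : spacetime -> Rn) : R :=
  \sum_(i < n) int_charge (sigma i) K (fun z => phi z ord0 i).

Definition weak_star_cvg (K : set (R * Rn)) (sigmak : nat -> vcharge)
    (sigma : vcharge) : Prop :=
  forall phi : R * Rn -> Rn, {within K, continuous phi} ->
    int_vcharge (sigmak k) K phi @[k --> \oo] --> int_vcharge sigma K phi.

Definition has_density (K : set spacetime) (nu : spacetime -> Rn)
    (mu : {finite_measure set spacetime -> \bar R}) (sigma : vcharge) : Prop :=
  forall i, mu.-integrable K (fun z => (nu z ord0 i)%:E) /\
    forall A, measurable A ->
      sigma i A = (\int[mu]_(z in A `&` K) (nu z ord0 i)%:E)%E.

Definition contact_force (alpha p : R) (Q Omega Gamma : set Rn)
    (eta0 : Rn -> Rn) (J : set R) (eta : R -> Rn -> Rn) (sigma : vcharge) :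
    Prop :=
  let K := J `*` bd Q in
  [/\ (forall t, J t -> admissible p Q Omega Gamma eta0 (eta t)),
      borel_in_time p Q J eta, vmeasure_on K sigma,
      vsupp sigma `<=` contact_set_time Q Omega J eta &
      exists2 mu : {finite_measure set spacetime -> \bar R}, mu (~` K) = 0%E &
        has_density K (fun z => deformed_normal alpha Q (eta z.1) z.2)
          mu sigma].

(* Test fields in C_c(J x Omega; R^n) are extended by zero. *)
Definition action_reaction (Q Omega : set Rn) (J : set R)
    (eta : R -> Rn -> Rn) (sigma : vcharge) : Prop :=
  forall phi : R * Rn -> Rn,
    {within J `*` Omega, continuous phi} ->
    (exists L : set (R * Rn), [/\ compact L, L `<=` J `*` Omega &
       forall z, ~ L z -> phi z = 0]) ->
    int_vcharge sigma (J `*` bd Q) (fun z => phi (z.1, eta z.1 z.2)) = 0.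

End setting.

(* Main.v *)
(* Write sigma_k = nu_k mu_k with |nu_k| = 1 and K = J x bd Q.  Evaluating sigma_k on
   the sets where a component of nu_k is positive bounds mu_k(K), so a subsequence of
   (mu_k) converges weakly to a finite measure mu on the compact set K: a diagonal
   argument over ever finer Borel partitions of K makes the integrals of continuous
   functions converge, and the limit functional is represented by the Daniell-Stone
   outer measure it generates.  The uniform C^1 convergence and the lower bound on the
   Jacobian determinants give nu_k -> nu uniformly on K, whence sigma_k -> nu mu.

   Contact is upper semicontinuous: near a boundary point without contact for eta(t0),
   the gradients of all eta_k(t) are close to one invertible matrix and nearby points of
   the closure of Q are joined inside Q by paths of comparable length, so the eta_k(t)
   are injective on a common neighbourhood; hence mu_k, and then mu, vanish there.

   The action-reaction principle passes to the limit because phi(t, eta_k) converges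
   uniformly to phi(t, eta); since eta_k is not continuous in time, the integrals are
   compared by monotonicity alone, without measurability of phi(t, eta_k).

   Finally eta is Borel in time: by duality the ball |D^a u|_p <= r is cut out by the
   conditions |int u D^a phi| <= r |phi|_q over a countable family of test functions
   dense in L^q, each of them closed in t, and the same family makes the relevant part
   of W^{2,p} separable. *)
Require Import Defs.
From HB Require Import structures.
From mathcomp Require Import all_boot all_order all_algebra.
From mathcomp Require Import finmap all_classical all_reals all_analysis.
From mathcomp Require Import measurable_realfun unstable ring lra.
Import Order.TTheory GRing.Theory Num.Theory.
Import numFieldNormedType.Exports.
Local Open Scope classical_set_scope.
Local Open Scope ring_scope.
Set Implicit Arguments. Unset Strict Implicit. Unset Printing Implicit Defensive.

(** * Density of function algebras in Lp *)

(** The lower bound on the determinants is used twice. Since [A^T cof(A) = det(A)], it keeps the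
    vectors [cof(A) v] away from zero, so that normalizing them is stable; and it makes the gradient
    at a boundary point invertible, so that a perturbation argument around that single matrix gives
    injectivity at a scale common to all [t] close to [t0] and all large [k]. Gradients on [bd Q]
    exist only as limits from inside: estimates are made on [Q] and then passed to its closure. As
    [Q] need not be convex, mean value inequalities hold only along segments inside it, which is why
    paths through a boundary chart occur. The unit length of the normals lets [sigma_k] control
    [mu_k], both in mass and in null sets. Integrals against a charge come from an unspecified Hahn
    decomposition; the only handle on it is the difference of the Jordan parts on Borel sets, and
    Riemann sums over fine partitions turn this into an identity of integrals. In time [eta] is
    continuous only with values in C^1, so its second derivatives depend on [t] continuously in a
    weak sense alone; this is what forces the detour through duality for measurability. *)

Lemma norm_complement_prod_le (R : realDomainType) (a b f g : R) :
  0 <= b <= 1 -> 0 <= f <= 1 ->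
  `|a * (1 - b) - (f - f * g)| <= `|a - f| + `|b - g|.
Proof.
move=> /andP[b0 b1] /andP[f0 f1].
(* In use [a], [b] are values of indicators and [f], [g] their approximants: [a (1 - b)] is a set
   difference, and each of the two errors gets multiplied by a factor in [0, 1]. *)
rewrite (_ : _ - _ = (a - f) * (1 - b) - f * (b - g)); last by ring.
apply: (le_trans (ler_normB _ _)); rewrite !normrM lerD//.
  by rewrite ler_piMr// ger0_norm ?subr_ge0//; lra.
by rewrite ler_piMl// ger0_norm.
Qed.

Lemma cvge_near_lt (R : realType) (T : Type) (F : set_system T) (FF : Filter F)
    (u : T -> \bar R) (l x : \bar R) :
  u @ F --> l -> (l < x)%E -> \forall t \near F, (u t < x)%E.
Proof.
by move=> ul lx; exact: (ul _ (open_ereal_lt' lx)).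
Qed.

Lemma powR_normr_small (R : realType) (r eps : R) : 0 < r -> 0 < eps ->
  exists2 d : R, 0 < d & forall x : R, `|x| < d -> `|x| `^ r < eps.
Proof.
move=> r0 e0; exists (eps `^ r^-1); first exact: powR_gt0.
move=> x xd; rewrite -[ltRHS](powRr1 (ltW e0)) -(mulVf (lt0r_neq0 r0)) powRrM.
by apply: gt0_ltr_powR; rewrite ?nnegrE ?powR_ge0.
Qed.

Import HBNNSimple.
Section Lp_density.
Context d (X : measurableType d) (R : realType).
Variables (mu : {measure set X -> \bar R}).
Variables (D : set X) (F : set (X -> R)).
Hypotheses (mD : measurable D) (muD : (mu D < +oo)%E).
Hypothesis F_meas : forall f, F f -> measurable_fun setT f.
Hypothesis F_D : forall f x, F f -> ~ D x -> f x = 0.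
Hypothesis FD : forall f g, F f -> F g -> F (f \+ g).
Hypothesis FB : forall f g, F f -> F g -> F (f \- g).
Hypothesis FM : forall f g, F f -> F g -> F (f \* g).

(** Values in [0, 1] are demanded so that errors do not grow under products, and so that L^1 errors
    bound L^r errors later on. *)
Definition L1_approx (A : set X) := forall eps : R, 0 < eps ->
  exists f, [/\ F f, forall x, 0 <= f x <= 1 &
    (\int[mu]_x `|\1_A x - f x|%:E < eps%:E)%E].

Let measurable_abs_indicB (A : set X) f : measurable A -> F f ->
  measurable_fun setT (fun x => (`|\1_A x - f x| : R)%:E).
Proof.
move=> mA Ff; apply/measurable_EFinP/measurableT_comp => //.
by apply: measurable_funB; [exact: measurable_indic|exact: F_meas].
Qed.

Let L1_approx2 (A B C : set X) f g h (eps : R) :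
  measurable A -> measurable B -> measurable C -> F f -> F g -> F h ->
  (\int[mu]_x `|\1_A x - f x|%:E < (eps / 2)%:E)%E ->
  (\int[mu]_x `|\1_B x - g x|%:E < (eps / 2)%:E)%E ->
  (forall x, `|\1_C x - h x| <= `|\1_A x - f x| + `|\1_B x - g x| :> R) ->
  (\int[mu]_x `|\1_C x - h x|%:E < eps%:E)%E.
Proof.
move=> mA mB mC Ff Fg Fh If Ig le.
apply: (@le_lt_trans _ _ (\int[mu]_x (`|\1_A x - f x|%:E + `|\1_B x - g x|%:E))%E).
  apply: ge0_le_integral => //; try exact: measurable_abs_indicB.
  - by apply: emeasurable_funD; exact: measurable_abs_indicB.
  - by move=> x _; rewrite -EFinD lee_fin.
rewrite ge0_integralD//; try exact: measurable_abs_indicB.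
by rewrite [eps]splitr EFinD; exact: lteD.
Qed.

Lemma L1_approxD (A B : set X) : measurable A -> measurable B ->
  L1_approx A -> L1_approx B -> L1_approx (A `\` B).
Proof.
move=> mA mB hA hB eps e0; have e20 : 0 < eps / 2 by rewrite divr_gt0.
have [f [Ff f01 If]] := hA _ e20; have [g [Fg g01 Ig]] := hB _ e20.
have Fh := FB Ff (FM Ff Fg).
exists (f \- f \* g); split => // [x|].
  have /andP[f0 f1] := f01 x; have /andP[g0 g1] := g01 x => /=.
  by apply/andP; split; nra.
apply: (L1_approx2 _ _ _ Ff Fg Fh If Ig) => //; first exact: measurableD.
move=> x /=; apply: le_trans (norm_complement_prod_le _ _ _ (f01 x)).
  by rewrite !indicE in_setD; case: (x \in A); case: (x \in B) => /=; rewrite ?subrr ?subr0 ?mul0r ?mulr1 ?mulr0.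
by rewrite indicE; case: (x \in B); rewrite ?lexx ?ler01.
Qed.

Lemma L1_approxU (A B : set X) : measurable A -> measurable B ->
  L1_approx A -> L1_approx B -> L1_approx (A `|` B).
Proof.
move=> mA mB hA hB eps e0; have e20 : 0 < eps / 2 by rewrite divr_gt0.
have [f [Ff f01 If]] := hA _ e20; have [g [Fg g01 Ig]] := hB _ e20.
have Fh := FB (FD Ff Fg) (FM Ff Fg).
exists (f \+ g \- f \* g); split => // [x|].
  have /andP[f0 f1] := f01 x; have /andP[g0 g1] := g01 x => /=.
  by apply/andP; split; nra.
apply: (L1_approx2 _ _ _ Ff Fg Fh If Ig) => //; first exact: measurableU.
move=> x /=; have /andP[f0 f1] := f01 x.
(* The complement of a union is a product of complements, so the inequality for differences applies
   with [1 - f] in the place of [f]. *)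
have -> : `|\1_A x - f x| = `|(1 - \1_A x) - (1 - f x)| :> R.
  by rewrite -normrN; congr (`|_|); ring.
apply: le_trans (norm_complement_prod_le _ _ _ _).
- rewrite -normrN; rewrite le_eqVlt; apply/orP; left; apply/eqP; congr (`|_|).
  by rewrite !indicE in_setU; case: (x \in A); case: (x \in B) => /=; ring.
- by rewrite indicE; case: (x \in B); rewrite ?lexx ?ler01.
- by apply/andP; split; lra.
Qed.

(** Finite unions exhaust the union, and what they miss has measure tending to 0 because everything
    lies in [D], which has finite measure. *)
Lemma L1_approx_bigcup (A : (set X)^nat) : (forall i, measurable (A i)) ->
  (forall i, A i `<=` D) -> (forall i, L1_approx (A i)) ->
  L1_approx (\bigcup_i A i).
Proof.
move=> mA AD hA eps e0; have e20 : 0 < eps / 2 by rewrite divr_gt0.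
pose B n := \big[setU/set0]_(i < n.+1) A i.
have mB n : measurable (B n) by exact: bigsetU_measurable.
have hB n : L1_approx (B n).
  elim: n => [|n ih]; first by rewrite /B big_ord_recl big_ord0 setU0.
  rewrite /B big_ord_recr/=; exact: L1_approxU (mB n) (mA _) ih (hA _).
have mU : measurable (\bigcup_i A i) by exact: bigcup_measurable.
pose C n := (\bigcup_i A i) `\` B n.
have BU n : B n `<=` \bigcup_i A i.
  by rewrite /B -bigcup_mkord => x [i _ Aix]; exists i.
have mC n : measurable (C n) by exact: measurableD.
have C0 : mu (C n) @[n --> \oo] --> 0%E.
  have <- : mu (\bigcap_n C n) = 0%E.
    rewrite (_ : \bigcap_n C n = set0) ?measure0// -subset0 => x Cx.
    have [[i _ Aix] _] := Cx 0%N I; have [_] := Cx i I; apply.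
    by rewrite /B -bigcup_mkord; exists i => //=.
  apply: nonincreasing_cvg_mu => //; last 2 first.
  - exact: bigcap_measurable.
  - apply/nonincreasing_seqP => n; apply/subsetPset; rewrite /C.
    by apply: setDS; rewrite /B [X in _ `<=` X]big_ord_recr/=; left.
  - apply: le_lt_trans muD; apply: le_measure; rewrite ?inE//.
    by move=> x [[i _ /AD]].
have [n _ /(_ n (leqnn n)) Cn] : \forall n \near \oo, (mu (C n) < (eps / 2)%:E)%E.
  by apply: (cvge_near_lt _ C0); rewrite lte_fin.
have [f [Ff f01 If]] := hB n _ e20.
exists f; split => //.
apply: (@le_lt_trans _ _ (\int[mu]_x ((\1_(C n) x)%:E + `|\1_(B n) x - f x|%:E))%E).
  apply: ge0_le_integral => //; try exact: measurable_abs_indicB.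
  - by apply: emeasurable_funD; [exact/measurable_EFinP|exact: measurable_abs_indicB].
  - move=> x _; rewrite -EFinD lee_fin.
    rewrite -[X in _ <= X + _]ger0_norm//; apply: le_trans (ler_normD _ _).
    rewrite le_eqVlt; apply/orP; left; apply/eqP; congr (`|_|); rewrite /C !indicE in_setD.
    have := @BU n x; case: (boolP (x \in B n)); rewrite ?inE => xB.
      by move=> /(_ xB) /mem_set -> /=; ring.
    by move=> _; case: (_ \in _) => /=; ring.
rewrite ge0_integralD//; first last.
- exact: measurable_abs_indicB.
- exact/measurable_EFinP.
rewrite integral_indic// setIT [eps]splitr EFinD; exact: lteD.
Qed.

(** Sets are traced on [D] so that a complement becomes a difference of two approximable sets; the
    intended family consists of compactly supported functions and cannot be expected to contain
    constants. *)
Lemma L1_approx_sigma_algebra : L1_approx D ->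
  sigma_algebra setT [set A | measurable A /\ L1_approx (A `&` D)].
Proof.
move=> hD; split => [|A [mA hA]|A hA] /=.
- split => //; rewrite set0I -(setDv D); exact: L1_approxD.
- rewrite setTD; split; first exact: measurableC.
  rewrite (_ : ~` A `&` D = D `\` (A `&` D)); last first.
    by rewrite setDIr setDv setU0 setIC setDE.
  apply: L1_approxD => //; exact: measurableI.
- split; first by apply: bigcup_measurable => i _; case: (hA i).
  rewrite setI_bigcupl; apply: L1_approx_bigcup => i.
  + by apply: measurableI => //; case: (hA i).
  + exact: subIsetr.
  + by case: (hA i).
Qed.

Hypothesis F_scale : forall (q : rat) f, F f -> F (fun x => ratr q * f x).
Hypothesis hF : forall A, measurable A -> L1_approx (A `&` D).

Variables (r : R) (r1 : 1 <= r).
Let r0 : 0 < r. Proof. exact: lt_le_trans r1. Qed.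
Local Notation "'Nr' f" := (Lnorm mu r%:E (EFin \o f%R)) (at level 10, f at level 9).

Let measurable_normr_powR (f : X -> R) : measurable_fun setT f ->
  measurable_fun setT (fun x => (`|f x| `^ r)%:E).
Proof.
move=> mf; apply/measurable_EFinP.
by apply: (measurableT_comp (measurable_powR r)); exact: measurableT_comp.
Qed.

Lemma Lnorm_lt (f : X -> R) (eps : R) : 0 < eps ->
  (\int[mu]_x (`|f x| `^ r)%:E < (eps `^ r)%:E)%E -> (Nr f < eps%:E)%E.
Proof.
move=> e0 If; rewrite ltNge; apply/negP => eN.
move: If; rewrite ltNge => /negP; apply.
have -> : (\int[mu]_x (`|f x| `^ r)%:E = Nr f `^ r)%E.
  by rewrite poweR_Lnorm ?gt_eqF.
by rewrite -poweR_EFin; apply: gt0_ler_poweR;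
  rewrite ?in_itv/= ?lee_fin ?leey ?andbT ?Lnorm_ge0 ?(ltW e0) ?(ltW r0).
Qed.

Lemma LnormZr (c : R) (f : X -> R) : measurable_fun setT f ->
  (Nr (fun x => c * f x) = `|c|%:E * Nr f)%E.
Proof.
move=> mf; rewrite unlock.
under eq_integral do rewrite /= normrM powRM// EFinM.
rewrite ge0_integralZl//; first last.
  exact: measurable_normr_powR.
rewrite poweRM ?lee_fin ?powR_ge0//; last by apply: integral_ge0 => x _; rewrite lee_fin powR_ge0.
by rewrite poweR_EFin -powRrM mulfV ?gt_eqF// powRr1.
Qed.

Definition Lp_closure (g : X -> R) := measurable_fun setT g /\
  forall eps : R, 0 < eps -> exists2 f, F f & (Nr (g \- f) < eps%:E)%E.

Lemma Lp_closureD g h : Lp_closure g -> Lp_closure h -> Lp_closure (g \+ h).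
Proof.
move=> [mg hg] [mh hh]; split; first exact: measurable_funD.
move=> eps e0; have e20 : 0 < eps / 2 by rewrite divr_gt0.
have [f Ff If] := hg _ e20; have [k Fk Ik] := hh _ e20.
exists (f \+ k); first exact: FD.
have -> : (g \+ h) \- (f \+ k) = (g \- f) \+ (h \- k).
  by apply/funext => x /=; ring.
apply: le_lt_trans (minkowski_EFin _ _ _ _) _ => //.
- by apply: measurable_funB => //; exact: F_meas.
- by apply: measurable_funB => //; exact: F_meas.
by rewrite [eps]splitr EFinD; exact: lteD.
Qed.

(** Only rational scalars act on [F], so [c] is replaced by a rational [q] so close that the finite
    norm of [g] absorbs the error; [f] is chosen after [q]. *)
Lemma Lp_closureZ c g : (Nr g < +oo)%E -> Lp_closure g ->
  Lp_closure (fun x => c * g x).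
Proof.
move=> Ng [mg hg]; split; first exact: measurable_funM.
move=> eps e0; have e20 : 0 < eps / 2 by rewrite divr_gt0.
have Nfin : Nr g \is a fin_num by rewrite ge0_fin_numE// Lnorm_ge0.
pose M := fine (Nr g) + 1.
have M0 : 0 < M by rewrite ltr_wpDl// fine_ge0// Lnorm_ge0.
have [q cq] : exists q : rat, `|c - ratr q| < eps / 2 / M.
  have d0 : 0 < eps / 2 / M by rewrite divr_gt0.
  have : (c < c + eps / 2 / M) by rewrite ltrDl.
  move=> /rat_in_itvoo[q]; rewrite in_itv/= => /andP[q1 q2].
  by exists q; rewrite ltr_norml; apply/andP; split; lra.
have d0 : 0 < eps / 2 / (`|ratr q| + 1) by rewrite divr_gt0// ltr_wpDl.
have [f Ff If] := hg _ d0.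
exists (fun x => ratr q * f x); first exact: F_scale.
rewrite (_ : _ \- _ = (fun x => (c - ratr q) * g x) \+
                      (fun x => ratr q * (g \- f) x)); last first.
  by apply/funext => x /=; ring.
have mgf : measurable_fun setT (g \- f).
  by apply: measurable_funB => //; exact: F_meas.
apply: le_lt_trans (minkowski_EFin _ _ _ _) _ => //.
- exact: measurable_funM.
- exact: measurable_funM.
rewrite !LnormZr// [eps]splitr EFinD; apply: lteD.
  rewrite -(fineK Nfin) -EFinM lte_fin.
  apply: (@le_lt_trans _ _ (`|c - ratr q| * M)); last by rewrite -ltr_pdivlMr.
  by rewrite ler_wpM2l// /M lerDl.
have Nf : Nr (g \- f) \is a fin_num.
  by rewrite ge0_fin_numE ?Lnorm_ge0//; apply: lt_trans If _; rewrite ltry.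
move: If; rewrite -(fineK Nf) -EFinM !lte_fin ltr_pdivlMr ?ltr_wpDl// => {}If.
apply: le_lt_trans If; rewrite mulrC ler_wpM2l ?lerDl//.
by rewrite fine_ge0// Lnorm_ge0.
Qed.

(** The difference of an indicator and an approximant has modulus at most 1, hence its r-th power is
    below the modulus itself and an L^1 error [eps^r] gives an L^r error [eps]. *)
Lemma Lp_closure_indic A : measurable A -> A `<=` D ->
  Lp_closure \1_A /\ (Nr \1_A < +oo)%E.
Proof.
move=> mA AD; split; last first.
  rewrite unlock poweR_lty//; apply: (@le_lt_trans _ _ (mu A)).
    rewrite -[X in mu X](setIT A) -integral_indic//.
    apply: ge0_le_integral => //; last 2 first.
    + exact/measurable_EFinP.
    + move=> x _; rewrite /= indicE; case: (x \in A) => /=.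
        by rewrite normr1 powR1.
      by rewrite normr0 powR0// gt_eqF.
    + by move=> x _; exact: poweR_ge0.
    + exact: measurable_normr_powR.
  by apply: le_lt_trans muD; apply: le_measure; rewrite ?inE.
split; first exact: measurable_indic.
move=> eps e0; have er0 : 0 < eps `^ r by rewrite powR_gt0.
have := hF mA er0; rewrite (setIidl AD) => -[f [Ff f01 If]].
exists f => //; apply: Lnorm_lt => //; apply: le_lt_trans If.
have mf := F_meas Ff.
have mAf : measurable_fun setT (fun x => \1_A x - f x).
  by apply: measurable_funB => //; exact: measurable_indic.
apply: ge0_le_integral => //.
- exact: measurable_normr_powR.
- exact: measurable_abs_indicB.
move=> x _; rewrite lee_fin -[leRHS]powRr1//.
have [->|h0] := eqVneq (`|\1_A x - f x|) 0; first by rewrite !powR0// gt_eqF.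
apply: ger_powR => //; rewrite normr_gt0 -normr_eq0 h0/=.
have /andP[f0 f1] := f01 x; rewrite ler_norml indicE.
by case: (x \in A); apply/andP; split => /=; lra.
Qed.

Lemma Lp_closure_limit (g : X -> R) : measurable_fun setT g ->
  (forall eps : R, 0 < eps -> exists2 h, Lp_closure h & (Nr (g \- h) < eps%:E)%E) ->
  Lp_closure g.
Proof.
move=> mg hg; split => // eps e0; have e20 : 0 < eps / 2 by rewrite divr_gt0.
have [h [mh hh] Ih] := hg _ e20; have [f Ff If] := hh _ e20.
exists f => //.
have -> : g \- f = (g \- h) \+ (h \- f) by apply/funext => x /=; ring.
apply: le_lt_trans (minkowski_EFin _ _ _ _) _ => //.
- exact: measurable_funB.
- by apply: measurable_funB => //; exact: F_meas.
by rewrite [eps]splitr EFinD; exact: lteD.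
Qed.

Lemma Lp_closure_sum (I : Type) (s : seq I) (g : I -> X -> R) :
  (forall i, Lp_closure (g i)) -> Lp_closure (fun x => \sum_(i <- s) g i x).
Proof.
move=> hg; elim: s => [|i s ih].
  have [h0 _] := Lp_closure_indic measurable0 (@sub0set _ D).
  by rewrite indic0 in h0; under eq_fun do rewrite big_nil.
under eq_fun do rewrite big_cons; exact: Lp_closureD.
Qed.

Lemma Lp_closure_nnsfun (h : {nnsfun X >-> R}) : (forall x, ~ D x -> h x = 0) ->
  Lp_closure h.
Proof.
move=> hD.
rewrite (_ : (h : X -> R) = fun x => \sum_(y <- fset_set (range h)) y * \1_(h @^-1` [set y]) x); last first.
  by apply/funext => x; rewrite [LHS]fimfunE fsbig_finite.
apply: Lp_closure_sum => y.
have [->|y0] := eqVneq y 0.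
  rewrite (_ : (fun _ => _) = (fun x => 0 * \1_set0 x)); last first.
    by apply/funext => x; rewrite !mul0r.
  by have [h0 N0] := Lp_closure_indic measurable0 (@sub0set _ D); exact: Lp_closureZ.
have [] := @Lp_closure_indic (h @^-1` [set y]) _ _.
- by rewrite -[X in measurable X]setTI; exact: measurable_funP.
- by move=> x /= hx; apply: contrapT => /hD hx0; move: y0; rewrite -hx hx0 eqxx.
by move=> ? ?; exact: Lp_closureZ.
Qed.

(** Simple functions increasing to [g] converge in L^r by dominated convergence, with [|g|^r] as the
    dominating function. *)
Lemma Lp_closure_ge0 (g : X -> R) : measurable_fun setT g ->
  (forall x, 0 <= g x) -> (forall x, ~ D x -> g x = 0) -> (Nr g < +oo)%E ->
  Lp_closure g.
Proof.
move=> mg g0 gD Ng; apply: Lp_closure_limit => // eps e0.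
have er0 : 0 < eps `^ r by rewrite powR_gt0.
have mEg : measurable_fun setT (EFin \o g) by exact/measurable_EFinP.
pose h n := nnsfun_approx measurableT mEg n.
have hg n x : h n x <= g x.
  by rewrite -lee_fin /h nnsfun_approxE; apply: le_approx => // y _; rewrite lee_fin.
have cvh x : h n x @[n --> \oo] --> g x.
  have := @cvg_nnsfun_approx _ _ _ _ measurableT _ mEg (fun y _ => g0 y) x Logic.I.
  by move=> /fine_cvgP[].
have mgh n : measurable_fun setT (g \- h n) by exact: measurable_funB.
have : (\int[mu]_x (`|(g \- h n)%R x| `^ r)%:E)%E @[n --> \oo] --> (\int[mu]_x 0)%E.
  apply: (@dominated_cvg _ _ _ mu _ measurableT _ _ (fun x => (`|g x| `^ r)%:E)) => //.
  - by move=> n; exact: measurable_normr_powR.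
  - move=> x _; apply/cvg_EFin; first by apply: nearW.
    apply/cvgrPdist_lt => e' e'0.
    have [d' d'0 hd'] := powR_normr_small r0 e'0.
    near=> n; rewrite /= sub0r normrN ger0_norm ?powR_ge0//; apply: hd'.
    by near: n; exact: cvgr_dist_lt.
  - apply/integrableP; split.
      exact: measurable_normr_powR.
    move: Ng; rewrite unlock => /lty_poweRy -/(_ (lt0r_neq0 _)).
    under [in X in _ -> X]eq_integral do rewrite gee0_abs ?lee_fin ?powR_ge0//.
    by apply; rewrite invr_gt0.
  - move=> n x _; rewrite gee0_abs ?lee_fin ?powR_ge0//.
    apply: ge0_ler_powR; rewrite ?nnegrE ?(ltW r0)//=.
    rewrite !ger0_norm ?subr_ge0//; first by rewrite lerBlDr lerDl fun_ge0.
rewrite integral0 => /cvge_near_lt => /(_ (eps `^ r)%:E); rewrite lte_fin.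
move=> /(_ er0) [n _ /(_ n (leqnn n)) hn].
exists (h n); last exact: Lnorm_lt.
apply: Lp_closure_nnsfun => x /gD gx; apply/eqP; rewrite eq_le -{1}gx hg/=.
by rewrite fun_ge0.
Unshelve. all: by end_near. Qed.

Theorem Lp_dense (g : X -> R) : measurable_fun setT g ->
  (forall x, ~ D x -> g x = 0) -> (Nr g < +oo)%E ->
  forall eps : R, 0 < eps -> exists2 f, F f & (Nr (g \- f) < eps%:E)%E.
Proof.
move=> mg gD Ng; suff [] : Lp_closure g by [].
have Nle (h : X -> R) : measurable_fun setT h -> (forall x, `|h x| <= `|g x|) ->
    (Nr h < +oo)%E.
  move=> mh hg; apply: le_lt_trans Ng; rewrite unlock.
  apply: gt0_ler_poweR; rewrite ?invr_ge0 ?(ltW r0)//.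
  - by rewrite in_itv/= leey andbT integral_ge0// => x _; rewrite lee_fin powR_ge0.
  - by rewrite in_itv/= leey andbT integral_ge0// => x _; rewrite lee_fin powR_ge0.
  apply: ge0_le_integral => //=.
  - exact: measurable_normr_powR.
  - exact: measurable_normr_powR.
  - move=> x _; rewrite lee_fin; apply: ge0_ler_powR; rewrite ?nnegrE ?(ltW r0)//.
have mp : measurable_fun setT (fun x => Num.max (g x) 0) by exact: measurable_maxr.
have mn : measurable_fun setT (fun x => Num.max (- g x) 0).
  by apply: measurable_maxr => //; exact: measurableT_comp.
have hp : Lp_closure (fun x => Num.max (g x) 0).
  apply: Lp_closure_ge0 => //.
  - by move=> x; rewrite le_max lexx orbT.
  - by move=> x /gD ->; rewrite maxxx.
  - by apply: Nle => // x; case: (leP (g x) 0) => _; rewrite ?normr0.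
have hn : Lp_closure (fun x => Num.max (- g x) 0).
  apply: Lp_closure_ge0 => //.
  - by move=> x; rewrite le_max lexx orbT.
  - by move=> x /gD ->; rewrite oppr0 maxxx.
  - by apply: Nle => // x; case: (leP (- g x) 0) => _; rewrite ?normr0 ?normrN.
have -> : g = (fun x => Num.max (g x) 0) \+ (fun x => - 1 * Num.max (- g x) 0).
  apply/funext => x /=; case: (leP (g x) 0); case: (leP (- g x) 0) => ? ?; lra.
apply: Lp_closureD => //; apply: Lp_closureZ => //.
by apply: Nle => // x; case: (leP (- g x) 0) => _; rewrite ?normr0 ?normrN.
Qed.

End Lp_density.

(** * Test functions *)

Section row_vectors.
Context (R : realType) (n : nat).
Local Notation Rn := 'rV[R]_n.
Implicit Types x y a b : Rn.

Lemma rV_norm_ltP x (e : R) : 0 < e ->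
  `|x| < e <-> forall i, `|x ord0 i| < e.
Proof.
move=> e0; rewrite {1}/Num.norm/= mx_normrE; split => [/bigmax_ltP[_ h] i|h].
  exact: (h (ord0, i)).
by apply/bigmax_ltP; split => // -[i j] _ /=; rewrite (ord1 i).
Qed.

Lemma coord_le_norm x i : `|x ord0 i| <= `|x|.
Proof.
rewrite [leRHS]/Num.norm/= mx_normrE; apply/bigmax_geP; right => /=.
by exists (ord0, i).
Qed.

Definition obox a b : set Rn := [set x | forall i, a ord0 i < x ord0 i < b ord0 i].
Definition cbox a b : set Rn := [set x | forall i, a ord0 i <= x ord0 i <= b ord0 i].

Lemma obox_cbox a b : obox a b `<=` cbox a b.
Proof. by move=> x h i; have /andP[/ltW -> /ltW ->] := h i. Qed.

Lemma compact_cbox a b : compact (cbox a b).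
Proof.
rewrite (_ : cbox a b = [set x : Rn | forall i, `[a ord0 i, b ord0 i]%classic (x ord0 i)]).
  by apply: (@rV_compact _ _ (fun i => `[a ord0 i, b ord0 i]%classic)) => i; exact: segment_compact.
by apply/seteqP; split => x h i; have := h i; rewrite /= in_itv.
Qed.

Definition ratv (q : 'rV[rat]_n) : Rn := map_mx ratr q.

(** Both boxes matter: a bump is positive exactly on the open one, while the closed one is the
    compact set that must stay inside [U]. *)
Lemma open_rat_box (U : set Rn) x : open U -> U x ->
  exists a b : 'rV[rat]_n, obox (ratv a) (ratv b) x /\ cbox (ratv a) (ratv b) `<=` U.
Proof.
move=> /[swap] Ux; rewrite openE => /(_ _ Ux) /nbhs_ballP[e /= e0 eU].
have /choice[a ha] i : exists q : rat, x ord0 i - e < ratr q < x ord0 i.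
  have /rat_in_itvoo[q] : x ord0 i - e < x ord0 i by rewrite ltrBlDr ltrDl.
  by rewrite in_itv/=; exists q.
have /choice[b hb] i : exists q : rat, x ord0 i < ratr q < x ord0 i + e.
  have /rat_in_itvoo[q] : x ord0 i < x ord0 i + e by rewrite ltrDl.
  by rewrite in_itv/=; exists q.
exists (\row_i a i), (\row_i b i); split.
  move=> i; rewrite !mxE; have /andP[_ ->] := ha i.
  by have /andP[-> _] := hb i.
move=> y hy; apply: eU; rewrite -ball_normE /ball_/=; apply/rV_norm_ltP => // i.
have := hy i; rewrite !mxE; have := ha i; have := hb i.
by move=> /andP[? ?] /andP[? ?] /andP[? ?]; rewrite ltr_norml; apply/andP; split; lra.
Qed.

Lemma measurable_vec_obox a b : measurable ((@vec R n) @^-1` obox a b).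
Proof.
rewrite (_ : _ @^-1` _ = \bigcap_(i in [set: 'I_n])
    ((fun s : n.-tuple (measurableTypeR R) => tnth s i) @^-1` `]a ord0 i, b ord0 i[%classic)).
  apply: fin_bigcap_measurable => // i _.
  rewrite -[X in measurable X]setTI; apply: measurable_tnth => //.
apply/seteqP; split => [s h i _|s h i].
  by have := h i; rewrite mxE /= in_itv.
by have := h i I; rewrite /= in_itv/= mxE.
Qed.

Lemma measurable_vec_open (U : set Rn) : open U -> measurable ((@vec R n) @^-1` U).
Proof.
move=> oU.
rewrite (_ : U = \bigcup_(q in [set q : 'rV[rat]_n * 'rV[rat]_n |
    cbox (ratv q.1) (ratv q.2) `<=` U]) obox (ratv q.1) (ratv q.2)).
  rewrite bigcup_mkcond preimage_bigcup; apply: countable_bigcupT_measurable => [|q].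
    exact: countableP.
  by case: ifPn => _; [exact: measurable_vec_obox|rewrite preimage_set0].
apply/seteqP; split => [x /(open_rat_box oU)[a [b [abx abU]]]|x [q /= qU /obox_cbox/qU]//].
by exists (a, b).
Qed.

Lemma measurable_vec_closed (U : set Rn) : closed U -> measurable ((@vec R n) @^-1` U).
Proof.
move=> cU; rewrite -[U]setCK preimage_setC; apply: measurableC.
exact: (measurable_vec_open (closed_openC cU)).
Qed.

Lemma measurable_comp_vec (g : Rn -> R) : continuous g ->
  measurable_fun setT (g \o @vec R n).
Proof.
move=> /continuousP cg; apply: (measurability _ (RGenOpens.measurableE R)).
move=> _ [_ [a [b ->]] <-]; rewrite setTI.
exact: (measurable_vec_open (cg _ (interval_open _ _))).
Qed.

End row_vectors.

Section smooth.
Context (R : realType) (n : nat).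
Local Notation Rn := 'rV[R]_n.
Implicit Types f g : Rn -> R.

Lemma Ck_continuous k f : Ck k f -> continuous f.
Proof. by case: k => [|k] []. Qed.

Lemma CkW k f : Ck k.+1 f -> Ck k f.
Proof.
elim: k f => [|k ih] f [cf hf]; first by split.
by split => // j; have [df pf] := hf j; split => //; exact: ih.
Qed.

Lemma Csmooth_continuous f : Csmooth f -> continuous f.
Proof. by move=> /(_ 0%N)[]. Qed.

Lemma Csmooth_partial j f : Csmooth f -> Csmooth (partial j f).
Proof. by move=> h k; have [_ /(_ j)[]] := h k.+1. Qed.

Lemma Ck_cst k c : Ck k (fun _ : Rn => c : R).
Proof.
elim: k c => [|k ih] c; first by split => //; exact: cst_continuous.
split => [|j]; first exact: cst_continuous.
split => [x|]; first exact: derivable_cst.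
by rewrite (_ : partial j _ = fun=> 0)//; apply/funext => x; exact: derive_cst.
Qed.

Lemma CkD k f g : Ck k f -> Ck k g -> Ck k (f \+ g).
Proof.
elim: k f g => [|k ih] f g [cf hf] [cg hg].
  by split => // x; apply: continuousD; [exact: cf|exact: cg].
split => [x|j]; first by apply: continuousD; [exact: cf|exact: cg].
have [df pf] := hf j; have [dg pg] := hg j.
split => [x|]; first exact: derivableD.
rewrite (_ : partial j _ = partial j f \+ partial j g); first exact: ih.
by apply/funext => x; exact: deriveD.
Qed.

Lemma CkM k f g : Ck k f -> Ck k g -> Ck k (f \* g).
Proof.
elim: k f g => [|k ih] f g hf hg; have := hf; have := hg; move=> [cg hg'] [cf hf'].
  by split => // x; apply: continuousM; [exact: cf|exact: cg].
split => [x|j]; first by apply: continuousM; [exact: cf|exact: cg].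
have [df pf] := hf' j; have [dg pg] := hg' j.
split => [x|]; first exact: derivableM.
rewrite (_ : partial j _ = f \* partial j g \+ g \* partial j f).
  by apply: CkD; apply: ih => //; exact: CkW.
by apply/funext => x; exact: deriveM.
Qed.

Lemma Csmooth_cst c : Csmooth (fun _ : Rn => c : R). Proof. by move=> k; exact: Ck_cst. Qed.

Lemma CsmoothD f g : Csmooth f -> Csmooth g -> Csmooth (f \+ g).
Proof. by move=> hf hg k; exact: CkD. Qed.

Lemma CsmoothM f g : Csmooth f -> Csmooth g -> Csmooth (f \* g).
Proof. by move=> hf hg k; exact: CkM. Qed.

Lemma Csmooth_prod (I : Type) (s : seq I) (f : I -> Rn -> R) :
  (forall i, Csmooth (f i)) -> Csmooth (fun x => \prod_(i <- s) f i x).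
Proof.
move=> hf; elim: s => [|i s ih].
  by under eq_fun do rewrite big_nil; exact: Csmooth_cst.
by under eq_fun do rewrite big_cons; exact: CsmoothM.
Qed.

End smooth.

Section flat_exp.
Context (R : realType).
Implicit Types (t : R) (m : nat).

(** The classical flat function [exp(-1/t)] times [t^(-m)]. The extra powers make the family stable
    under differentiation, up to linear combinations, so smoothness becomes an induction over all
    [m] at once. *)
Definition flat_exp m t : R := if 0 < t then t^-1 ^+ m * expR (- t^-1) else 0.

Lemma flat_exp_ge0 m t : 0 <= flat_exp m t.
Proof.
rewrite /flat_exp; case: ifPn => // t0.
by rewrite mulr_ge0 ?expR_ge0// exprn_ge0// invr_ge0 ltW.
Qed.

Lemma flat_exp0_le1 t : flat_exp 0 t <= 1.
Proof.
rewrite /flat_exp; case: ifPn => // t0.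
by rewrite expr0 mul1r expR_le1 oppr_le0 invr_ge0 ltW.
Qed.

Lemma flat_exp0_gt0 t : (0 < flat_exp 0 t) = (0 < t).
Proof.
rewrite /flat_exp; case: ifPn => t0; last by rewrite ltxx.
by rewrite expr0 mul1r expR_gt0.
Qed.

(** With [v = 1/t], this is [exp(v) >= v^(m+1) / (m+1)!]. It yields flatness at the origin. *)
Lemma flat_exp_le m t : flat_exp m t <= m.+1`!%:R * `|t|.
Proof.
rewrite /flat_exp; case: ifPn => t0; last by rewrite mulr_ge0.
have v0 : 0 < t^-1 by rewrite invr_gt0.
rewrite expRN ler_pdivrMr ?expR_gt0// (gtr0_norm t0).
have := expR_ge1Dxn m (ltW v0) => h.
have {}h : t^-1 ^+ m.+1 / m.+1`!%:R <= expR t^-1 by apply: le_trans h; rewrite lerDr.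
rewrite ler_pdivrMr ?ltr0n ?fact_gt0// in h.
rewrite exprS ler_pdivrMl// in h.
by rewrite (le_trans h)// le_eqVlt; apply/orP; left; apply/eqP; ring.
Qed.

Lemma is_derive_flat_exp m t :
  is_derive t 1 (flat_exp m) (flat_exp m.+2 t - m%:R * flat_exp m.+1 t).
Proof.
have [t0|t0|->] := ltgtP t 0.
- apply: (@near_eq_is_derive _ _ _ (cst 0)).
    near=> s; rewrite /flat_exp ifN// -leNgt ltW//.
    by near: s; exact: lt_nbhsl.
  by rewrite /flat_exp !ifN -?leNgt ?ltW// mulr0 subr0; exact: is_derive_cst.
- have tn0 : t != 0 by rewrite gt_eqF.
  have dV : is_derive t 1 (fun s : R => s^-1 : R^o) (- t^-1 ^+ 2).
    apply: DeriveDef; first by apply: derivableV => //; exact: derivable_id.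
    by rewrite deriveV ?derive_id// exprVn; exact: mulr1.
  have dE : is_derive t 1 (fun s : R => expR (- s^-1) : R^o) (t^-1 ^+ 2 * expR (- t^-1)).
    have dN : is_derive t 1 (fun s : R => - s^-1 : R^o) (t^-1 ^+ 2).
      by apply: (is_derive_eq (is_deriveN dV)); rewrite opprK.
    have := @is_derive1_comp _ expR (fun s => - s^-1) t _ _ (is_derive_expR _) dN.
    by rewrite mulrC.
  apply: (@near_eq_is_derive _ _ _ (fun s : R => s^-1 ^+ m * expR (- s^-1) : R^o)).
    near=> s; rewrite /flat_exp ifT//.
    by near: s; exact: lt_nbhsr.
  have dX : is_derive t 1 (fun s : R => s^-1 ^+ m : R^o) (- m%:R * t^-1 ^+ m.+1).
    elim: (m) => [|k dk]; first by rewrite oppr0 mul0r; exact: is_derive_cst.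
    apply: (@is_derive_eq _ _ _ (fun s : R => s^-1 ^+ k.+1 : R^o)).
      by under eq_fun do rewrite exprS; exact: is_deriveM dV dk.
    by rewrite /GRing.scale/= !exprS -natr1; ring.
  apply: (is_derive_eq (is_deriveM dX dE)).
  rewrite /flat_exp t0 /GRing.scale/= !exprS; ring.
- rewrite {2 3}/flat_exp ltxx mulr0 subr0.
  have cv0 : (fun h : R => h^-1 *: ((flat_exp m \o shift 0) (h *: 1) - flat_exp m 0)) @ 0^' --> (0 : R^o).
    apply/cvgrPdist_lt => e e0.
    have C0 : 0 < m.+2`!%:R :> R by rewrite ltr0n fact_gt0.
    near=> h; have h0 : h != 0 by near: h; exact: nbhs_dnbhs_neq.
    rewrite /= addr0 {2}/flat_exp ltxx subr0 sub0r normrN /GRing.scale/= mulr1.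
    (* At the origin the difference quotient is the next member of the family, which tends to 0 by
       [flat_exp_le]. *)
    rewrite (_ : h^-1 * _ = flat_exp m.+1 h); last first.
      by rewrite /flat_exp; case: ifPn; rewrite ?mulr0// exprS mulrA.
    rewrite ger0_norm ?flat_exp_ge0//; apply: (le_lt_trans (flat_exp_le _ _)).
    rewrite -ltr_pdivlMl//.
    near: h; apply: dnbhs0_lt; by rewrite mulr_gt0 ?invr_gt0.
  by apply: DeriveDef; [apply/cvg_ex; exists 0|exact: cvg_lim cv0].
Unshelve. all: by end_near. Qed.

Lemma flat_exp_derivable m t : derivable (flat_exp m) t 1.
Proof. by have [] := is_derive_flat_exp m t. Qed.

Lemma flat_exp_continuous m : continuous (flat_exp m).
Proof.
move=> t; apply: differentiable_continuous.
by apply/derivable1_diffP; exact: flat_exp_derivable.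
Qed.

End flat_exp.

Section bump.
Context (R : realType) (n : nat).
Local Notation Rn := 'rV[R]_n.

(** Along a basis vector the difference quotient coincides with that of the one-variable function
    along the increment [w]. The derivative is a combination of the members [m.+2] and [m.+1], so
    the induction on [k] keeps [m] general. *)
Lemma Ck_flat_exp_affine k m (s c : R) (i : 'I_n) :
  Ck k (fun x : Rn => flat_exp m (s * x ord0 i + c)).
Proof.
have ct m' : continuous (fun x : Rn => flat_exp m' (s * x ord0 i + c)).
  have ca : continuous (fun x : Rn => s * x ord0 i + c).
    suff /Ck_continuous : Ck 0 (((fun=> s) \* (fun y : Rn => y ord0 i)) \+ (fun=> c)) by [].
    apply: CkD; last exact: Ck_cst.
    by apply: CkM; [exact: Ck_cst|split => //; exact: coord_continuous].
  by move=> x; exact: (continuous_comp (ca x) (@flat_exp_continuous _ m' _)).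
have dfw m' t w : is_derive t w (flat_exp m' : R -> R^o)
    (w * (flat_exp m'.+2 t - m'%:R * flat_exp m'.+1 t)).
  have dd := is_derive_flat_exp m' t.
  have df : differentiable (flat_exp m' : R -> R^o) t.
    by apply/derivable1_diffP; exact: flat_exp_derivable.
  apply: DeriveDef; first exact: diff_derivable.
  rewrite deriveE// deriv1E; last exact: flat_exp_derivable.
  by rewrite derive1E (@derive_val _ _ _ _ _ _ _ dd).
elim: k m => [|k ih] m; first by split.
split => // j; set w := s * (basis_vec R j) ord0 i.
have key x : is_derive x (basis_vec R j) (fun x : Rn => flat_exp m (s * x ord0 i + c) : R^o)
    (w * (flat_exp m.+2 (s * x ord0 i + c) - m%:R * flat_exp m.+1 (s * x ord0 i + c))).
  have [d1 d2] := dfw m (s * x ord0 i + c) w.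
  have E : (fun h : R => h^-1 *: (((fun x : Rn => flat_exp m (s * x ord0 i + c) : R^o) \o shift x) (h *: basis_vec R j) - flat_exp m (s * x ord0 i + c))) =
    (fun h : R => h^-1 *: (((flat_exp m : R -> R^o) \o shift (s * x ord0 i + c)) (h *: w) - flat_exp m (s * x ord0 i + c))).
    apply/funext => h /=; congr (_ *: (flat_exp m _ - _)).
    have -> : (h *: basis_vec R j + x) ord0 i = h * basis_vec R j ord0 i + x ord0 i.
      by rewrite !mxE.
    by rewrite -[h *: w]/(h * w) /w; ring.
  by apply: DeriveDef; [rewrite /derivable E|rewrite -d2 /derive E].
split => [x|]; first by case: (key x).
rewrite (_ : partial j _ = (fun=> w) \* ((fun x => flat_exp m.+2 (s * x ord0 i + c)) \+ (fun=> - m%:R) \* (fun x => flat_exp m.+1 (s * x ord0 i + c)))).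
  apply: CkM; first exact: Ck_cst.
  apply: CkD; first exact: ih.
  by apply: CkM; [exact: Ck_cst|exact: ih].
apply/funext => x /=; rewrite /partial; have [_ ->] := key x.
by rewrite mulNr.
Qed.

Definition box_bump (a b x : Rn) : R :=
  \prod_(i < n) (flat_exp 0 (x ord0 i - a ord0 i) * flat_exp 0 (b ord0 i - x ord0 i)).

Lemma Csmooth_box_bump a b : Csmooth (box_bump a b).
Proof.
apply: Csmooth_prod => i; apply: CsmoothM.
  rewrite (_ : (fun _ => _) = fun x : Rn => flat_exp 0 (1 * x ord0 i + - a ord0 i)).
    by move=> k; exact: Ck_flat_exp_affine.
  by apply/funext => x; rewrite mul1r.
rewrite (_ : (fun _ => _) = fun x : Rn => flat_exp 0 (- 1 * x ord0 i + b ord0 i)).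
  by move=> k; exact: Ck_flat_exp_affine.
by apply/funext => x; rewrite mulN1r addrC.
Qed.

Lemma box_bump_ge0 a b x : 0 <= box_bump a b x.
Proof. by apply: prodr_ge0 => i _; rewrite mulr_ge0 ?flat_exp_ge0. Qed.

Lemma box_bump_le1 a b x : box_bump a b x <= 1.
Proof.
apply: prodr_ile1 => i _; rewrite mulr_ge0 ?flat_exp_ge0//=.
by rewrite mulr_ile1 ?flat_exp_ge0 ?flat_exp0_le1.
Qed.

Lemma box_bump_gt0 a b x : 0 < box_bump a b x <-> obox a b x.
Proof.
split => [h i|h]; last first.
  apply: prodr_gt0 => i _; have /andP[ai bi] := h i.
  by rewrite mulr_gt0// flat_exp0_gt0 subr_gt0.
have : flat_exp 0 (x ord0 i - a ord0 i) * flat_exp 0 (b ord0 i - x ord0 i) != 0.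
  by have /lt0r_neq0/prodf_neq0 := h; apply.
rewrite mulf_eq0 negb_or => /andP[h1 h2].
by rewrite -subr_gt0 -flat_exp0_gt0 lt0r h1 flat_exp_ge0/= -subr_gt0 -flat_exp0_gt0 lt0r h2 flat_exp_ge0.
Qed.

Lemma box_bump_eq0 a b x : ~ obox a b x -> box_bump a b x = 0.
Proof.
move=> h; apply/eqP; rewrite eq_le box_bump_ge0 andbT leNgt.
by apply/negP => /box_bump_gt0.
Qed.

End bump.

Section test_functions.
Context (R : realType) (n : nat).
Local Notation Rn := 'rV[R]_n.
Variable Q : set Rn.
Implicit Types f g : Rn -> R.

Lemma test_fun_box_bump a b : cbox a b `<=` Q -> test_fun Q (box_bump a b).
Proof.
move=> abQ; split; first exact: Csmooth_box_bump.
exists (cbox a b); split => //; first exact: compact_cbox.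
by move=> x abx; apply: box_bump_eq0 => /obox_cbox.
Qed.

Lemma test_funM f g : Csmooth f -> test_fun Q g -> test_fun Q (f \* g).
Proof.
move=> sf [sg [K [cK KQ g0]]]; split; first exact: CsmoothM.
by exists K; split => // x /g0 /= ->; rewrite mulr0.
Qed.

Lemma test_funD f g : test_fun Q f -> test_fun Q g -> test_fun Q (f \+ g).
Proof.
move=> [sf [K [cK KQ f0]]] [sg [L [cL LQ g0]]]; split; first exact: CsmoothD.
exists (K `|` L); split; first exact: compactU.
  by rewrite subUset.
by move=> x /not_orP[/f0 /= -> /g0 ->]; rewrite addr0.
Qed.

Lemma test_funZ c f : test_fun Q f -> test_fun Q (fun x => c * f x).
Proof. by move=> tf; apply: (@test_funM (fun=> c)) => //; exact: Csmooth_cst. Qed.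

Lemma test_funB f g : test_fun Q f -> test_fun Q g -> test_fun Q (f \- g).
Proof.
move=> tf tg; rewrite (_ : f \- g = f \+ (fun x => - 1 * g x)).
  by apply: test_funD => //; exact: test_funZ.
by apply/funext => x /=; rewrite mulN1r.
Qed.

Lemma test_fun_partial j f : test_fun Q f -> test_fun Q (partial j f).
Proof.
move=> [sf [K [cK KQ f0]]]; split; first exact: Csmooth_partial.
exists K; split => // x Kx.
have cl : closed K by apply: compact_closed => //; exact: norm_hausdorff.
have oK : open (~` K) by exact: closed_openC.
rewrite /partial (@near_eq_derive _ _ _ f (cst 0)) ?derive_cst//.
by near=> y; apply: f0; near: y; exact: open_nbhs_nbhs.
Unshelve. all: by end_near. Qed.

Lemma test_fun_bounded f : test_fun Q f -> exists M : R, forall x, `|f x| <= M.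
Proof.
move=> [sf [K [cK KQ f0]]].
have /compact_bounded[M [_ hM]] : compact (f @` K).
  apply: continuous_compact => //; apply: continuous_subspaceT.
  exact: Csmooth_continuous.
exists (`|M| + 1) => x; have [Kx|/f0 ->] := pselect (K x).
  by apply: hM; [rewrite (le_lt_trans (ler_norm M))// ltrDl|exists x].
by rewrite normr0 addr_ge0.
Qed.

End test_functions.

(** * A countable dense family of test functions *)

Section lebesgue_tuple_facts.
Context (R : realType).

Lemma lebesgue_tuple_cube (n : nat) (r : R) :
  (lebesgue_tuple R n [set s | forall i, (`|tnth s i| <= r)%R] < +oo)%E.
Proof.
elim: n => [|n ih].
  by rewrite /= diracE ltry.
rewrite /= /lebesgue_cons /pushforward.
rewrite (_ : _ @^-1` _ = `[- r, r]%classic `*`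
    [set s : n.-tuple (measurableTypeR R) | forall i, (`|tnth s i| <= r)%R]).
  rewrite product_measure1E//.
    have h : (lebesgue_measure `[(- r)%R, r]%classic \is a fin_num)%E.
      by rewrite lebesgue_measure_itv/=; case: ifPn.
    by apply: lte_mul_pinfty.
  rewrite (_ : [set s | _] = \bigcap_(i in [set: 'I_n])
      ((fun s : n.-tuple (measurableTypeR R) => tnth s i) @^-1` `[- r, r]%classic)).
    apply: fin_bigcap_measurable => // i _.
    by rewrite -[X in measurable X]setTI; apply: measurable_tnth.
  apply/seteqP; split => [s h i _|s h i].
    by have := h i; rewrite /= in_itv/= ler_norml.
  by have := h i I; rewrite /= in_itv/= ler_norml.
apply/seteqP; split => [[x s] h|[x s] [/= hx hs] i].
  split => /=; first by have := h ord0; rewrite /= in_itv/= ler_norml.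
  move=> i; have := h (lift ord0 i).
  by rewrite /cons_pair/= tnthS.
case: (unliftP ord0 i) => [j ->|->]; first by rewrite /cons_pair/= tnthS.
by move: hx; rewrite in_itv/= ler_norml.
Qed.

(** The product sigma-algebra is generated by coordinate preimages of open intervals, and these are
    already preimages of open sets under [vec]. *)
Lemma measurable_tuple_ind (n : nat) (A : set (set (n.-tuple (measurableTypeR R)))) :
  sigma_algebra setT A ->
  (forall U : set 'rV[R]_n, open U -> A ((@vec R n) @^-1` U)) ->
  measurable `<=` A.
Proof.
move=> sA hA; apply: smallest_sub => // S.
rewrite -bigcup_seq => -[i _ [B mB <-]].
have : <<s @RGenOpens.G R >> `<=` image_set_system setT (fun s : n.-tuple (measurableTypeR R) => tnth s i) A.
  apply: smallest_sub; first exact: sigma_algebra_image.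
  move=> _ [x [y ->]]; rewrite /image_set_system/= setTI.
  have := hA ((fun v : 'rV[R]_n => v ord0 i) @^-1` `]x, y[%classic).
  rewrite (_ : (@vec R n) @^-1` _ = (fun s : n.-tuple (measurableTypeR R) => tnth s i) @^-1` `]x, y[%classic).
    apply; apply: open_comp; last exact: interval_open.
    by move=> ? _; exact: coord_continuous.
  by apply/seteqP; split => s /=; rewrite mxE.
by apply; have := mB; rewrite (RGenOpens.measurableE R).
Qed.

End lebesgue_tuple_facts.

Section test_family.
Context (R : realType) (n : nat) (Q : set 'rV[R]_n).
Local Notation Rn := 'rV[R]_n.

(* The index [j] encodes a rational box or a Q-algebra operation on members of level [k]. *)
Fixpoint tfam (k j : nat) : Rn -> R :=
  match k with
  | 0 => if (choice.unpickle j : option ('rV[rat]_n * 'rV[rat]_n)) is Some (a, b) then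
           if `[< cbox (ratv R a) (ratv R b) `<=` Q >] then box_bump (ratv R a) (ratv R b)
           else fun=> 0
         else fun=> 0
  | k'.+1 => if (choice.unpickle j : option (nat * nat * nat * rat)) is Some (o, u, v, q) then
           match o with
           | 0 => tfam k' u \+ tfam k' v
           | 1 => tfam k' u \- tfam k' v
           | 2 => tfam k' u \* tfam k' v
           | _ => fun x => ratr q * tfam k' u x
           end
         else fun=> 0
  end.

Definition tfams : set (Rn -> R) := [set f | exists k j, f = tfam k j].

Lemma test_fun0 : test_fun Q (fun=> 0 : R).
Proof.
split; first exact: Csmooth_cst.
by exists set0; split => //; exact: compact0.
Qed.

Lemma tfams_test f : tfams f -> test_fun Q f.
Proof.
move=> [k [j ->]]; elim: k j => [|k ih] j /=.
  case: choice.unpickle => [[a b]|]; last exact: test_fun0.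
  by case: asboolP => h; [exact: test_fun_box_bump|exact: test_fun0].
case: choice.unpickle => [[[[c u] v] q]|]; last exact: test_fun0.
case: c => [|[|[|o]]].
- exact: test_funD.
- exact: test_funB.
- by apply: test_funM => //; case: (ih u).
- exact: test_funZ.
Qed.

Let tfam_code k o u v q : tfam k.+1 (choice.pickle (o, u, v, q : rat)) =
  match o : nat with
           | 0 => tfam k u \+ tfam k v
           | 1 => tfam k u \- tfam k v
           | 2 => tfam k u \* tfam k v
           | _ => fun x => ratr (q : rat) * tfam k u x
           end.
Proof. by rewrite /= choice.pickleK. Qed.

(** Operation code 3 with the rational 1 copies a member to the next level; this brings two members
    to a common level before they are combined. *)
Lemma tfam_lift k l u : (k <= l)%N -> exists v, tfam l v = tfam k u.
Proof.
move=> kl; rewrite -(subnK kl); elim: (l - k)%N => [|m [v hv]]; first by exists u.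
exists (choice.pickle (3%N, v, 0%N, 1 : rat)); rewrite addSn tfam_code.
by apply/funext => x; rewrite hv rmorph1 mul1r.
Qed.

Let tfams_op o f g (q : rat) : tfams f -> tfams g -> tfams
  match o : nat with
           | 0 => f \+ g
           | 1 => f \- g
           | 2 => f \* g
           | _ => fun x => ratr (q : rat) * f x
           end.
Proof.
move=> [k [u ->]] [l [v ->]].
have [u' <-] := tfam_lift u (leq_maxl k l).
have [v' <-] := tfam_lift v (leq_maxr k l).
by exists (maxn k l).+1, (choice.pickle (o, u', v', q)); rewrite tfam_code.
Qed.

Lemma tfamsD f g : tfams f -> tfams g -> tfams (f \+ g).
Proof. exact: (tfams_op 0 0). Qed.
Lemma tfamsB f g : tfams f -> tfams g -> tfams (f \- g).
Proof. exact: (tfams_op 1 0). Qed.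
Lemma tfamsM f g : tfams f -> tfams g -> tfams (f \* g).
Proof. exact: (tfams_op 2 0). Qed.
Lemma tfamsZ (q : rat) f : tfams f -> tfams (fun x => ratr q * f x).
Proof. by move=> h; exact: (tfams_op 3 q h h). Qed.

Lemma tfams_box_bump a b : cbox (ratv R a) (ratv R b) `<=` Q -> tfams (box_bump (ratv R a) (ratv R b)).
Proof.
by move=> h; exists 0%N, (choice.pickle (a, b)); rewrite /= choice.pickleK; case: asboolP.
Qed.

(* Increases to the indicator of [f > 0] when [0 <= f <= 1]. *)
Fixpoint saturate (f : Rn -> R) (m : nat) : Rn -> R :=
  if m is m'.+1 then f \+ saturate f m' \- f \* saturate f m' else f.

Lemma tfams_saturate f m : tfams f -> tfams (saturate f m).
Proof.
by move=> h; elim: m => //= m ih; apply: tfamsB; [exact: tfamsD|exact: tfamsM].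
Qed.

Lemma saturateE f m x : saturate f m x = 1 - (1 - f x) ^+ m.+1.
Proof. by elim: m => /= [|m ->]; rewrite ?exprS; ring. Qed.

End test_family.

Section test_density.
Context (R : realType) (n : nat) (Q : set 'rV[R]_n).
Hypotheses (oQ : open Q) (bQ : bounded_set Q).
Local Notation Rn := 'rV[R]_n.
Local Notation X := (n.-tuple (measurableTypeR R)).
Local Notation leb := (lebesgue_tuple R n).
Local Notation D := ((@vec R n) @^-1` Q).

Lemma measurable_vec_Q : measurable D. Proof. exact: measurable_vec_open. Qed.

Lemma lebesgue_bounded_lty : (leb D < +oo)%E.
Proof.
have [M [_ hM]] := bQ.
apply: le_lt_trans (lebesgue_tuple_cube n (`|M| + 1)).
have mcube : measurable [set s : X | forall i, `|tnth s i| <= `|M| + 1].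
  rewrite (_ : [set s | _] = (@vec R n) @^-1` (cbox (const_mx (- (`|M| + 1))) (const_mx (`|M| + 1)))).
    apply: measurable_vec_closed; apply: compact_closed; first exact: norm_hausdorff.
    exact: compact_cbox.
  by apply/seteqP; split => s h i; have := h i; rewrite !mxE ler_norml.
apply: le_measure; rewrite ?inE//; first exact: measurable_vec_Q.
move=> s Qs i; have := coord_le_norm (vec s) i; rewrite mxE => /le_trans; apply.
by apply: (hM (`|M| + 1)) => //; rewrite (le_lt_trans (ler_norm M))// ltrDl.
Qed.

Definition tfams_vec : set (X -> R) := [set f | exists2 g, tfams Q g & f = g \o @vec R n].

Lemma test_fun_continuous f : test_fun Q f -> continuous f.
Proof. by move=> [/Csmooth_continuous]. Qed.

Lemma tfams_vec_meas f : tfams_vec f -> measurable_fun setT f.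
Proof.
move=> [g /tfams_test tg ->]; apply: measurable_comp_vec.
exact: test_fun_continuous.
Qed.

Lemma test_fun_off f x : test_fun Q f -> ~ Q x -> f x = 0.
Proof. by move=> [_ [K [_ KQ f0]]] Qx; apply: f0 => /KQ. Qed.

Let VD f g : tfams_vec f -> tfams_vec g -> tfams_vec (f \+ g).
Proof. by move=> [f' hf ->] [g' hg ->]; exists (f' \+ g') => //; exact: tfamsD. Qed.
Let VB f g : tfams_vec f -> tfams_vec g -> tfams_vec (f \- g).
Proof. by move=> [f' hf ->] [g' hg ->]; exists (f' \- g') => //; exact: tfamsB. Qed.
Let VM f g : tfams_vec f -> tfams_vec g -> tfams_vec (f \* g).
Proof. by move=> [f' hf ->] [g' hg ->]; exists (f' \* g') => //; exact: tfamsM. Qed.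
Let VZ (q : rat) f : tfams_vec f -> tfams_vec (fun x => ratr q * f x).
Proof. by move=> [f' hf ->]; exists (fun x => ratr q * f' x) => //; exact: tfamsZ. Qed.

(** On the open box the bump lies in (0, 1], so [1 - (1 - be)^(m+1)] tends to 1 there and is 0
    elsewhere; the indicator of [D] dominates. *)
Lemma L1_approx_obox a b : cbox (ratv R a) (ratv R b) `<=` Q ->
  L1_approx leb tfams_vec ((@vec R n) @^-1` obox (ratv R a) (ratv R b)).
Proof.
move=> abQ eps e0; pose be := box_bump (ratv R a) (ratv R b).
pose A := (@vec R n) @^-1` obox (ratv R a) (ratv R b).
have tb : tfams Q be by exact: tfams_box_bump.
have s01 m x : 0 <= saturate be m x <= 1.
  rewrite saturateE; have := box_bump_ge0 (ratv R a) (ratv R b) x.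
  have := box_bump_le1 (ratv R a) (ratv R b) x; rewrite -/be => b1 b0.
  have h : 0 <= (1 - be x) ^+ m.+1 <= 1.
    by rewrite exprn_ge0 ?subr_ge0//= exprn_ile1 ?subr_ge0// lerBlDr lerDl.
  by move/andP : h => [? ?]; apply/andP; split; lra.
have mA : measurable A by exact: measurable_vec_obox.
have AD : A `<=` D by move=> s /obox_cbox/abQ.
have ms m : measurable_fun setT (saturate be m \o @vec R n).
  by apply: tfams_vec_meas; exists (saturate be m) => //; exact: tfams_saturate.
have sA0 m s : ~ A s -> saturate be m (vec s) = 0.
  by move=> As; rewrite saturateE /be box_bump_eq0// subr0 expr1n subrr.
have : (\int[leb]_s `|\1_A s - saturate be m (vec s)|%:E)%E @[m --> \oo] --> (\int[leb]_s 0)%E.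
  apply: (@dominated_cvg _ _ _ leb _ measurableT _ _ (EFin \o \1_D)) => //.
  - move=> m; apply/measurable_EFinP; apply: measurableT_comp => //.
    by apply: measurable_funB; [exact: measurable_indic|exact: ms].
  - move=> s _; apply/cvg_EFin; first exact: nearW.
    have [As|As] := pselect (A s); last first.
      apply: cvg_near_cst; apply: nearW => m.
      by rewrite /= indicE memNset//= sA0// subrr normr0.
    have b0 : 0 < be (vec s) by apply/box_bump_gt0.
    have b1 := box_bump_le1 (ratv R a) (ratv R b) (vec s); rewrite -/be in b1.
    rewrite (_ : _ \o _ = fun m => (1 - be (vec s)) ^+ m.+1).
      rewrite (cvg_shiftS (fun m => (1 - be (vec s)) ^+ m)).
      apply: cvg_expr; rewrite ger0_norm ?subr_ge0//.
      by rewrite ltrBlDr ltrDl.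
    apply/funext => m /=; rewrite indicE mem_set//= saturateE subKr ger0_norm//.
    by rewrite exprn_ge0// subr_ge0.
  - apply/integrableP; split.
      by apply/measurable_EFinP; apply: measurable_indic; exact: measurable_vec_Q.
    under eq_integral do rewrite /= ger0_norm//.
    rewrite integral_indic//; last exact: measurable_vec_Q.
    by rewrite setIT; exact: lebesgue_bounded_lty.
  - move=> m s _ /=; rewrite normr_id lee_fin.
    have [As|As] := pselect (A s); last by rewrite indicE memNset//= sA0// subrr normr0.
    rewrite !indicE (mem_set As) (mem_set (AD _ As))/=.
    by have /andP[? ?] := s01 m (vec s); rewrite ger0_norm; lra.
rewrite integral0 => /cvge_near_lt => /(_ eps%:E); rewrite lte_fin.
move=> /(_ e0)[m _ /(_ m (leqnn m)) hm].
exists (saturate be m \o @vec R n); split => //; last by move=> x /=; exact: s01.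
by exists (saturate be m) => //; exact: tfams_saturate.
Qed.

Lemma L1_approx_open U : open U -> U `<=` Q ->
  L1_approx leb tfams_vec ((@vec R n) @^-1` U).
Proof.
move=> oU UQ.
pose B (j : nat) : set Rn := if (choice.unpickle j : option ('rV[rat]_n * 'rV[rat]_n)) is Some (a, b)
  then if `[< cbox (ratv R a) (ratv R b) `<=` U >] then obox (ratv R a) (ratv R b) else set0
  else set0.
have -> : U = \bigcup_j B j.
  apply/seteqP; split => [x /(open_rat_box oU)[a [b [abx abU]]]|x [j _]].
    by exists (choice.pickle (a, b)) => //; rewrite /B choice.pickleK; case: asboolP.
  rewrite /B; case: choice.unpickle => [[a b]|]//.
  by case: asboolP => // abU /obox_cbox/abU.
have h0 : L1_approx leb tfams_vec set0.
  have h f : tfams_vec f -> L1_approx leb tfams_vec set0.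
    move=> hf eps e0; exists (f \- f); split; first exact: VB.
      by move=> x /=; rewrite subrr lexx ler01.
    under eq_integral do rewrite /= subrr indic0 subrr normr0.
    by rewrite integral0 lte_fin.
  (* Any member would do: it serves only to form the difference [f - f = 0]. *)
  apply: (h (tfam Q 0 0 \o @vec R n)); exists (tfam Q 0 0) => //.
  by exists 0%N, 0%N.
rewrite preimage_bigcup; apply: (@L1_approx_bigcup _ _ _ _ D) => //.
- exact: measurable_vec_Q.
- exact: lebesgue_bounded_lty.
- exact: tfams_vec_meas.
- move=> j; rewrite /B; case: choice.unpickle => [[a b]|]; last by rewrite preimage_set0.
  by case: asboolP => // _; rewrite ?preimage_set0//; exact: measurable_vec_obox.
- move=> j s; rewrite /B; case: choice.unpickle => [[a b]|]//=.
  by case: asboolP => // abU /obox_cbox/abU/UQ.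
- move=> j; rewrite /B; case: choice.unpickle => [[a b]|]; last by rewrite preimage_set0.
  case: asboolP => // abU.
  by apply: L1_approx_obox; exact: subset_trans UQ.
Qed.

Lemma L1_approx_measurable (A : set X) : measurable A ->
  L1_approx leb tfams_vec (A `&` D).
Proof.
move=> mA; suff : [set A | measurable A /\ L1_approx leb tfams_vec (A `&` D)] A by case.
move: A mA; apply: measurable_tuple_ind.
  apply: L1_approx_sigma_algebra => //.
  - exact: measurable_vec_Q.
  - exact: lebesgue_bounded_lty.
  - exact: tfams_vec_meas.
  - exact: L1_approx_open.
move=> U oU; split; first exact: measurable_vec_open.
rewrite -preimage_setI; apply: L1_approx_open; first exact: openI.
exact: subIsetr.
Qed.

Lemma tfams_dense (r : R) : 1 <= r -> forall g : X -> R, measurable_fun setT g ->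
  (forall x, ~ D x -> g x = 0) -> ('N[leb]_r%:E[EFin \o g] < +oo)%E ->
  forall eps : R, 0 < eps -> exists2 f, tfams Q f &
    ('N[leb]_r%:E[EFin \o (g \- (f \o @vec R n))%R] < eps%:E)%E.
Proof.
move=> r1 g mg gD Ng eps e0.
have [_ [f hf ->] h] : exists2 f, tfams_vec f & ('N[leb]_r%:E[EFin \o (g \- f)%R] < eps%:E)%E.
  apply: (@Lp_dense _ _ _ leb D tfams_vec) => //.
  - exact: measurable_vec_Q.
  - exact: lebesgue_bounded_lty.
  - exact: tfams_vec_meas.
  - exact: L1_approx_measurable.
by exists f.
Qed.

End test_density.

(** * Duality in Lp *)

Section Lp_duality.
Context d (X : measurableType d) (R : realType) (mu : {measure set X -> \bar R}).
Variables (p q : R).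
Hypotheses (p0 : 0 < p) (q0 : 0 < q) (pq : p^-1 + q^-1 = 1).
Implicit Types f g : X -> R.
Local Notation N r f := (Lnorm mu r%:E (EFin \o f%R)).

Lemma hoelder_integrable f g : measurable_fun setT f -> measurable_fun setT g ->
  (N p f < +oo)%E -> (N q g < +oo)%E ->
  mu.-integrable setT (EFin \o (f \* g)) /\
  `|\int[mu]_x (f x * g x)| <= fine (N p f) * fine (N q g).
Proof.
move=> mf mg Nf Ng.
have H := hoelder mu mf mg p0 q0 pq.
have Ff : N p f \is a fin_num by rewrite ge0_fin_numE// Lnorm_ge0.
have Fg : N q g \is a fin_num by rewrite ge0_fin_numE// Lnorm_ge0.
have ifg : mu.-integrable setT (EFin \o (f \* g)).
  apply/integrableP; split; first by apply/measurable_EFinP; exact: measurable_funM.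
  rewrite -[ltLHS]Lnorm1; apply: le_lt_trans H _.
  by rewrite -(fineK Ff) -(fineK Fg) -EFinM ltry.
split => //.
rewrite -lee_fin EFin_normr_Rintegral// EFinM (fineK Ff) (fineK Fg).
apply: le_trans H; rewrite Lnorm1; apply: le_abse_integral => //.
by apply/measurable_EFinP; exact: measurable_funM.
Qed.

Lemma Lnorm_fineE f r : 0 < r -> (N r f < +oo)%E ->
  (\int[mu]_x (`|f x| `^ r)%:E)%E = ((fine (N r f)) `^ r)%:E.
Proof.
move=> r0 Nf; have Ff : N r f \is a fin_num by rewrite ge0_fin_numE// Lnorm_ge0.
by rewrite -poweR_EFin (fineK Ff) poweR_Lnorm ?gt_eqF.
Qed.

Variables (D : set X) (F : set (X -> R)).
Hypothesis F_meas : forall f, F f -> measurable_fun setT f.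
Hypothesis F_dense : forall g, measurable_fun setT g ->
  (forall x, ~ D x -> g x = 0) -> (N q g < +oo)%E ->
  forall eps : R, 0 < eps -> exists2 f, F f & (N q (g \- f) < eps%:E)%E.

(** Testing against the extremal function [f |f|^(p-2)] of the Hoelder inequality gives
    [A^p <= c A^(p-1)], where [A] is the norm of [f]. As the bound is assumed on [F] only, that
    function is first approximated in L^q. *)
Lemma Lp_dual_le f c : measurable_fun setT f -> (forall x, ~ D x -> f x = 0) ->
  (N p f < +oo)%E -> 0 <= c ->
  (forall g, F g -> `|\int[mu]_x (f x * g x)| <= c * fine (N q g)) ->
  (N p f <= c%:E)%E.
Proof.
move=> mf fD Nf c0 hc.
have Ff : N p f \is a fin_num by rewrite ge0_fin_numE// Lnorm_ge0.
set A := fine (N p f); have A0 : 0 <= A by rewrite fine_ge0// Lnorm_ge0.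
rewrite -(fineK Ff) lee_fin -/A.
have p1 : 1 < p.
  rewrite -(invr1) -(invrK p) ltf_pV2 ?posrE ?invr_gt0//.
  by rewrite -pq ltrDl invr_gt0.
have qp : (p - 1) * q = p.
  have : p * q * (p^-1 + q^-1) = p * q by rewrite pq mulr1.
  rewrite mulrDr mulrAC mulfV ?gt_eqF// mul1r -mulrA mulfV ?gt_eqF// mulr1 => h.
  by rewrite mulrBl mul1r -h; ring.
pose g x := f x * `|f x| `^ (p - 2).
have mg : measurable_fun setT g.
  apply: measurable_funM => //; apply: (measurableT_comp (measurable_powR _)).
  exact: measurableT_comp.
have gE x : `|g x| = `|f x| `^ (p - 1).
  rewrite /g normrM (ger0_norm (powR_ge0 _ _)).
  have [->|f0] := eqVneq (f x) 0.
    by rewrite normr0 mul0r powR0// subr_eq0 gt_eqF.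
  rewrite -[X in X * _](powRr1 (normr_ge0 _)) -powRD; last by rewrite normr_eq0 f0 implybT.
  by congr (_ `^ _); ring.
have fgE x : f x * g x = `|f x| `^ p.
  rewrite /g mulrA -expr2 -real_normK ?num_real// expr2 -mulrA.
  have -> : `|f x| * `|f x| `^ (p - 2) = `|g x| by rewrite /g normrM (ger0_norm (powR_ge0 _ _)).
  by rewrite gE mulr_powRB1.
have Ig : (\int[mu]_x (`|g x| `^ q)%:E)%E = (A `^ p)%:E.
  rewrite -(Lnorm_fineE p0 Nf); apply: eq_integral => x _.
  by rewrite gE -powRrM qp.
have NgE : N q g = (A `^ (p - 1))%:E.
  rewrite unlock /= [X in poweR X]Ig poweR_EFin -powRrM; congr (_ `^ _)%:E.
  by rewrite -{1}qp mulfK// gt_eqF.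
have Ng : (N q g < +oo)%E by rewrite NgE ltry.
have gD x : ~ D x -> g x = 0 by move=> /fD; rewrite /g => ->; rewrite mul0r.
have [ifg _] := hoelder_integrable mf mg Nf Ng.
have IfgE : \int[mu]_x (f x * g x) = A `^ p.
  rewrite /Rintegral -[RHS]/(fine (A `^ p)%:E) -(Lnorm_fineE p0 Nf).
  by congr fine; apply: eq_integral => x _; rewrite fgE.
have key eps : 0 < eps -> A `^ p <= c * (A `^ (p - 1) + eps) + A * eps.
  move=> e0; have [h Fh Nh] := F_dense mg gD Ng e0.
  have mh := F_meas Fh.
  have mgh : measurable_fun setT (g \- h) by exact: measurable_funB.
  have Nghoo : (N q (g \- h) < +oo)%E by apply: lt_trans Nh _; rewrite ltry.
  have q1 : 1 <= q.
    rewrite -(invr1) -(invrK q) lef_pV2 ?posrE ?invr_gt0//.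
    by rewrite -pq lerDr invr_ge0 ltW.
  have NhE : (N q h <= (A `^ (p - 1) + eps)%:E)%E.
    rewrite EFinD -NgE.
    have -> : EFin \o h = EFin \o (g \+ (fun x => - (g \- h) x))%R.
      by apply/funext => x /=; congr EFin; ring.
    apply: le_trans (minkowski_EFin _ _ _ _) _ => //; first exact: measurableT_comp.
    rewrite leeD2l//; apply: le_trans (ltW Nh).
    by rewrite -[leRHS]oppe_Lnorm.
  have Nhoo : (N q h < +oo)%E by apply: le_lt_trans NhE _; rewrite ltry.
  have [ifh _] := hoelder_integrable mf mh Nf Nhoo.
  have [ifgh Igh] := hoelder_integrable mf mgh Nf Nghoo.
  rewrite -IfgE (_ : \int[mu]_x (f x * g x) = \int[mu]_x (f x * h x) + \int[mu]_x (f x * (g \- h) x)); last first.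
    rewrite -RintegralD//; apply: eq_Rintegral => x _ /=; ring.
  apply: lerD.
    apply: le_trans (ler_norm _) _; apply: le_trans (hc _ Fh) _.
    by rewrite ler_wpM2l// -lee_fin fineK// ge0_fin_numE// Lnorm_ge0.
  apply: le_trans (ler_norm _) _; apply: le_trans Igh _.
  rewrite ler_wpM2l// -lee_fin fineK ?(ltW Nh)//.
  by rewrite ge0_fin_numE// Lnorm_ge0.
have {}key : A `^ p <= c * A `^ (p - 1).
  apply/ler_addgt0Pr => e e0.
  (* The approximation error enters with the factor [c + A]; the added 1 only keeps the denominator
     positive. *)
  have ca0 : 0 < c + A + 1 by rewrite ltr_wpDl// addr_ge0.
  have := key (e / (c + A + 1)); rewrite divr_gt0// => /(_ isT) /le_trans; apply.
  rewrite mulrDr -addrA lerD2l -mulrDl mulrA ler_pdivrMr//.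
  by rewrite mulrC ler_wpM2l ?(ltW e0)// lerDl.
have [A00|A00] := eqVneq A 0; first by rewrite A00.
have A1 : 0 < A by rewrite lt0r A00.
by move: key; rewrite -mulr_powRB1// ler_pM2r// powR_gt0.
Qed.

End Lp_duality.

(** * Weak derivatives and Borel measurability in time *)

Section sobolev_facts.
Context (R : realType) (n : nat) (p q : R) (Q : set 'rV[R]_n).
Hypotheses (oQ : open Q) (bQ : bounded_set Q).
Hypotheses (p1 : 1 < p) (q0 : 0 < q) (pq : p^-1 + q^-1 = 1).
Local Notation Rn := 'rV[R]_n.
Local Notation X := (n.-tuple (measurableTypeR R)).
Local Notation leb := (lebesgue_tuple R n).
Local Notation D := ((@vec R n) @^-1` Q).
Local Notation N r f := (Lnorm leb r%:E (EFin \o f%R)).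
Implicit Types u v h k phi : Rn -> R.

Let p0 : 0 < p. Proof. exact: lt_trans p1. Qed.

Definition zext h : X -> R := (h \_ Q) \o @vec R n.

Lemma zextE h s : zext h s = if s \in D then h (vec s) else 0.
Proof. by rewrite /zext/= patchE. Qed.

Lemma zext_off h s : ~ D s -> zext h s = 0.
Proof. by move=> Ds; rewrite zextE memNset. Qed.

Lemma measurable_zext h : in_Lp p Q h -> measurable_fun setT (zext h).
Proof.
move=> [mh _]; rewrite (_ : zext h = (h \o @vec R n) \_ D).
  by apply/(measurable_restrictT _ _).1 => //; exact: measurable_vec_Q.
by apply/funext => s; rewrite zextE patchE.
Qed.

Lemma Lnorm_zext_lty h : in_Lp p Q h -> (N p (zext h) < +oo)%E.
Proof. by case. Qed.

Lemma zextB u v : zext (u \- v) = zext u \- zext v.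
Proof. by apply/funext => s; rewrite /= !zextE; case: ifPn; rewrite ?subr0. Qed.

Lemma in_LpB u v : in_Lp p Q u -> in_Lp p Q v -> in_Lp p Q (u \- v).
Proof.
move=> hu hv; have [mu Nu] := hu; have [mv Nv] := hv; split.
  by apply: measurable_funB.
suff : (N p (zext (u \- v)) < +oo)%E by [].
rewrite zextB.
have -> : EFin \o (zext u \- zext v) = EFin \o (zext u \+ (fun s => - zext v s))%R by [].
apply: le_lt_trans (minkowski_EFin _ _ _ _) _.
- exact: measurable_zext.
- by apply: measurableT_comp => //; exact: measurable_zext.
- exact: ltW.
apply: lte_add_pinfty => //.
by rewrite (_ : N p (fun s => - zext v s) = N p (zext v))// -[RHS]oppe_Lnorm.
Qed.

Lemma test_fun_Lnorm_lty phi r : 1 <= r -> test_fun Q phi ->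
  (N r (phi \o @vec R n) < +oo)%E.
Proof.
move=> r1 tphi; have [M hM] := test_fun_bounded tphi.
have r0 : 0 < r by exact: lt_le_trans r1.
have M0 : 0 <= M by apply: le_trans (hM 0).
have mphi : measurable_fun setT (phi \o @vec R n).
  by apply: measurable_comp_vec; exact: test_fun_continuous tphi.
rewrite unlock poweR_lty//.
apply: (@le_lt_trans _ _ (\int[leb]_s ((M `^ r)%:E * (\1_D s)%:E))%E).
  apply: ge0_le_integral => //.
  - by move=> x _; exact: poweR_ge0.
  - apply/measurable_EFinP; apply: (measurableT_comp (measurable_powR r)).
    exact: measurableT_comp.
  - apply: emeasurable_funM => //; apply/measurable_EFinP; apply: measurable_indic.
    exact: measurable_vec_Q.
  - move=> s _; rewrite /= -EFinM lee_fin indicE.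
    have [Ds|Ds] := pselect (D s).
      by rewrite mem_set// mulr1; apply: ge0_ler_powR; rewrite ?nnegrE ?(ltW r0).
    by rewrite memNset// mulr0 (test_fun_off tphi Ds) normr0 powR0// gt_eqF.
rewrite ge0_integralZl//; last 2 first.
- by apply/measurable_EFinP; apply: measurable_indic; exact: measurable_vec_Q.
- by rewrite lee_fin powR_ge0.
rewrite integral_indic//; last exact: measurable_vec_Q.
by rewrite setIT lte_mul_pinfty ?lee_fin ?powR_ge0//; exact: lebesgue_bounded_lty.
Qed.

Let q1 : 1 <= q.
Proof.
rewrite -(invr1) -(invrK q) lef_pV2 ?posrE ?invr_gt0//.
by rewrite -pq lerDr invr_ge0 ltW.
Qed.

Lemma intL_zext h phi : test_fun Q phi ->
  intL Q (fun x => h x * phi x) = \int[leb]_s (zext h s * (phi \o @vec R n) s).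
Proof.
move=> tphi; rewrite /intL Rintegral_mkcond; apply: eq_Rintegral => s _.
rewrite patchE zextE /=; case: ifPn => // Ds.
by rewrite (test_fun_off tphi) ?mulr0// => Qs; move: Ds; rewrite notin_setE; apply.
Qed.

Let measurable_test phi : test_fun Q phi -> measurable_fun setT (phi \o @vec R n).
Proof. by move=> tphi; apply: measurable_comp_vec; exact: test_fun_continuous tphi. Qed.

Lemma intL_integrable h phi : in_Lp p Q h -> test_fun Q phi ->
  leb.-integrable setT (EFin \o (zext h \* (phi \o @vec R n))) /\
  `|intL Q (fun x => h x * phi x)| <= fine (N p (zext h)) * fine (N q (phi \o @vec R n)).
Proof.
move=> hh tphi; rewrite intL_zext//; apply: hoelder_integrable => //.
- exact: measurable_zext.
- exact: measurable_test.
- exact: Lnorm_zext_lty.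
- exact: test_fun_Lnorm_lty.
Qed.

Lemma intLB u v phi : in_Lp p Q u -> in_Lp p Q v -> test_fun Q phi ->
  intL Q (fun x => (u \- v) x * phi x) =
  intL Q (fun x => u x * phi x) - intL Q (fun x => v x * phi x).
Proof.
move=> hu hv tphi; rewrite !intL_zext// zextB -RintegralB//.
- by apply: eq_Rintegral => s _ /=; rewrite mulrBl.
- by have [] := intL_integrable hu tphi.
- by have [] := intL_integrable hv tphi.
Qed.

Lemma is_weak_partialB j u v h k : in_Lp p Q u -> in_Lp p Q v ->
  is_weak_partial p Q j u h -> is_weak_partial p Q j v k ->
  is_weak_partial p Q j (u \- v) (h \- k).
Proof.
move=> hu hv [hh Hh] [hk Hk]; split; first exact: in_LpB.
move=> phi tphi; rewrite !intLB//; last exact: test_fun_partial.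
by rewrite Hh// Hk// opprB opprK addrC.
Qed.

Lemma sobolev2B u v : sobolev2 p Q u -> sobolev2 p Q v -> sobolev2 p Q (u \- v).
Proof.
move=> [hu Hu] [hv Hv]; split; first exact: in_LpB.
move=> j; have [h hh Hh] := Hu j; have [k hk Hk] := Hv j.
exists (h \- k); first exact: is_weak_partialB.
move=> i; have [h' hh'] := Hh i; have [k' hk'] := Hk i; exists (h' \- k').
by apply: is_weak_partialB => //; [case: hh|case: hk].
Qed.

(* The derivatives of order at most two: [None], [Some (j, None)] and
   [Some (j, Some i)] stand for u, d_j u and d_i d_j u. *)
Definition order2 := option ('I_n * option 'I_n).

Definition wder (o : order2) u : Rn -> R :=
  match o with
  | None => u
  | Some (j, None) => weak_partial p Q j u
  | Some (j, Some i) => weak_partial p Q i (weak_partial p Q j u)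
  end.

(** Integrating by parts twice reverses the order of the derivatives: d_i d_j u against [phi]
    becomes u against d_j d_i [phi]. The accompanying sign is [dsign]. *)
Definition dtest (o : order2) phi : Rn -> R :=
  match o with
  | None => phi
  | Some (j, None) => partial j phi
  | Some (j, Some i) => partial j (partial i phi)
  end.

Definition dsign (o : order2) : R := if o is Some (_, None) then -1 else 1.

Lemma test_fun_dtest o phi : test_fun Q phi -> test_fun Q (dtest o phi).
Proof. by case: o => [[j [i|]]|] tphi //=; do ?exact: test_fun_partial; apply: test_fun_partial; exact: test_fun_partial. Qed.

Lemma weak_partialP j u : (exists h, is_weak_partial p Q j u h) ->
  is_weak_partial p Q j u (weak_partial p Q j u).
Proof. by move=> ex; exact: (getPex ex). Qed.

Lemma wder_spec o u : sobolev2 p Q u -> in_Lp p Q (wder o u) /\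
  forall phi, test_fun Q phi ->
    intL Q (fun x => wder o u x * phi x) = dsign o * intL Q (fun x => u x * dtest o phi x).
Proof.
move=> [hu Hu]; case: o => [[j [i|]]|] /=; last by split => // phi _; rewrite mul1r.
- have [h hh Hh] := Hu j; have [k [hk Hk]] := Hh i.
  have [hw Hw] : is_weak_partial p Q j u (weak_partial p Q j u) by apply: weak_partialP; exists h.
  (* The hypothesis differentiates some weak derivative [h] of [u], not the one selected by
     [weak_partial]. Both have the same integrals against test functions, so the derivative [k] of
     [h] is also one of the selected function. *)
  have [hw' Hw'] : is_weak_partial p Q i (weak_partial p Q j u) (weak_partial p Q i (weak_partial p Q j u)).
    apply: weak_partialP; exists k; split => // phi tphi.
    have tphi' := test_fun_partial i tphi.
    apply: oppr_inj; rewrite -Hw// -Hk//.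
    by case: hh => _ ->.
  split => // phi tphi; rewrite mul1r Hw; last exact: test_fun_partial.
  by rewrite Hw'// opprK.
- have [h hh Hh] := Hu j.
  have [hw Hw] : is_weak_partial p Q j u (weak_partial p Q j u) by apply: weak_partialP; exists h.
  by split => // phi tphi; rewrite Hw// mulrN mulN1r opprK.
Qed.

(** Duality moves all derivatives to the test functions. What remains are conditions on integrals of
    [u] itself, which survive uniform convergence. *)
Lemma normLp_wder_le o u r : sobolev2 p Q u -> 0 <= r ->
  (forall phi, tfams Q phi -> `|intL Q (fun x => u x * dtest o phi x)|
     <= r * fine (N q (phi \o @vec R n))) ->
  (normLp p Q (wder o u) <= r%:E)%E.
Proof.
move=> su r0 hr; have [hw Hw] := wder_spec o su.
apply: (@Lp_dual_le _ _ _ leb p q p0 q0 pq D (@tfams_vec _ _ Q)) => //.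
- exact: tfams_vec_meas.
- move=> g mg gD Ng eps e0.
  by have [f hf Nf] := tfams_dense oQ bQ q1 mg gD Ng e0; exists (f \o @vec R n) => //; exists f.
- exact: measurable_zext.
- exact: zext_off.
- exact: Lnorm_zext_lty.
- move=> _ [phi hphi ->]; have tphi := tfams_test hphi.
  rewrite -intL_zext// Hw// normrM.
  have -> : `|dsign o| = 1 by rewrite /dsign; case: (o) => [[j [i|]]|]; rewrite ?normrN normr1.
  by rewrite mul1r hr.
Qed.

Lemma normW2p_le (f : Rn -> Rn) r :
  (forall c o, (normLp p Q (wder o (coordf f c)) <= r%:E)%E) ->
  (normW2p p Q f <= (r * (n * (1 + n + n * n))%:R)%:E)%E.
Proof.
move=> hr; rewrite /normW2p /normW2p_on.
apply: (@le_trans _ _ (\sum_(c < n) (r%:E + \sum_(j < n) r%:E + \sum_(i < n) \sum_(j < n) r%:E))%E).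
  apply: lee_sum => c _; apply: leeD; first apply: leeD.
  - exact: (hr c None).
  - by apply: lee_sum => j _; exact: (hr c (Some (j, None))).
  - by apply: lee_sum => i _; apply: lee_sum => j _; exact: (hr c (Some (j, Some i))).
have sE (z : R) : (\sum_(j < n) z%:E)%E = (z * n%:R)%:E.
  by rewrite sumEFin sumr_const card_ord mulr_natr.
have inner : (r%:E + \sum_(j < n) r%:E + \sum_(i < n) \sum_(j < n) r%:E)%E =
    (r + r * n%:R + r * n%:R * n%:R)%:E.
  by under [X in (_ + _ + X)%E]eq_bigr do rewrite sE; rewrite !sE -!EFinD.
under eq_bigr do rewrite inner.
rewrite sE lee_fin le_eqVlt; apply/orP; left; apply/eqP.
by rewrite !natrM !natrD natrM; ring.
Qed.

End sobolev_facts.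

(** * Borel measurability in W^{2,p} of families continuous in time with values in C^1 *)

Section borel_in_time.
Context (R : realType) (n : nat) (p : R) (Q : set 'rV[R]_n).
Hypotheses (oQ : open Q) (bQ : bounded_set Q) (p1 : 1 < p).
Local Notation Rn := 'rV[R]_n.
Local Notation X := (n.-tuple (measurableTypeR R)).
Local Notation leb := (lebesgue_tuple R n).
Local Notation D := ((@vec R n) @^-1` Q).
Local Notation N r f := (Lnorm leb r%:E (EFin \o f%R)).
Let q := p / (p - 1).

Let p0 : 0 < p. Proof. exact: lt_trans p1. Qed.
Let q0 : 0 < q. Proof. by rewrite divr_gt0// subr_gt0. Qed.
Let pq : p^-1 + q^-1 = 1.
Proof. by rewrite /q invf_div; field; rewrite gt_eqF. Qed.
Let q1 : 1 <= q.
Proof. by rewrite /q ler_pdivlMr ?subr_gt0// mul1r lerBlDr lerDl. Qed.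

Lemma intL_sup_le (h phi : Rn -> R) (e M : R) : in_Lp p Q h -> test_fun Q phi ->
  0 <= e -> 0 <= M -> (forall x, Q x -> `|h x| <= e) -> (forall x, `|phi x| <= M) ->
  `|intL Q (fun x => h x * phi x)| <= e * M * fine (leb D).
Proof.
move=> hh tphi e0 M0 he hM; rewrite intL_zext//.
have [ih _] := intL_integrable oQ bQ p1 q0 pq hh tphi.
apply: le_trans (le_normr_Rintegral _ ih) _ => //.
have mD : measurable D by exact: measurable_vec_Q.
have iD : leb.-integrable setT (EFin \o \1_D).
  apply/integrableP; split; first exact/measurable_EFinP/measurable_indic.
  under eq_integral do rewrite /= ger0_norm//.
  by rewrite integral_indic// setIT; exact: lebesgue_bounded_lty.
have -> : e * M * fine (leb D) = \int[leb]_s (e * M * \1_D s).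
  rewrite RintegralZl//; congr (_ * _); rewrite /Rintegral integral_indic//.
  by rewrite setIT.
apply: le_Rintegral => //.
- rewrite (_ : _ \o _ = abse \o (EFin \o (zext Q h \* (phi \o @vec R n)))); last first.
    by apply/funext => s.
  exact: integrable_abse.
- rewrite (_ : _ \o _ = fun s => (e * M)%:E * (EFin \o \1_D) s)%E; last first.
    by apply/funext => s; rewrite /= EFinM.
  exact: integrableZl.
move=> s _ /=; rewrite normrM zextE indicE; case: ifPn => [Ds|_].
  by rewrite mulr1 ler_pM//; apply: he; rewrite inE in Ds.
by rewrite normr0 mul0r mulr0.
Qed.

Variables (J : set R) (eta : R -> Rn -> Rn).
Hypotheses (cJ : closed J) (eta_W2p : forall t, J t -> W2p p Q (eta t)).
Hypothesis eta_time : C1_continuous_in_time Q J eta.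

Let u t c := coordf (eta t) c.

Let su t c : J t -> sobolev2 p Q (u t c).
Proof. by move=> /eta_W2p[+ _]; exact. Qed.

Let uLp t c : J t -> in_Lp p Q (u t c).
Proof. by move=> /(su c)[]. Qed.

Let I c psi t := intL Q (fun x => u t c x * psi x).

(** Only the undifferentiated map enters, so sup-norm closeness on the bounded set [Q] is enough. *)
Lemma intL_continuous_in_time c psi t0 : test_fun Q psi -> J t0 ->
  forall e : R, 0 < e -> exists2 d : R, 0 < d &
    forall t, J t -> `|t - t0| < d -> `|I c psi t - I c psi t0| <= e.
Proof.
move=> tpsi Jt0 e e0; have [M hM] := test_fun_bounded tpsi.
have M0 : 0 <= M by apply: le_trans (hM 0).
set K := M * fine (leb D) + 1.
have K0 : 0 < K by rewrite ltr_wpDl// mulr_ge0// fine_ge0.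
have e'0 : 0 < e / K by rewrite divr_gt0.
have [d d0 hd] := eta_time Jt0 e'0.
exists d => // t Jt td; rewrite /I -(intLB oQ bQ p1 q0 pq)//; [|exact: uLp..].
apply: (@le_trans _ _ (e / K * M * fine (leb D))).
  apply: intL_sup_le => //.
  - by apply: in_LpB => //; exact: uLp.
  - exact: ltW.
  - move=> x Qx; have [h _] := hd t Jt td x Qx; apply: le_trans h.
    by apply: le_trans (coord_le_norm _ c); rewrite !mxE.
rewrite -mulrA mulrAC ler_pdivrMr// ler_wpM2l ?(ltW e0)//.
by rewrite /K lerDl.
Qed.

(** The dual form of: every derivative of order at most two of [eta t - eta s] has L^p norm at most
    [r]. In this form the set is visibly an intersection of closed conditions on [t]. *)
Let near_time s r : set R := [set t | J t /\ forall c o phi, tfams Q phi ->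
  `|I c (dtest o phi) t - I c (dtest o phi) s| <= r * fine (N q (phi \o @vec R n))].

Let closed_near_time s r : closed (near_time s r).
Proof.
move=> t clt; have Jt : J t.
  by apply: cJ => B /clt[t' [[Jt' _] Bt']]; exists t'.
split => // c o phi hphi; apply/ler_addgt0Pr => e e0.
have tpsi := test_fun_dtest o (tfams_test hphi).
have [d d0 hd] := intL_continuous_in_time c tpsi Jt e0.
have [t' [[Jt' ht'] /= tt']] := clt _ (nbhsx_ballx t d d0).
have td : `|t' - t| < d by rewrite distrC.
have := hd _ Jt' td; have := ht' c o phi hphi.
set x := I _ _ t; set y := I _ _ t'; set z := I _ _ s; set w := _ * fine _.
rewrite !ler_norml => /andP[? ?] /andP[? ?]; apply/andP; split; lra.
Qed.

Let code := {ffun 'I_n * order2 n -> nat * nat}.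

(** A code picks one member of the dense family for every component and every derivative. Codes are
    countable, and two times with the same code are within [r] of each other by the triangle
    inequality; this is the separability that is needed. *)
Let near_code (r : R) (xi : code) : set R := [set t | J t /\ forall c o,
  (N p (zext Q (wder p Q o (u t c)) \- (tfam Q (xi (c, o)).1 (xi (c, o)).2 \o @vec R n)) < (r / 2)%:E)%E].

Let near_code_cover r t : 0 < r -> J t -> exists xi, near_code r xi t.
Proof.
move=> r0 Jt; have r20 : 0 < r / 2 by rewrite divr_gt0.
have /choice[xi hxi] : forall co : 'I_n * order2 n, exists kj : nat * nat,
    (N p (zext Q (wder p Q co.2 (u t co.1)) \- (tfam Q kj.1 kj.2 \o @vec R n)) < (r / 2)%:E)%E.
  move=> [c o]; have [hw _] := wder_spec o (su c Jt).
  have [f [k [j ->]] Nf] := tfams_dense oQ bQ (ltW p1) (measurable_zext oQ hw)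
    (@zext_off _ _ Q _) (Lnorm_zext_lty hw) r20.
  by exists (k, j).
by exists [ffun co => xi co]; split => // c o; rewrite !ffunE; exact: (hxi (c, o)).
Qed.

Let near_code_near_time r xi s t : 0 < r -> near_code r xi s -> near_code r xi t -> near_time s r t.
Proof.
move=> r0 [Js hs] [Jt ht]; split => // c o phi hphi.
have tphi := tfams_test hphi.
have [hws Hws] := wder_spec o (su c Js); have [hwt Hwt] := wder_spec o (su c Jt).
have E : `|I c (dtest o phi) t - I c (dtest o phi) s| =
    `|intL Q (fun x => (wder p Q o (u t c) \- wder p Q o (u s c)) x * phi x)|.
  rewrite (intLB oQ bQ p1 q0 pq)// Hwt// Hws// -mulrBr normrM.
  have -> : `|dsign R o| = 1 by rewrite /dsign; case: (o) => [[j [i|]]|]; rewrite ?normrN normr1.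
  by rewrite mul1r.
have hB := in_LpB oQ p1 hwt hws.
rewrite E; have [_ H] := intL_integrable oQ bQ p1 q0 pq hB tphi.
apply: le_trans H _; rewrite ler_wpM2r ?fine_ge0 ?Lnorm_ge0//.
rewrite -lee_fin fineK; last by rewrite ge0_fin_numE ?Lnorm_ge0//; exact: Lnorm_zext_lty.
set f := tfam Q (xi (c, o)).1 (xi (c, o)).2 \o @vec R n.
have mf : measurable_fun setT f.
  apply: measurable_comp_vec; apply: test_fun_continuous; apply: tfams_test.
  by eexists; eexists.
have -> : zext Q (wder p Q o (u t c) \- wder p Q o (u s c)) =
   (zext Q (wder p Q o (u t c)) \- f) \+ (fun x => - (zext Q (wder p Q o (u s c)) \- f) x).
  by rewrite zextB; apply/funext => x /=; ring.
have mt := measurable_zext oQ hwt; have ms := measurable_zext oQ hws.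
apply: le_trans (minkowski_EFin _ _ _ (ltW p1)) _.
- exact: measurable_funB.
- by apply: measurableT_comp => //; exact: measurable_funB.
rewrite [r]splitr EFinD; apply: leeD; first exact/ltW/ht.
apply: le_trans (ltW (hs c o)).
by rewrite -[leRHS]oppe_Lnorm.
Qed.

(** A Lindeloef argument: the times at which [eta] lies in an open set form a countable union of
    closed sets [near_time], indexed by a radius [1/(m+1)] and a code. *)
Theorem C1_continuous_borel_in_time : borel_in_time p Q J eta.
Proof.
move=> U oU.
pose K : R := (n * (1 + n + n * n))%:R.
pose r (m : nat) : R := m.+1%:R^-1.
pose good (m : nat) (xi : code) s := near_code (r m) xi s /\ near_time s (r m) `<=` [set t | J t /\ U (eta t)].
(* For each code one admissible centre is chosen, if there is any; otherwise the set is empty. *)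
pose B (m : nat) (j : nat) : set R :=
  if (choice.unpickle j : option code) is Some xi then
    if pselect (exists s, good m xi s) is left ex then near_time (sval (cid ex)) (r m) else set0
  else set0.
have -> : [set t | J t /\ U (eta t)] = \bigcup_m \bigcup_j B m j.
  apply/seteqP; split => [t [Jt Ut]|t [m _ [j _]]]; last first.
    rewrite /B; case: choice.unpickle => // xi.
    by case: pselect => // ex; case: cid => /= s [_ hs] /hs.
  have [d d0 hd] := oU _ (eta_W2p Jt) Ut.
  (* [K] counts the terms of the W^{2,p} norm, so [r m * K] bounds this norm when each term is at
     most [r m]. *)
  have [m Km] : exists m, r m * K < d.
    exists (Num.trunc (K / d)); rewrite mulrC ltr_pdivrMr// -ltr_pdivrMl// mulrC.
    exact: truncnS_gt.
  have r0 : 0 < r m by rewrite invr_gt0.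
  have [xi hxi] := near_code_cover r0 Jt.
  have tgood : near_time t (r m) `<=` [set t' | J t' /\ U (eta t')].
    move=> t' [Jt' ht']; split => //; apply: hd; first exact: eta_W2p.
    apply: le_lt_trans (normW2p_le (r := r m) _) _; last by rewrite lte_fin.
    move=> c o; have -> : coordf (fun x => eta t' x - eta t x) c = u t' c \- u t c.
      by apply/funext => x; rewrite /u /coordf/= !mxE.
    apply: (normLp_wder_le oQ bQ p1 q0 pq) => //.
    - by apply: (sobolev2B oQ bQ p1 q0 pq); exact: su.
    - exact: ltW.
    - move=> phi hphi; have tphi := test_fun_dtest o (tfams_test hphi).
      by rewrite (intLB oQ bQ p1 q0 pq)//; [exact: ht'|exact: uLp..].
  have ex : exists s, good m xi s by exists t.
  exists m => //; exists (choice.pickle xi) => //; rewrite /B choice.pickleK.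
  case: pselect => // ex'; case: cid => /= s [hs _].
  (* The centre chosen for the code [xi] may differ from [t], but sharing the code puts [t] into the
     closed set around it. *)
  exact: near_code_near_time hs hxi.
apply: bigcupT_measurable => m; apply: bigcupT_measurable => j.
rewrite /B; case: choice.unpickle => // xi; case: pselect => // ex.
exact: closed_measurable.
Qed.

End borel_in_time.

(** * Riesz representation *)

Section open_weight.
Context (R : realType) (V : normedModType R).

(** The weight is the distance to the complement, truncated at 1; the truncation also gives the
    infimum a nonempty set when [U] is the whole space. *)
Lemma open_weight (U : set V) : open U -> exists h : V -> R,
  [/\ continuous h, forall z, 0 <= h z & forall z, 0 < h z <-> U z].
Proof.
move=> oU; pose S z := [set 1 : R] `|` [set `|z - y| | y in ~` U].
have S0 z : S z !=set0 by exists 1; left.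
have lb0 z : lbound (S z) 0.
  by move=> _ [->|[y _ <-]].
have hS z : has_inf (S z) by split => //; exists 0.
pose h z := inf (S z).
have h0 z : 0 <= h z by apply: lb_le_inf.
have hlip z w : h z <= h w + `|z - w|.
  rewrite -lerBlDr; apply: lb_le_inf => // x [->|[y Uy <-]]; rewrite lerBlDr.
    apply: (@le_trans _ _ 1); last by rewrite lerDl.
    by apply: ge_inf; [exists 0|left].
  apply: (@le_trans _ _ `|z - y|).
    by apply: ge_inf; [exists 0|right; exists y].
  rewrite [leRHS]addrC (_ : z - y = (z - w) + (w - y)); last by rewrite addrA subrK.
  exact: ler_normD.
exists h; split => //.
  move=> z; apply/cvgrPdist_lt => e e0; near=> w.
  have zw : `|z - w| < e by near: w; exact: cvgr_dist_lt.
  rewrite (le_lt_trans _ zw)// ler_norml; apply/andP; split.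
    by have := hlip w z; rewrite distrC; lra.
  by have := hlip z w; lra.
move=> z; split => [hz|Uz].
  apply: contrapT => Uz; suff : h z <= 0 by lra.
  by apply: ge_inf; [exists 0|right; exists z => //; rewrite subrr normr0].
have /nbhs_ballP[e /= e0 eU] : nbhs z U by exact: open_nbhs_nbhs.
apply: (@lt_le_trans _ _ (Num.min 1 e)); first by rewrite lt_min ltr01.
apply: lb_le_inf => // x [->|[y Uy <-]]; rewrite ge_min ?lexx//.
apply/orP; right; rewrite leNgt; apply/negP => zy; apply: Uy; apply: eU.
by rewrite -ball_normE.
Unshelve. all: by end_near. Qed.

End open_weight.

Section finite_measure_integral.
Context d (T : measurableType d) (R : realType).
Variable mu : {finite_measure set T -> \bar R}.

Lemma bounded_finite_integrable (D : set T) (g : T -> R) (M : R) : measurable D ->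
  measurable_fun D g -> (forall x, D x -> `|g x| <= M) -> mu.-integrable D (EFin \o g).
Proof.
move=> mD mg gM; apply: measurable_bounded_integrable => //.
  by rewrite ltey_eq fin_num_measure.
by exists M; split => [|y My z Dz]; [exact: num_real|rewrite /= (le_trans (gM _ Dz))// ltW].
Qed.

Lemma Rintegral_setID (D B : set T) (f : T -> R) : measurable (D `&` B) ->
  measurable (D `\` B) -> mu.-integrable D (EFin \o f) ->
  (\int[mu]_(z in D) f z = \int[mu]_(z in D `&` B) f z + \int[mu]_(z in D `\` B) f z)%R.
Proof.
move=> mI mD iD; have dis : [disjoint D `&` B & D `\` B] by apply/disj_setPS => z [[_ Bz] [_]].
by rewrite -{1}(setUIDK D B) Rintegral_setU// setUIDK.
Qed.

End finite_measure_integral.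

Section within_compact.
Context (R : realType) (V : normedModType R).
Local Notation S := (g_sigma_algebraType (@open V)).

Lemma measurable_gen_open (U : set S) : open (U : set V) -> measurable U.
Proof. by move=> oU; exact: sub_gen_smallest. Qed.

Lemma measurable_gen_compact (K : set S) : compact (K : set V) -> measurable K.
Proof.
move=> cK; rewrite -(setCK K); apply: measurableC; apply: measurable_gen_open.
by apply: closed_openC; exact: compact_closed.
Qed.

Lemma measurable_fun_within (K : set V) (f : V -> R) : compact K ->
  {within K, continuous f} -> measurable_fun (K : set S) (f : S -> R).
Proof.
move=> cK cf; apply: (measurability _ (RGenOInfty.measurableE R)) => _ [_ [x ->] <-].
have : open (f @^-1` `]x, +oo[%classic : set (subspace K)).
  by move/continuousP : cf; apply; exact: interval_open.
move/open_subspaceP => [U oU UK]; rewrite setIC -UK.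
by apply: measurableI; [exact: measurable_gen_open|exact: measurable_gen_compact].
Qed.

Lemma within_continuous_bound (K : set V) (f : V -> R) : compact K ->
  {within K, continuous f} -> exists2 M : R, 0 < M & forall z, K z -> `|f z| <= M.
Proof.
move=> cK cf; have [M [_ h]] := compact_bounded (continuous_compact cf cK).
exists (`|M| + 1) => [|z Kz]; first by rewrite ltr_wpDl.
by apply: (h (`|M| + 1)); [rewrite ltr_pwDr// ler_norm|exists z].
Qed.

Lemma within_integrable (mu : {finite_measure set S -> \bar R}) (K : set V) (f : V -> R) :
  compact K -> {within K, continuous f} -> mu.-integrable (K : set S) (EFin \o f).
Proof.
move=> cK cf; have [M _ fM] := within_continuous_bound cK cf.
apply: (@bounded_finite_integrable _ _ _ _ _ _ M) => //; last exact: measurable_fun_within.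
exact: measurable_gen_compact.
Qed.

End within_compact.

Section riesz.
Context (R : realType) (V : normedModType R).
Local Notation S := (g_sigma_algebraType (@open V)).
Variables (K : set V) (Lam : (V -> R) -> R).
Hypothesis cK : compact K.
Local Notation cont f := ({within K, continuous (f : V -> R)}).
Hypothesis LamD : forall f g, cont f -> cont g -> Lam (f \+ g) = Lam f + Lam g.
Hypothesis LamZ : forall c f, cont f -> Lam (fun z => c * f z) = c * Lam f.
Hypothesis Lam_le : forall f g, cont f -> cont g ->
  (forall z, K z -> f z <= g z) -> Lam f <= Lam g.
Implicit Types (f : V -> R) (F : nat -> V -> R) (g : V -> \bar R).

Let contD f1 f2 : cont f1 -> cont f2 -> cont (f1 \+ f2).
Proof. by move=> h1 h2 z; apply: continuousD; [exact: h1|exact: h2]. Qed.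

Let contM f1 f2 : cont f1 -> cont f2 -> cont (f1 \* f2).
Proof. by move=> h1 h2 z; apply: continuousM; [exact: h1|exact: h2]. Qed.

Let cont_cst c : cont (fun=> c). Proof. by move=> z; exact: cvg_cst. Qed.

Let contZ c f : cont f -> cont (fun z => c * f z).
Proof. by move=> h; apply: (@contM (fun=> c)). Qed.

Let cont_min f1 f2 : cont f1 -> cont f2 -> cont (fun z => Num.min (f1 z) (f2 z)).
Proof. by move=> h1 h2 z; apply: continuous_min; [exact: h1|exact: h2]. Qed.

Let cont_max f1 f2 : cont f1 -> cont f2 -> cont (fun z => Num.max (f1 z) (f2 z)).
Proof. by move=> h1 h2 z; apply: continuous_max; [exact: h1|exact: h2]. Qed.

Let Lam0 : Lam (fun=> 0) = 0.
Proof.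
have h := @LamZ 0 (fun=> 0) (@cont_cst 0); rewrite mul0r in h.
by rewrite h mul0r.
Qed.

Definition nnc f := cont f /\ forall z, K z -> 0 <= f z.

Let Lam_ge0 f : nnc f -> 0 <= Lam f.
Proof. by move=> [cf f0]; rewrite -Lam0 Lam_le. Qed.

(** Covering by series rather than by single continuous functions builds countable subadditivity
    into the upper integral. *)
Definition upper_cover g : set (nat -> V -> R) := [set F | (forall i, nnc (F i)) /\
  forall z, K z -> (g z <= \sum_(i <oo) (F i z)%:E)%E].

Definition upper_int g : \bar R :=
  ereal_inf [set (\sum_(i <oo) (Lam (F i))%:E)%E | F in upper_cover g].

Lemma upper_int_ge0 g : (0 <= upper_int g)%E.
Proof.
by apply: le_ereal_inf_tmp => _ /= [F [hF _] <-]; apply: nneseries_ge0 => i _ _; rewrite lee_fin Lam_ge0.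
Qed.

Lemma upper_int_le g F : upper_cover g F -> (upper_int g <= \sum_(i <oo) (Lam (F i))%:E)%E.
Proof. by move=> hF; apply: ereal_inf_lbound; exists F. Qed.

Lemma upper_int_le1 g f : nnc f -> (forall z, K z -> (g z <= (f z)%:E)%E) ->
  (upper_int g <= (Lam f)%:E)%E.
Proof.
move=> hf gf; pose F i := if i is 0%N then f else (fun=> 0).
have S1 (a : nat -> \bar R) : a 0%N = a 0%N -> (forall i, a i.+1 = 0%E) -> (0 <= a 0%N)%E -> (\sum_(i <oo) a i = a 0%N)%E.
  move=> _ a0 a00; rewrite nneseries_recl//; last by case=> [|i] _; rewrite ?a0.
  by rewrite eseries_cond/= eseries0 ?adde0// => -[|]//= k _ _.
rewrite -(S1 (fun i => (Lam (F i))%:E)) => //; last 2 first.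
- by move=> i /=; rewrite Lam0.
- by rewrite lee_fin; exact: Lam_ge0.
apply: upper_int_le; split => [[|i]|z Kz] //.
  by split => [|z _] /=; [exact: cont_cst|].
rewrite (S1 (fun i => (F i z)%:E)) => //; first exact: gf.
by rewrite lee_fin; case: hf => _; apply.
Qed.

Lemma le_upper_int g1 g2 : (forall z, K z -> (g1 z <= g2 z)%E) ->
  (upper_int g1 <= upper_int g2)%E.
Proof.
move=> h; apply: le_ereal_inf_tmp => _ /= [F [hF gF] <-]; apply: upper_int_le; split => // z Kz.
by apply: le_trans (gF _ Kz); exact: h.
Qed.

(* The double family of continuous functions produced by the epsilon/2^j covers
   of the [G j] is re-indexed along a bijection of [nat] with [nat * nat]. *)
Lemma upper_int_sigma_subadditive g (G : nat -> V -> \bar R) :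
  (forall z, K z -> (g z <= \sum_(j <oo) G j z)%E) ->
  (forall j z, K z -> (0 <= G j z)%E) ->
  (upper_int g <= \sum_(j <oo) upper_int (G j))%E.
Proof.
move=> gG G0; have [[i ioo]|] := pselect (exists i, upper_int (G i) = +oo%E).
  rewrite (eseries_pinfty _ _ ioo) ?leey// => n _.
  by rewrite -ltNye (lt_le_trans _ (upper_int_ge0 _)).
rewrite -forallNE => Goo.
apply/lee_addgt0Pr => e e0.
rewrite (le_trans _ (epsilon_trick _ (fun n => upper_int_ge0 (G n)) (ltW e0)))//.
pose P j (F : nat -> V -> R) := upper_cover (G j) F /\
  (\sum_(k <oo) (Lam (F k))%:E <= upper_int (G j) + (e / (2 ^ j.+1)%:R)%:E)%E.
have [F PF] : {F : nat -> nat -> V -> R & forall j, P j (F j)}.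
  apply: (@choice _ _ P) => j.
  have ej : 0 < e / (2 ^ j.+1)%:R by rewrite divr_gt0// ltr0n expn_gt0.
  have fin : upper_int (G j) \is a fin_num.
    by rewrite ge0_fin_numE ?upper_int_ge0// ltey; apply/eqP/Goo.
  have [_ [H hH <-] xS] := lb_ereal_inf_adherent ej fin.
  by exists H; split => //; exact: ltW.
have hF jk : nnc (uncurry F jk) by case: jk => j k; exact: (PF j).1.1.
have dsum (a : nat * nat -> \bar R) : (forall jk, (0 <= a jk)%E) ->
    (\esum_(i in setT) a i = \sum_(j <oo) \sum_(k <oo) a (j, k))%E.
  move=> a0; pose J : nat -> set (nat * nat) := fun i => [set (i, j) | j in setT].
  rewrite (_ : setT = \bigcup_k J k); last first.
    by rewrite predeqE => -[x y]; split => // _; exists x => //; exists y.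
  rewrite esum_bigcupT /=; last 2 first.
  - apply/trivIsetP => i j _ _ ij.
    rewrite predeqE => -[n m] /=; split => //= -[] [_] _ [<-{n} _].
    by move=> [m' _] [] /esym/eqP; rewrite (negbTE ij).
  - by move=> /= [n m].
  rewrite -(image_id [set: nat]) -fun_true esum_pred_image//; last first.
    by move=> n _; exact: esum_ge0.
  apply: eq_eseriesr => /= j _.
  rewrite -(esum_pred_image a (pair j) predT)//=; last first.
    by move=> ? ? _ _; exact: (@can_inj _ _ _ snd).
  by congr esum; rewrite predeqE => -[x y]; split; move=> [i _ <-]; exists i.
have /card_esym/ppcard_eqP[f] := card_nat2.
have sreidx (a : nat * nat -> \bar R) : (forall jk, (0 <= a jk)%E) ->
    (\sum_(i <oo) a (f i) = \sum_(j <oo) \sum_(k <oo) a (j, k))%E.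
  move=> a0; rewrite -dsum// -(esum_pred_image a f xpredT) ?[fun=> _]set_true//.
  by rewrite image_eq.
apply: (@le_trans _ _ (\sum_(i <oo) (Lam (uncurry F (f i)))%:E)%E).
  apply: upper_int_le; split => [i|z Kz]; first exact: hF.
  rewrite (sreidx (fun jk => (uncurry F jk z)%:E)); last first.
    by move=> jk; rewrite lee_fin; case: (hF jk) => _; apply.
  apply: le_trans (gG _ Kz) _; apply: lee_nneseries => [j _ _|j _]; first exact: G0.
  by case: (PF j) => -[_ /(_ _ Kz)].
rewrite (sreidx (fun jk => (Lam (uncurry F jk))%:E)); last first.
  by move=> jk; rewrite lee_fin; exact: Lam_ge0.
apply: lee_nneseries => [j _ _|j _]; last by case: (PF j).
by apply: nneseries_ge0 => k _ _; rewrite lee_fin; exact: Lam_ge0 (hF (j, k)).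
Qed.

Let cont_sum (N : nat) F : (forall i, cont (F i)) -> cont (fun z => \sum_(i < N) F i z).
Proof.
move=> h; elim: N => [|N IH].
  by rewrite (_ : (fun z => _) = fun=> 0)//; apply/funext => z; rewrite big_ord0.
rewrite (_ : (fun z => _) = (fun z => \sum_(i < N) F i z) \+ F N); first exact: contD.
by apply/funext => z; rewrite big_ord_recr.
Qed.

Let Lam_sum (N : nat) F : (forall i, cont (F i)) ->
  Lam (fun z => \sum_(i < N) F i z) = \sum_(i < N) Lam (F i).
Proof.
move=> h; elim: N => [|N IH].
  by rewrite big_ord0 -[RHS]Lam0; congr Lam; apply/funext => z; rewrite big_ord0.
rewrite big_ord_recr/= -IH -LamD//; last exact: cont_sum.
by congr Lam; apply/funext => z; rewrite big_ord_recr.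
Qed.

(** The functions [min 1 (m h)], with [h] a weight of [U], are continuous and increase to the
    indicator of [U]. The increments of [f u_m] form a series covering [f] on [U], at cost the limit
    of [Lam (f u_m)], while [f - f u_m] covers [f] off [U] for every [m]; the two costs add up to
    [Lam f]. *)
Lemma upper_int_open_split f (U : set V) : open U -> nnc f ->
  (upper_int (fun z => (f z * \1_U z)%:E) + upper_int (fun z => (f z * \1_(~` U) z)%:E)
    <= (Lam f)%:E)%E.
Proof.
move=> oU hf; have [h [ch h0 hU]] := open_weight oU.
have cf := hf.1; have f0 := hf.2.
pose u m z := Num.min 1 (m%:R * h z).
have cu m : cont (u m).
  apply: cont_min => //; apply: contZ; exact: continuous_subspaceT.
have u0 m z : 0 <= u m z by rewrite le_min ler01/= mulr_ge0.
have u1 m z : u m z <= 1 by rewrite ge_min lexx.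
have uS m z : u m z <= u m.+1 z.
  rewrite le_min u1/= ge_min; apply/orP; right.
  by rewrite ler_wpM2r// ler_nat.
have uoff m z : ~ U z -> u m z = 0.
  move=> Uz; have -> : u m z = Num.min 1 (m%:R * 0); last by rewrite mulr0 min_r.
  rewrite /u; congr (Num.min _ (_ * _)); apply/eqP; rewrite eq_le h0 andbT leNgt.
  by apply/negP => /hU.
have ucvg z : U z -> u m z @[m --> \oo] --> (1 : R).
  move=> /hU hz; apply: cvg_near_cst.
  exists (Num.bound (h z)^-1) => // m /= hm; rewrite /u min_l// -ler_pdivrMr// div1r ltW//.
  by rewrite (lt_le_trans (archi_boundP _))// ?ler_nat// invr_ge0 ltW.
have nu m : nnc (fun z => f z * u m z).
  by split; [exact: contM|move=> z Kz; rewrite mulr_ge0// f0].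
pose d m z := f z * u m.+1 z - f z * u m z.
have cd m : cont (d m).
  rewrite (_ : d m = (fun z => f z * u m.+1 z) \+ (fun z => (-1) * (f z * u m z))); last first.
    by apply/funext => z; rewrite /d/= mulN1r.
  by apply: contD; [exact: (nu _).1|apply: contZ; exact: (nu _).1].
have nd m : nnc (d m).
  by split => // z Kz; rewrite subr_ge0 ler_wpM2l// f0.
have tele m z : \sum_(i < m) d i z = f z * u m z.
  rewrite -(big_mkord xpredT (d ^~ z)) telescope_sumr//.
  by rewrite {2}/u mul0r min_r ?ler01// mulr0 subr0.
have Lc : limn (EFin \o (fun m => Lam (fun z => f z * u m z))) =
    (\sum_(m <oo) (Lam (d m))%:E)%E.
  congr (limn _); apply/funext => m /=; rewrite sumEFin; congr EFin.
  rewrite big_mkord -Lam_sum//; congr Lam; apply/funext => z; by rewrite tele.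
have fin : upper_int (fun z => (f z * \1_(~` U) z)%:E) \is a fin_num.
  rewrite ge0_fin_numE ?upper_int_ge0//; apply: le_lt_trans (ltry (Lam f)).
  apply: upper_int_le1 => // z Kz; rewrite lee_fin -[leRHS]mulr1 ler_wpM2l ?f0//.
apply: (@le_trans _ _ (\sum_(m <oo) (Lam (d m))%:E +
    upper_int (fun z => (f z * \1_(~` U) z)%:E))%E).
  apply: leeD => //; apply: upper_int_le; split => // z Kz.
  rewrite indicE; have [/set_mem Uz|/negbTE nUz] := boolP (z \in U); last first.
    by rewrite mulr0; apply: nneseries_ge0 => m _ _; rewrite lee_fin (nd _).2.
  rewrite mulr1 (_ : limn _ = (f z)%:E)//; apply/cvg_lim => //.
  rewrite (_ : (fun k => _) = EFin \o (fun m => f z * u m z)); last first.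
    by apply/funext => m /=; rewrite sumEFin big_mkord tele.
  apply/cvg_EFin; first exact: nearW.
  rewrite -[X in _ --> X]mulr1; apply: cvgMr; exact: ucvg.
rewrite -Lc -leeBrDr//.
apply: lime_le.
  rewrite (_ : EFin \o _ = fun m => (\sum_(0 <= i < m) (Lam (d i))%:E)%E); last first.
    apply/funext => m /=; rewrite sumEFin; congr EFin.
    by rewrite big_mkord -Lam_sum//; congr Lam; apply/funext => z; rewrite tele.
  by apply: is_cvg_nneseries => m _ _; rewrite lee_fin Lam_ge0.
apply: nearW => m /=; rewrite leeBrDr//.
pose g z := f z + (-1) * (f z * u m z).
have cg : cont g by apply: contD => //; apply: contZ; exact: (nu _).1.
apply: (@le_trans _ _ ((Lam (fun z => f z * u m z))%:E + (Lam g)%:E)%E).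
  rewrite leeD2lE//; apply: upper_int_le1.
    split => // z Kz; rewrite /g mulN1r subr_ge0 -[leRHS]mulr1 ler_wpM2l ?f0//.
  move=> z Kz; rewrite lee_fin indicE /g; case: (boolP (z \in _)) => [/set_mem nU|_].
    by rewrite uoff// !mulr0 addr0 mulr1.
  by rewrite mulr0 mulN1r subr_ge0 -[leRHS]mulr1 ler_wpM2l ?f0//.
rewrite -EFinD -LamD//; last exact: (nu _).1.
rewrite lee_fin le_eqVlt; apply/orP; left; apply/eqP; congr Lam; apply/funext => z /=.
by rewrite /g; ring.
Qed.

Definition riesz_outer (A : set V) : \bar R := upper_int (EFin \o \1_A).

Lemma riesz_outer0 : riesz_outer set0 = 0%E.
Proof.
apply/eqP; rewrite eq_le upper_int_ge0 andbT.
have : (upper_int (EFin \o \1_set0) <= (Lam (fun=> 0%R))%:E)%E; last by rewrite Lam0.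
by apply: upper_int_le1 => [|z _]; [split|rewrite /= indic0].
Qed.

Lemma riesz_outer_ge0 A : (0 <= riesz_outer A)%E. Proof. exact: upper_int_ge0. Qed.

Lemma le_riesz_outer : {homo riesz_outer : A B / A `<=` B >-> (A <= B)%E}.
Proof.
move=> A B AB; apply: le_upper_int => z _ /=; rewrite lee_fin !indicE ler_nat.
by case: (boolP (z \in A)) => // /set_mem/AB/mem_set ->.
Qed.

Lemma riesz_outer_sigma_subadditive : sigma_subadditive riesz_outer.
Proof.
move=> A; apply: upper_int_sigma_subadditive => [z _|j z _ /=]; last by rewrite lee_fin indicE.
rewrite /= indicE; case: (boolP (z \in _)) => [/set_mem[j _ Aj]|_]; last first.
  by apply: nneseries_ge0 => j _ _; rewrite lee_fin indicE.
rewrite (@nneseriesD1 _ _ j)//.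
rewrite (indicE _ (A j)) mem_set// leeDl//; apply: nneseries_ge0 => k _ _; by rewrite lee_fin indicE.
Qed.

HB.instance Definition _ := isOuterMeasure.Build R V riesz_outer
  riesz_outer0 riesz_outer_ge0 le_riesz_outer riesz_outer_sigma_subadditive.

(** It suffices to split each function of a cover of [A] along [U]; the splitting costs add up to
    the cost of the cover. *)
Lemma riesz_outer_open (U : set V) : open U -> riesz_outer.-caratheodory U.
Proof.
move=> oU; apply: le_caratheodory_measurable => A.
apply: le_ereal_inf_tmp => _ /= [F [hF AF] <-].
pose G (B : set V) i z := (F i z * \1_B z)%:E.
have GB (B : set V) : (riesz_outer (A `&` B) <= \sum_(i <oo) upper_int (G B i))%E.
  apply: upper_int_sigma_subadditive => [z Kz|i z Kz]; last first.
    by rewrite lee_fin mulr_ge0 ?(hF i).2// indicE.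
  rewrite /= indicI /= (indicE _ B); have := AF _ Kz; rewrite /=.
  have [zB|zB] := boolP (z \in B).
    rewrite mulr1 => /le_trans; apply; apply: lee_nneseries => [i _ _|i _].
      by rewrite lee_fin (hF i).2.
    by rewrite lee_fin indicE zB mulr1.
  by rewrite mulr0 => _; apply: nneseries_ge0 => i _ _; rewrite lee_fin mulr_ge0 ?(hF i).2// indicE.
apply: le_trans (leeD (GB U) (GB (~` U))) _.
rewrite -nneseriesD; [|by move=> i _ _; exact: upper_int_ge0..].
apply: lee_nneseries => i _; first by rewrite adde_ge0 ?upper_int_ge0.
exact: upper_int_open_split.
Qed.

Lemma riesz_outer_borel (A : set S) : measurable A -> riesz_outer.-caratheodory A.
Proof.
suff : <<s @open V >> `<=` riesz_outer.-caratheodory by exact.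
apply: smallest_sub; last exact: riesz_outer_open.
split.
- exact: caratheodory_measurable_set0.
- by move=> B mB; rewrite setTD; exact: caratheodory_measurable_setC.
- by move=> F mF; exact: caratheodory_measurable_bigcup.
Qed.

Definition riesz_measure (A : set S) : \bar R := riesz_outer A.

Let riesz_measure_sigma_additive : semi_sigma_additive riesz_measure.
Proof.
move=> F mF tF mU; apply: (@caratheodory_measure_sigma_additive _ _ riesz_outer) => //.
  by move=> i; exact: riesz_outer_borel.
exact: riesz_outer_borel.
Qed.

HB.instance Definition _ := isMeasure.Build _ _ _ riesz_measure
  riesz_outer0 riesz_outer_ge0 riesz_measure_sigma_additive.

Let riesz_le_Lam f (A : set V) : nnc f -> (forall z, K z -> A z -> 1 <= f z) ->
  (riesz_measure A <= (Lam f)%:E)%E.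
Proof.
move=> hf h; apply: upper_int_le1 => // z Kz; rewrite /= lee_fin indicE.
by case: (boolP (z \in A)) => [/set_mem/(h _ Kz)//|_]; exact: hf.2.
Qed.

Lemma riesz_measure_fin : fin_num_fun riesz_measure.
Proof.
move=> A mA; rewrite ge0_fin_numE// (le_lt_trans _ (ltry (Lam (fun=> 1))))//.
exact: riesz_le_Lam.
Qed.

HB.instance Definition _ := Measure_isFinite.Build _ _ _ riesz_measure riesz_measure_fin.

Lemma riesz_measure_setC : riesz_measure (~` K) = 0%E.
Proof.
apply/eqP; rewrite eq_le measure_ge0 andbT -[leRHS](congr1 EFin Lam0).
exact: riesz_le_Lam.
Qed.

(* Dini: finitely many members of a cover of the compact set [K] already sum up
   to at least [1 - e]. *)
Lemma Lam1_le : ((Lam (fun=> 1))%:E <= riesz_measure K)%E.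
Proof.
apply: le_ereal_inf_tmp => _ /= [F [hF KF] <-].
apply/lee_addgt0Pr => e e0.
have L0 : 0 <= Lam (fun=> 1) by exact: Lam_ge0.
(* Reaching only [1 - d] costs [d * Lam 1], which this choice keeps below [e]. *)
pose d := e / (Lam (fun=> 1) + 1).
have d0 : 0 < d by rewrite divr_gt0// ltr_pwDr.
have cover : \forall N \near \oo, K `<=` [set z | 1 - d <= \sum_(i < N) F i z].
  have /compact_near_coveringP/near_covering_withinP ncK := cK.
  apply: (ncK nat \oo (fun N z => 1 - d <= \sum_(i < N) F i z)) => z Kz.
  have [N0 zN0] : exists N0, 1 - d < \sum_(i < N0) F i z.
    apply: contrapT => /forallNP h; suff : (1%:E <= (1 - d)%:E)%E by rewrite lee_fin; lra.
    have := KF _ Kz; rewrite /= indicE mem_set// => /le_trans; apply.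
    apply: lime_le; first by apply: is_cvg_nneseries => m _ _; rewrite lee_fin (hF m).2.
    apply: nearW => m; rewrite sumEFin lee_fin big_mkord leNgt; apply/negP; exact: h.
  have ck : cont (fun z => \sum_(i < N0) F i z) by apply: cont_sum => i; exact: (hF i).1.
  have /subspace_continuousP/(_ _ Kz) := ck; move=> /cvgr_gt/(_ _ zN0) Kn.
  near=> z' N => /= Kz'.
  apply: (@le_trans _ _ (\sum_(i < N0) F i z')).
    by apply: ltW; move: Kz'; near: z'; exact: Kn.
  have N0N : (N0 <= N)%N by near: N; exact: nbhs_infty_ge.
  rewrite -!(big_mkord xpredT (F ^~ z')) (big_cat_nat _ N0N)//= lerDl.
  by apply: sumr_ge0 => i _; exact: (hF i).2.
have [N _ /(_ _ (leqnn N)) NK] := cover.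
apply: (@le_trans _ _ (\sum_(i < N) Lam (F i) + e)%:E).
  rewrite lee_fin -Lam_sum; last by move=> i; exact: (hF i).1.
  have : (1 - d) * Lam (fun=> 1) <= Lam (fun z => \sum_(i < N) F i z).
    rewrite -LamZ//; apply: Lam_le => //; last by move=> z /NK /=; rewrite mulr1.
    by apply: cont_sum => i; exact: (hF i).1.
  have : d * Lam (fun=> 1) <= e.
    by rewrite /d -mulrAC ler_pdivrMr ?ltr_pwDr// ler_wpM2l ?(ltW e0)// lerDl.
  by lra.
rewrite EFinD leeD2r// -sumEFin -(big_mkord xpredT (fun i => (Lam (F i))%:E)).
apply: nneseries_lim_ge => i _ _; by rewrite lee_fin Lam_ge0.
Unshelve. all: by end_near. Qed.

Lemma riesz_measureK : riesz_measure K = (Lam (fun=> 1))%:E.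
Proof. by apply/eqP; rewrite eq_le Lam1_le andbT; exact: riesz_le_Lam. Qed.

Local Notation rint f :=
  (\int[riesz_measure]_(z in (K : set S)) (f : S -> R) z)%R.

Let mK : measurable (K : set S). Proof. exact: measurable_gen_compact. Qed.

Let Kfin : (riesz_measure K < +oo)%E. Proof. by rewrite riesz_measureK ltry. Qed.

Let int_cont f : cont f -> riesz_measure.-integrable (K : set S) (EFin \o f).
Proof. exact: within_integrable. Qed.

(* Peeling off the layer [min f d] costs [d * mu {f > 0}], and the next layer's
   share [d * mu {f > d}] is paid by [Lam (min f d)]. *)
Let rint_layers (d : R) (J : nat) f : 0 < d -> nnc f ->
  (forall z, K z -> f z <= J%:R * d) ->
  rint f <= d * fine (riesz_measure (K `&` [set z | 0 < f z])) + Lam f.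
Proof.
move=> d0; elim: J f => [|J IH] f hf fJ.
  rewrite (@eq_Rintegral _ _ _ _ _ (fun=> 0)) => [|z /set_mem Kz]; last first.
    by apply/eqP; rewrite eq_le hf.2// andbT (le_trans (fJ _ Kz))// mul0r.
  by rewrite Rintegral_cst// mul0r addr_ge0 ?Lam_ge0// mulr_ge0 ?(ltW d0) ?fine_ge0.
pose m z := Num.min (f z) d; pose g z := Num.max (f z + (- d)) 0.
have cm : cont m by apply: cont_min => //; exact: hf.1.
have cg : cont g by apply: cont_max => //; apply: contD => //; exact: hf.1.
have hg : nnc g by split => // z _; rewrite le_max lexx orbT.
have hm : nnc m by split => // z Kz; rewrite le_min hf.2//= ltW.
have fE : f = m \+ g.
  apply/funext => z; rewrite /= /m /g; case: (ltP (f z) d) => h.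
    by rewrite max_r ?addr0//; lra.
  by rewrite max_l; lra.
have mf (h : V -> R) : cont h -> measurable (K `&` [set z | 0 < h z] : set S).
  move=> ch; rewrite (_ : [set z | 0 < h z] = h @^-1` `]0, +oo[%classic); last first.
    by apply/seteqP; split => z /=; rewrite in_itv/= andbT.
  exact: (measurable_fun_within cK ch).
have -> : rint f = rint m + rint g.
  by rewrite -RintegralD//; [|exact: int_cont..]; apply: eq_Rintegral => z _; rewrite {1}fE.
have -> : Lam f = Lam m + Lam g by rewrite -LamD// -fE.
apply: lerD.
  have mA := mf f hf.1; set A := _ `&` _ in mA *.
  have iA : riesz_measure.-integrable (K : set S) (EFin \o (\1_A : S -> R)).
    apply: (@bounded_finite_integrable _ _ _ _ _ _ 1) => // z _.
    by rewrite indicE; case: (_ \in _); rewrite ?normr0 ?normr1.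
  apply: (@le_trans _ _ (rint (fun z => d * \1_A z))).
    apply: le_Rintegral => //; [exact: int_cont| |].
      by rewrite (_ : _ \o _ = fun z => (d%:E * (\1_A z)%:E)%E)//; exact: integrableZl.
    move=> z Kz; rewrite indicE /m.
    have [h|h] := ltP 0 (f z); first by rewrite mem_set// mulr1 ge_min lexx orbT.
    by rewrite memNset ?mulr0 ?ge_min ?h// => -[_ /=]; rewrite ltNge h.
  rewrite RintegralZl// ler_wpM2l ?(ltW d0)// le_eqVlt; apply/orP; left; apply/eqP.
  by rewrite /Rintegral integral_indic//; congr (fine (riesz_measure _)); apply/setIidPl => z [].
apply: le_trans (IH g hg _) _.
  move=> z Kz; rewrite /g ge_max mulr_ge0 ?(ltW d0)// andbT.
  by have := fJ _ Kz; rewrite -natr1; lra.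
rewrite lerD2r -ler_pdivlMl// mulrC.
have := mf g cg; set A := _ `&` _ => mA.
rewrite -lee_fin fineK ?riesz_measure_fin//.
rewrite -[_ * _]mulrC -[X in (_ <= X%:E)%E](@LamZ d^-1)//; apply: riesz_le_Lam.
  by split => [|z Kz]; [exact: contZ|rewrite mulr_ge0 ?invr_ge0 ?(ltW d0) ?hm.2].
move=> z Kz [_ /=]; rewrite /g lt_max ltxx orbF => h.
by rewrite /m min_r ?mulVf ?gt_eqF//; lra.
Qed.

(** Slicing into layers of height [d] leaves an excess of at most [d] times the mass of [K], which
    is [d * Lam 1]; then [d] tends to 0. *)
Let rint_le f : nnc f -> rint f <= Lam f.
Proof.
move=> hf; have [M M0 hM] := within_continuous_bound cK hf.1.
have fM z : K z -> f z <= M by move=> /hM; apply: le_trans; exact: ler_norm.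
have L0 : 0 <= Lam (fun=> 1) by exact: Lam_ge0.
apply/ler_addgt0Pr => e e0; pose d := e / (Lam (fun=> 1) + 1).
have d0 : 0 < d by rewrite divr_gt0// ltr_pwDr.
apply: le_trans (@rint_layers d (Num.bound (M / d)) f d0 hf _) _.
  move=> z Kz; rewrite (le_trans (fM _ Kz))// -ler_pdivrMr// ltW// archi_boundP//.
  by rewrite divr_ge0// ltW.
rewrite addrC lerD2l; apply: (@le_trans _ _ (d * Lam (fun=> 1))).
  rewrite ler_wpM2l ?(ltW d0)// -[leRHS]/(fine (Lam (fun=> 1))%:E) -riesz_measureK.
  have mA : measurable (K `&` [set z | 0 < f z] : set S).
    rewrite (_ : [set z | 0 < f z] = f @^-1` `]0, +oo[%classic); last first.
      by apply/seteqP; split => z /=; rewrite in_itv/= andbT.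
    exact: (measurable_fun_within cK hf.1).
  by apply: fine_le; rewrite ?riesz_measure_fin//; apply: le_measure; rewrite ?inE.
by rewrite /d -mulrAC ler_pdivrMr ?ltr_pwDr// ler_wpM2l ?(ltW e0)// lerDl.
Qed.

(** Adding a constant, on which both functionals agree by [riesz_measureK], extends the inequality
    from nonnegative to signed functions; applied to the opposite function it becomes an
    equality. *)
Lemma riesz_measureE f : cont f -> rint f = Lam f.
Proof.
move=> cf; have [N N0 fN] := within_continuous_bound cK cf.
have mKN : rint (fun=> N) = Lam (fun=> N).
  rewrite Rintegral_cst// -[X in fine X]/(riesz_measure K) riesz_measureK/= -LamZ//.
  by congr Lam; apply/funext => z; rewrite mulr1.
have key (h : V -> R) : cont h -> (forall z, K z -> `|h z| <= N) -> rint h <= Lam h.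
  move=> ch hN; have : rint (h \+ (fun=> N)) <= Lam (h \+ (fun=> N)).
    apply: rint_le; split => [|z Kz /=]; first exact: contD.
    by have := hN _ Kz; rewrite ler_norml => /andP[]; lra.
  have -> : rint (h \+ (fun=> N)) = rint h + rint (fun=> N).
    by rewrite -RintegralD//; exact: int_cont.
  by rewrite LamD// mKN lerD2r.
apply/eqP; rewrite eq_le key//=.
have cNf : cont (fun z => (-1) * f z) by exact: contZ.
have := key _ cNf; rewrite LamZ// RintegralZl//; last exact: int_cont.
by rewrite !mulN1r lerN2; apply => z Kz; rewrite mulN1r normrN; exact: fN.
Qed.

Lemma riesz_measure_ex : exists mu : {finite_measure set S -> \bar R},
  mu (~` K) = 0%E /\ forall f, cont f -> (\int[mu]_(z in (K : set S)) f z)%R = Lam f.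
Proof.
by exists riesz_measure; split; [exact: riesz_measure_setC|exact: riesz_measureE].
Qed.

End riesz.

Theorem riesz_representation (R : realType) (V : normedModType R) (K : set V)
    (Lam : (V -> R) -> R) : compact K ->
  (forall f g : V -> R, {within K, continuous f} -> {within K, continuous g} ->
     Lam (f \+ g) = Lam f + Lam g) ->
  (forall (c : R) (f : V -> R), {within K, continuous f} ->
     Lam (fun z => c * f z) = c * Lam f) ->
  (forall f g : V -> R, {within K, continuous f} -> {within K, continuous g} ->
     (forall z, K z -> f z <= g z) -> Lam f <= Lam g) ->
  exists mu : {finite_measure set (g_sigma_algebraType (@open V)) -> \bar R},
    mu (~` K) = 0%E /\ forall f : V -> R, {within K, continuous f} ->
      (\int[mu]_(z in (K : set (g_sigma_algebraType (@open V)))) f z)%R = Lam f.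
Proof. by move=> cK LamD LamZ Lam_le; exact: riesz_measure_ex. Qed.

(** * Weak compactness of finite measures *)

Lemma continuous_near_dist_lt (R : realType) (T : topologicalType) (f : T -> R) (l : T)
  (e : R) : continuous f -> 0 < e -> \forall y \near l, `|f l - f y| < e.
Proof. by move=> cf e0; have /cvgrPdist_lt/(_ _ e0) := cf l. Qed.

(** Tychonoff replaces successive extraction: the sequences indexed by [i] form one sequence in a
    compact product, and the m-th index is chosen so that the first [m] coordinates are within
    [1/(m+1)] of a cluster point. *)
Lemma bounded_diagonal_subsequence (R : realType) (u : nat -> nat -> R) (C : R) :
  (forall i k, `|u i k| <= C) ->
  exists s : nat -> nat, {homo s : i j / (i < j)%N} /\ forall i, cvgn (u i \o s).
Proof.
move=> uC; pose T := prod_topology (fun _ : nat => R : topologicalType).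
pose x (k : nat) : T := fun i => u i k.
have cA : compact [set f : T | forall i, `[- C, C]%classic (f i)].
  exact: (@tychonoff nat (fun=> R : topologicalType) (fun=> `[- C, C]%classic)
    (fun=> @segment_compact _ _ _)).
have [|l [_ xl]] := cA (x @ \oo) _.
  by exists 0%N => // k _ i /=; rewrite in_itv/= -ler_norml; exact: uC.
have step (m N : nat) : exists k, (N < k)%N /\ forall i, (i < m)%N -> `|l i - u i k| < m.+1%:R^-1.
  have near_l : \forall y \near l, forall i, (i < m)%N -> `|l i - y i| < m.+1%:R^-1.
    have : 0 < m.+1%:R^-1 :> R by rewrite invr_gt0.
    move: (m.+1%:R^-1) => e e0; elim: m => [|j IH]; first by near=> y => i.
    have lj : \forall y \near l, `|l j - y j| < e.
      exact: (continuous_near_dist_lt l (@proj_continuous nat (fun=> R : topologicalType) j) e0).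
    near=> y => i; rewrite ltnS leq_eqVlt => /orP[/eqP ->|]; first by near: y.
    by move: i; near: y.
  have : (x @ \oo) (x @` [set k | (N < k)%N]).
    apply: (@filterS _ _ _ [set k | (N < k)%N]); last exact: nbhs_infty_gt.
    by move=> k Nk; exists k.
  by move=> /xl/(_ near_l)[_ [[k Nk <-] h]]; exists k.
pose nxt m N := proj1_sig (cid (step m N)).
have nxtP m N : (N < nxt m N)%N /\ forall i, (i < m)%N -> `|l i - u i (nxt m N)| < m.+1%:R^-1.
  exact: proj2_sig (cid (step m N)).
pose s := fix s m := if m is m'.+1 then nxt m'.+1 (s m') else nxt 0%N 0%N.
exists s; split.
  by apply: homo_ltn => [? ? ?|m]; [exact: ltn_trans|case: (nxtP m.+1 (s m))].
move=> i; apply/cvg_ex; exists (l i); apply/cvgrPdist_lt => e e0.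
have /cvgrPdist_lt/(_ _ e0) h := @cvg_harmonic R; near=> m.
have im : (i < m)%N by near: m; exact: nbhs_infty_gt.
have : `|l i - u i (s m)| < m.+1%:R^-1.
  by case: (m) im => // m' im; case: (nxtP m'.+1 (s m')) => _; apply.
move=> /lt_trans; apply; have : `|0 - harmonic m| < e by near: m.
by rewrite sub0r normrN gtr0_norm//= invr_gt0.
Unshelve. all: by end_near. Qed.

Section pieces.
Context (R : realType) (V : normedModType R).
Local Notation S := (g_sigma_algebraType (@open V)).

Fixpoint pieces (D : set S) (l : seq (set S)) : seq (set S) :=
  if l is B :: l' then (D `&` B) :: pieces (D `\` B) l' else [::].

Lemma piecesP (D : set S) (l : seq (set S)) (mu : {finite_measure set S -> \bar R}) (f : S -> R) :
  measurable D -> (forall B, B \in l -> measurable B) ->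
  (forall z, D z -> exists2 B, B \in l & B z) -> mu.-integrable D (EFin \o f) ->
  [/\ forall A, A \in pieces D l -> measurable A /\ A `<=` D /\ exists2 B, B \in l & A `<=` B,
      (\int[mu]_(z in D) f z)%R = \sum_(A <- pieces D l) (\int[mu]_(z in A) f z)%R
    & fine (mu D) = \sum_(A <- pieces D l) fine (mu A)].
Proof.
elim: l D => [|B l IH] D mD ml Dl iD.
  have -> : D = set0 by apply/seteqP; split => // z /Dl[B].
  by rewrite !big_nil Rintegral_set0 measure0; split.
have mB : measurable B by apply: ml; rewrite inE eqxx.
have mDB : measurable (D `\` B) by exact: measurableD.
have mIB : measurable (D `&` B) by exact: measurableI.
have [||||h1 h2 h3] := IH (D `\` B).
- by [].
- by move=> B' B'l; apply: ml; rewrite inE B'l orbT.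
- move=> z [Dz Bz]; have [B'] := Dl _ Dz; rewrite inE => /orP[/eqP -> //|B'l B'z].
  by exists B'.
- by apply: integrableS iD => // z [].
split => [A||].
- rewrite inE => /orP[/eqP ->|/h1[mA [AD [B' B'l AB]]]].
    by split => //; split => [z []//|]; exists B; [rewrite inE eqxx|move=> z []].
  split => //; split => [z /AD[]//|]; exists B' => //; by rewrite inE B'l orbT.
- by rewrite /= big_cons -h2 -Rintegral_setID.
- rewrite /= big_cons -h3 -fineD ?fin_num_measure// -measureU ?setUIDK//.
  by apply/seteqP; split => // z [[_ Bz] [_]].
Qed.

Lemma pieces_ball (K : set V) (d : R) : compact K -> 0 < d ->
  exists l : seq (set S), [/\ forall B, B \in l -> measurable B,
    forall z, K z -> exists2 B, B \in l & B z &
    forall B, B \in l -> exists c, B `<=` ball (c : V) d].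
Proof.
move=> cK d0; have := cK; rewrite compact_cover => /(_ V setT (fun c => ball c d)).
case.
- by move=> c _; exact: ball_open.
- by move=> z _; exists z => //; exact: ballxx.
move=> D _ KD; exists [seq (ball c d : set S) | c <- finmap.enum_fset D]; split.
- by move=> _ /mapP[c _ ->]; apply: measurable_gen_open; exact: ball_open.
- by move=> z /KD[c cD cz]; exists (ball c d) => //; apply/mapP; exists c.
- by move=> _ /mapP[c _ ->]; exists c.
Qed.

(** Heine's theorem with the second point free in a larger set [D]. This serves perturbed arguments
    that leave the compact set, as happens when [eta] is replaced by [eta_k]. *)
Lemma within_uniformly_continuous (W : normedModType R) (K D : set V) (f : V -> W) (e : R) : compact K ->
  K `<=` D -> {within D, continuous f} -> 0 < e -> exists2 d : R, 0 < d &
    forall z w, K z -> D w -> `|z - w| < d -> `|f z - f w| < e.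
Proof.
move=> cK KD cf e0; have /compact_near_coveringP/near_covering_withinP ncK := cK.
have [|N _ /(_ _ (leqnn N)) h] := ncK nat \oo
    (fun j z => forall w, D w -> `|z - w| < j.+1%:R^-1 -> `|f z - f w| < e) _.
  move=> z Kz; have e20 : 0 < e / 2 by rewrite divr_gt0.
  have /subspace_continuousP/(_ _ (KD _ Kz))/cvgrPdist_lt/(_ _ e20) := cf.
  rewrite near_withinE => /nbhs_ballP[r /= r0 rz].
  have r20 : 0 < r / 2 by rewrite divr_gt0.
  have /cvgrPdist_lt/(_ _ r20) hj := @cvg_harmonic R.
  near=> z' j => /= Kz' w Kw z'w.
  have zz' : `|z - z'| < r / 2 by near: z'; exact: cvgr_dist_lt.
  have jr : j.+1%:R^-1 < r / 2.
    have : `|0 - harmonic j| < r / 2 by near: j.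
    by rewrite sub0r normrN gtr0_norm//= invr_gt0.
  have zw : `|z - w| < r.
    by rewrite (le_lt_trans (ler_distD z' _ _))// [ltRHS](splitr r) ltrD// (lt_trans z'w).
  have b1 : `|f z - f z'| < e / 2.
    by apply: rz; [rewrite -ball_normE/=; lra|exact: KD].
  have b2 : `|f z - f w| < e / 2 by apply: rz => //; rewrite -ball_normE.
  by rewrite (le_lt_trans (ler_distD (f z) _ _))// (distrC (f z')); lra.
exists N.+1%:R^-1 => [|z w Kz Kw]; first by rewrite invr_gt0.
exact: h.
Unshelve. all: by end_near. Qed.

Lemma Rintegral_dist_cst (mu : {finite_measure set S -> \bar R}) (A : set S) (f : S -> R)
    (c d : R) : measurable A -> mu.-integrable A (EFin \o f) ->
  (forall z, A z -> `|f z - c| <= d) ->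
  `|\int[mu]_(z in A) f z - c * fine (mu A)| <= d * fine (mu A).
Proof.
move=> mA iA h.
have ic (x : R) : mu.-integrable A (EFin \o (fun=> x)).
  exact: (@bounded_finite_integrable _ _ _ _ _ _ `|x|).
have le1 : (\int[mu]_(z in A) f z <= \int[mu]_(z in A) (c + d))%R.
  by apply: le_Rintegral => // z /h; rewrite ler_norml => /andP[_]; lra.
have le2 : (\int[mu]_(z in A) (c - d) <= \int[mu]_(z in A) f z)%R.
  by apply: le_Rintegral => // z /h; rewrite ler_norml => /andP[]; lra.
by move: le1 le2; rewrite !Rintegral_cst// mulrDl mulrBl ler_norml => *; apply/andP; split; lra.
Qed.

Lemma fine_measure_le (mu : {finite_measure set S -> \bar R}) (A B : set S) :
  measurable A -> measurable B -> A `<=` B -> fine (mu A) <= fine (mu B).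
Proof. by move=> mA mB AB; apply: fine_le; rewrite ?fin_num_measure// le_measure ?inE. Qed.

(** Once the measures of all pieces of all partitions converge, the Riemann sums of a continuous
    function converge too; they approximate its integrals uniformly in [k] because the masses are
    bounded, so the integrals are Cauchy. *)
Theorem finite_measure_weak_compactness (K : set V) (mu : nat -> {finite_measure set S -> \bar R})
    (C : R) : compact K -> (forall k, (mu k (K : set S) <= C%:E)%E) ->
  exists (s : nat -> nat) (nu : {finite_measure set S -> \bar R}),
    [/\ {homo s : i j / (i < j)%N}, nu (~` K) = 0%E & forall f : V -> R,
      {within K, continuous f} ->
      (\int[mu (s k)]_(z in (K : set S)) f z)%R @[k --> \oo] -->
      (\int[nu]_(z in (K : set S)) f z)%R].
Proof.
move=> cK muC; have mK := measurable_gen_compact cK.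
have muC' k : fine (mu k K) <= C by rewrite -lee_fin fineK ?fin_num_measure.
have C0 : 0 <= C by rewrite (le_trans _ (muC' 0%N))// fine_ge0.
have d0 j : 0 < j.+1%:R^-1 :> R by rewrite invr_gt0.
pose l j := proj1_sig (cid (pieces_ball cK (d0 j))).
have lP j : [/\ forall B, B \in l j -> measurable B,
    forall z, K z -> exists2 B, B \in l j & B z &
    forall B, B \in l j -> exists c, B `<=` ball (c : V) j.+1%:R^-1].
  exact: proj2_sig (cid (pieces_ball cK (d0 j))).
pose P j := pieces K (l j).
have i1 k : (mu k).-integrable (K : set S) (EFin \o (fun=> 1 : R)).
  by apply: (@within_integrable _ _ _ _ (fun=> 1)) => // z; exact: cvg_cst.
have PP k j (f : V -> R) (cf : {within K, continuous f}) :=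
  let: And3 a b _ := lP j in piecesP mK a b (within_integrable (mu k) cK cf).
(* A single index encodes a partition and a position in it; indices out of range give the empty set,
   which is harmless. *)
pose dec i : nat * nat := odflt (0, 0)%N (choice.unpickle i).
pose A i := nth set0 (P (dec i).1) (dec i).2.
have mA i : measurable (A i) /\ A i `<=` K.
  rewrite /A; case: (ltnP (dec i).2 (size (P (dec i).1))) => h.
    have [|PA _ _] := @PP 0%N (dec i).1 (fun=> 1); first by move=> z; exact: cvg_cst.
    by have [? []] := PA _ (mem_nth set0 h).
  by rewrite nth_default//; split => //; exact: sub0set.
have [|s [sh sc]] := @bounded_diagonal_subsequence R (fun i k => fine (mu k (A i))) C.
  move=> i k; rewrite ger0_norm ?fine_ge0// (le_trans _ (muC' k))// fine_measure_le//; by case: (mA i).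
have sc' j B : B \in P j -> cvgn (fun k => fine (mu (s k) B)).
  move=> /(nthP set0)[m mP <-]; have := sc (choice.pickle (j, m)).
  by rewrite /A /dec choice.pickleK.
pose I f k := (\int[mu (s k)]_(z in (K : set S)) (f : V -> R) z)%R.
have Icvg f : {within K, continuous f} -> cvgn (I f).
  move=> cf; apply/cauchy_cvgP; apply: cauchy_exP => e e0.
  pose d := e / 2 / (C + 1).
  have dd : 0 < d by rewrite !divr_gt0// ltr_pwDr.
  have [r r0 fr] := within_uniformly_continuous cK (@subset_refl _ K) cf dd.
  have r20 : 0 < r / 2 by rewrite divr_gt0.
  have [j jr] : exists j, (j.+1%:R^-1 : R) < r / 2.
    have /cvgrPdist_lt/(_ _ r20)[j _ /(_ _ (leqnn j))] := @cvg_harmonic R.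
    by rewrite sub0r normrN gtr0_norm//= ?invr_gt0//; exists j.
  (* For an empty piece [get] returns an arbitrary point, but its value is then multiplied by
     measure 0. *)
  pose x B : R := f (get (B : set V)).
  pose J k := \sum_(B <- P j) x B * fine (mu (s k) B).
  have [L JL] : exists L : R, J k @[k --> \oo] --> L.
    exists (\sum_(B <- P j) x B * lim (fine (mu (s k) B) @[k --> \oo])).
    rewrite /J; elim: (P j) (@sc' j) => [|B Ps IH] Pc.
      by under eq_fun do rewrite big_nil; rewrite big_nil; exact: cvg_cst.
    under eq_fun do rewrite big_cons; rewrite big_cons; apply: cvgD.
      by apply: cvgM; [exact: cvg_cst|apply: Pc; rewrite inE eqxx].
    by apply: IH => B' B'P; apply: Pc; rewrite inE B'P orbT.
  exists L; have e20 : 0 < e / 2 by rewrite divr_gt0.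
  move/cvgrPdist_lt/(_ _ e20) : JL; apply: filterS => k Jk.
  rewrite -ball_normE/=.
  have [PA PI PM] := PP (s k) j f cf.
  have : `|I f k - J k| <= d * fine (mu (s k) K).
    rewrite /I PI PM /J -sumrB mulr_sumr (le_trans (ler_norm_sum _ _ _))//.
    rewrite big_seq [leRHS]big_seq; apply: ler_sum => B BP.
    have [mB [BK [B' B'l BB']]] := PA _ BP.
    apply: Rintegral_dist_cst => //.
      exact: integrableS (within_integrable (mu (s k)) cK cf).
    move=> z Bz; have Bg : B (get (B : set V)) by apply: getI; exact: Bz.
    apply: ltW; apply: fr; [exact: BK|exact: BK|].
    have [_ _ lb] := lP j; have [c B'c] := lb _ B'l.
    have := B'c _ (BB' _ Bz); have := B'c _ (BB' _ Bg); rewrite -!ball_normE/= => h1 h2.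
    rewrite (le_lt_trans (ler_distD (c : V) _ _))// (distrC (z : V)) [ltRHS](splitr r).
    by rewrite ltrD// (lt_trans _ jr).
  have dC : d * fine (mu (s k) K) < e / 2.
    apply: (@le_lt_trans _ _ (d * C)); first by rewrite ler_wpM2l ?(ltW dd).
    rewrite /d -mulrA gtr_pMr// mulrC ltr_pdivrMr ?ltr_pwDr// mul1r; lra.
  by move=> h; rewrite (le_lt_trans (ler_distD (J k) _ _))// (distrC (J k)); lra.
have iK k f : {within K, continuous f} -> (mu k).-integrable (K : set S) (EFin \o f).
  exact: within_integrable.
have [|||nu [nu0 nuE]] := @riesz_representation R V K (fun f => limn (I f)) cK.
- move=> f g cf cg; have -> : I (f \+ g) = (fun k => I f k + I g k).
    by apply/funext => k; rewrite /I -RintegralD//; exact: iK.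
  apply/cvg_lim => //; apply: cvgD; exact: Icvg.
- move=> c f cf; have -> : I (fun z => c * f z) = (fun k => c * I f k).
    by apply/funext => k; rewrite /I -RintegralZl//; exact: iK.
  by apply/cvg_lim => //; apply: cvgM; [exact: cvg_cst|exact: Icvg].
- move=> f g cf cg fg; apply: ler_lim; [exact: Icvg..|].
  by apply: nearW => k; apply: le_Rintegral => //; exact: iK.
exists s, nu; split => // f cf; rewrite nuE//; exact: Icvg.
Qed.

End pieces.

(** * Integrals against signed measures *)

Section perturbation.
Context d (T : measurableType d) (R : realType).
Variable mu : {finite_measure set T -> \bar R}.

(** The integral of a nonnegative function is a supremum over simple functions below it, so
    monotonicity holds for arbitrary functions. *)
Lemma ge0_le_integral_nonmeas (D : set T) (f g : T -> \bar R) :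
  (forall x, D x -> (0 <= f x)%E) -> (forall x, D x -> (f x <= g x)%E) ->
  (\int[mu]_(x in D) f x <= \int[mu]_(x in D) g x)%E.
Proof.
move=> f0 fg; have g0 x : D x -> (0 <= g x)%E by move=> Dx; rewrite (le_trans (f0 _ Dx)) ?fg.
rewrite !ge0_integralE//; apply: le_ereal_sup => _ [h /= hf <-]; exists h => //= x.
apply: le_trans (hf x) _; rewrite /patch; case: ifPn => // /set_mem; exact: fg.
Qed.

(* No measurability is assumed on [f]: its integral is then a difference of two
   lower integrals. *)
Lemma ge0_Rintegral_perturb (D : set T) (f g : T -> R) (M e : R) : measurable D ->
  measurable_fun D g -> (forall x, D x -> 0 <= g x <= M) -> (forall x, D x -> 0 <= f x) ->
  0 <= e -> (forall x, D x -> `|f x - g x| <= e) ->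
  (\int[mu]_(x in D) (f x)%:E)%E \is a fin_num /\
  `|\int[mu]_(x in D) f x - \int[mu]_(x in D) g x| <= e * fine (mu D).
Proof.
move=> mD mg gM f0 e0 fg.
have ig (h : T -> R) (N : R) : measurable_fun D h -> (forall x, D x -> `|h x| <= N) ->
  mu.-integrable D (EFin \o h) by exact: bounded_finite_integrable.
have mge : measurable_fun D (fun x => g x + e) by exact: measurable_funD.
have mgl : measurable_fun D (fun x => Num.max (g x - e) 0).
  by apply: measurable_maxr => //; exact: measurable_funB.
have ge : mu.-integrable D (EFin \o (fun x => g x + e)).
  apply: (ig _ (M + e)) => // x Dx; have /andP[g0 gM'] := gM _ Dx.
  by rewrite ger0_norm ?addr_ge0// lerD2r.
have gl : mu.-integrable D (EFin \o (fun x => Num.max (g x - e) 0)).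
  apply: (ig _ M) => // x Dx; have /andP[g0 gM'] := gM _ Dx.
  by rewrite ger0_norm ?le_max ?lexx ?orbT// ge_max; apply/andP; split; lra.
have gg : mu.-integrable D (EFin \o g).
  by apply: (ig _ M) => // x Dx; have /andP[g0 gM'] := gM _ Dx; rewrite ger0_norm.
have gc : mu.-integrable D (EFin \o (fun=> e)).
  by apply: (ig _ e) => // x _; rewrite ger0_norm.
(* [f] is squeezed between the measurable functions [max (g - e) 0] and [g + e]; truncating at 0
   keeps the lower one nonnegative. *)
have up : (\int[mu]_(x in D) (f x)%:E <= \int[mu]_(x in D) (g x + e)%:E)%E.
  apply: ge0_le_integral_nonmeas => x Dx; rewrite lee_fin; first exact: f0.
  by have := fg _ Dx; rewrite ler_norml => /andP[_]; lra.
have lo : (\int[mu]_(x in D) (Num.max (g x - e) 0)%:E <= \int[mu]_(x in D) (f x)%:E)%E.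
  apply: ge0_le_integral_nonmeas => x Dx; rewrite lee_fin ?le_max ?lexx ?orbT//.
  by rewrite ge_max f0// andbT; have := fg _ Dx; rewrite ler_norml => /andP[]; lra.
have ffin : (\int[mu]_(x in D) (f x)%:E)%E \is a fin_num.
  rewrite ge0_fin_numE; last by apply: integral_ge0 => x Dx; rewrite lee_fin f0.
  by rewrite (le_lt_trans up)// ltey_eq (integrable_fin_num mD ge).
split => //.
have up' : (\int[mu]_(x in D) f x <= \int[mu]_(x in D) (g x + e))%R.
  by apply: fine_le => //; exact: (integrable_fin_num mD ge).
have lo' : (\int[mu]_(x in D) (Num.max (g x - e) 0) <= \int[mu]_(x in D) f x)%R.
  by apply: fine_le => //; exact: (integrable_fin_num mD gl).
have e1 : (\int[mu]_(x in D) (g x + e) = \int[mu]_(x in D) g x + e * fine (mu D))%R.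
  by rewrite RintegralD// Rintegral_cst.
have e2 : (\int[mu]_(x in D) (g x - e) = \int[mu]_(x in D) g x - e * fine (mu D))%R.
  by rewrite RintegralB// Rintegral_cst.
have e3 : (\int[mu]_(x in D) (g x - e) <= \int[mu]_(x in D) (Num.max (g x - e) 0))%R.
  apply: le_Rintegral => //.
    apply: (ig _ (M + e)) => [|x Dx]; first exact: measurable_funB.
    have /andP[g0 gM'] := gM _ Dx.
    by rewrite (le_trans (ler_normB _ _))// !ger0_norm// lerD2r.
  by move=> x Dx; rewrite le_max lexx.
by rewrite ler_norml; apply/andP; split; lra.
Qed.

(** Positive and negative parts are perturbed separately, each by at most [e], whence the factor 2.
    Finiteness of both parts is what allows the real-valued integral to be split. *)
Lemma Rintegral_perturb (D : set T) (f g : T -> R) (M e : R) : measurable D ->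
  measurable_fun D g -> (forall x, D x -> `|g x| <= M) ->
  0 <= e -> (forall x, D x -> `|f x - g x| <= e) ->
  `|\int[mu]_(x in D) f x - \int[mu]_(x in D) g x| <= 2 * e * fine (mu D).
Proof.
move=> mD mg gM e0 fg.
have mg0 : measurable_fun D (fun x => Num.max (g x) 0) by exact: measurable_maxr.
have mg1 : measurable_fun D (fun x => Num.max (- g x) 0).
  by apply: measurable_maxr => //; exact: measurableT_comp.
have max0 (x : R) : 0 <= Num.max x 0 by rewrite le_max lexx orbT.
have maxM (x N : R) : `|x| <= N -> Num.max x 0 <= N.
  by rewrite ler_norml ge_max => /andP[h1 h2]; apply/andP; split; lra.
have dmax (x y : R) : `|x - y| <= e -> `|Num.max x 0 - Num.max y 0| <= e.
  rewrite !ler_norml => /andP[h1 h2].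
  by case: (leP x 0); case: (leP y 0) => h3 h4; apply/andP; split; lra.
have [] := @ge0_Rintegral_perturb D (fun x => Num.max (f x) 0) _ M e mD mg0 _ _ e0.
- by move=> x Dx; rewrite max0 maxM ?gM.
- by move=> x Dx.
- by move=> x Dx; rewrite dmax ?fg.
move=> ffin fge.
have [] := @ge0_Rintegral_perturb D (fun x => Num.max (- f x) 0) _ M e mD mg1 _ _ e0.
- by move=> x Dx; rewrite max0 maxM ?normrN ?gM.
- by move=> x Dx.
- by move=> x Dx; rewrite dmax// -opprD normrN fg.
move=> ffin1 fge1.
have split0 (h : T -> R) : (\int[mu]_(x in D) (Num.max (h x) 0)%:E)%E \is a fin_num ->
    (\int[mu]_(x in D) (Num.max (- h x) 0)%:E)%E \is a fin_num ->
    (\int[mu]_(x in D) h x)%R =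
    (\int[mu]_(x in D) (Num.max (h x) 0) - \int[mu]_(x in D) (Num.max (- h x) 0))%R.
  move=> h1 h2; rewrite /Rintegral integralE -fineB//; congr (fine (_ - _)%E);
  by apply: eq_integral => x _; rewrite ?funeposE ?funenegE /= EFin_max.
have gfin (h : T -> R) : measurable_fun D h -> (forall x, D x -> 0 <= h x <= M) ->
    (\int[mu]_(x in D) (h x)%:E)%E \is a fin_num.
  move=> mh hM; apply: integrable_fin_num => //.
  by apply: (@bounded_finite_integrable _ _ _ _ _ _ M) => // x /hM/andP[h0 h1]; rewrite ger0_norm.
rewrite (split0 f)// (split0 g); last 2 first.
- by apply: gfin => // x Dx; rewrite max0 maxM ?gM.
- by apply: gfin => // x Dx; rewrite max0 maxM ?normrN ?gM.
set a := Rintegral _ _ _ in fge *; set b := Rintegral _ _ _ in fge1 *.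
set a' := Rintegral _ _ _ in fge *; set b' := Rintegral _ _ _ in fge1 *.
rewrite (_ : a - b - (a' - b') = (a - a') - (b - b')); last by ring.
by rewrite (le_trans (ler_normB _ _))//; lra.
Qed.

End perturbation.

Section densities.
Context (R : realType) (V : normedModType R).
Local Notation S := (g_sigma_algebraType (@open V)).
Variables (K : set V) (mu : {finite_measure set S -> \bar R}) (f : S -> R).
Hypotheses (cK : compact K) (intf : mu.-integrable (K : set S) (EFin \o f)).

Let mK : measurable (K : set S). Proof. exact: measurable_gen_compact. Qed.

Lemma bounded_mul_integrable (phi : S -> R) (M : R) : measurable_fun (K : set S) phi ->
  (forall z, K z -> `|phi z| <= M) ->
  mu.-integrable (K : set S) (EFin \o (fun z => phi z * f z)).
Proof.
move=> mphi phiM; have mf : measurable_fun (K : set S) f.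
  by apply/measurable_EFinP; exact: (measurable_int _ intf).
apply: (@le_integrable _ _ _ mu _ mK _ (fun z => M%:E * (f z)%:E)%E).
- by apply/measurable_EFinP; exact: measurable_funM.
- move=> z Kz; rewrite lee_fin !normrM ler_wpM2r//.
  by rewrite (le_trans (phiM _ Kz))// ler_norm.
- exact: integrableZl.
Qed.

(* Both sides are within [delta] of the same Riemann sum over a fine partition
   of [K]. *)
Lemma Rintegral_jordan_density (m1 m2 : {finite_measure set S -> \bar R}) (phi : V -> R) :
  {within K, continuous phi} ->
  (forall A : set S, measurable A -> A `<=` K ->
     fine (m1 A) - fine (m2 A) = (\int[mu]_(z in A) f z)%R) ->
  (\int[m1]_(z in (K : set S)) phi z - \int[m2]_(z in (K : set S)) phi z)%R =
  (\int[mu]_(z in (K : set S)) (phi z * f z))%R.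
Proof.
move=> cphi m12.
have mphi := measurable_fun_within cK cphi.
have [M _ phiM] := within_continuous_bound cK cphi.
have iphif := bounded_mul_integrable mphi phiM.
have inorm : mu.-integrable (K : set S) (EFin \o (fun z => `|f z|)).
  exact: (integrable_norm intf).
(* On each piece [phi] oscillates by at most [d]; the three replacements by a constant then cost
   [d * c] in total. *)
pose c := fine (m1 K) + fine (m2 K) + (\int[mu]_(z in (K : set S)) `|f z|)%R.
have c0 : 0 <= c by rewrite !addr_ge0 ?fine_ge0//; apply: integral_ge0.
apply/eqP; rewrite -subr_eq0 -normr_le0; apply/ler_addgt0Pr => e e0; rewrite add0r.
pose d := e / (c + 1); have d0 : 0 < d by rewrite divr_gt0// ltr_pwDr.
have [r r0 phir] := within_uniformly_continuous cK (@subset_refl _ K) cphi d0.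
have r20 : 0 < r / 2 by rewrite divr_gt0.
have [l [ml Kl lb]] := pieces_ball cK r20.
have i1 := within_integrable m1 cK cphi; have i2 := within_integrable m2 cK cphi.
have [PA P1 M1] := piecesP mK ml Kl i1.
have [_ P2 M2] := piecesP mK ml Kl i2.
have [_ P3 _] := piecesP mK ml Kl iphif.
have [_ P4 _] := piecesP mK ml Kl inorm.
rewrite P1 P2 P3 -!sumrB.
apply: (@le_trans _ _ (d * c)); last first.
  by rewrite /d -mulrAC ler_pdivrMr ?ltr_pwDr// ler_wpM2l ?(ltW e0)// lerDl.
rewrite /c M1 M2 P4 -!big_split/= mulr_sumr (le_trans (ler_norm_sum _ _ _))//.
rewrite big_seq [leRHS]big_seq; apply: ler_sum => A AP.
have [mA [AK [B Bl AB]]] := PA _ AP.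
pose x := phi (get (A : set V)).
have phiA z : A z -> `|phi z - x| <= d.
  move=> Az; have Ag : A (get (A : set V)) by apply: getI; exact: Az.
  apply: ltW; apply: phir; [exact: AK|exact: AK|].
  have [b bB] := lb _ Bl.
  have := bB _ (AB _ Az); have := bB _ (AB _ Ag); rewrite -!ball_normE/= => h1 h2.
  rewrite (le_lt_trans (ler_distD (b : V) _ _))// (distrC (z : V)) [ltRHS](splitr r).
  by rewrite ltrD.
have a1 := Rintegral_dist_cst mA (integrableS mK mA AK i1) phiA.
have a2 := Rintegral_dist_cst mA (integrableS mK mA AK i2) phiA.
have ifA := integrableS mK mA AK intf.
have a3 : `|\int[mu]_(z in A) (phi z * f z) - x * \int[mu]_(z in A) f z|
    <= d * \int[mu]_(z in A) `|f z|.
  have iA := integrableS mK mA AK iphif.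
  rewrite -RintegralZl// -RintegralB//; last first.
    by rewrite (_ : _ \o _ = fun z => (x%:E * (f z)%:E)%E)//; exact: integrableZl.
  have iD : mu.-integrable A (EFin \o (fun z => phi z * f z - x * f z)).
    rewrite (_ : _ \o _ = (fun z => (phi z * f z)%:E - x%:E * (f z)%:E)%E)//.
    by apply: integrableB => //; exact: integrableZl.
  rewrite (le_trans (le_normr_Rintegral _ iD))// -RintegralZl//; last first.
    exact: (integrable_norm ifA).
  apply: le_Rintegral => //; first exact: (integrable_norm iD).
    rewrite (_ : _ \o _ = fun z => (d%:E * `|f z|%:E)%E)//; apply: integrableZl => //.
    exact: (integrable_norm ifA).
  by move=> z Az; rewrite -mulrBl normrM ler_wpM2r// phiA.
rewrite -(m12 A mA AK) in a3.
set t1 := Rintegral _ _ _ in a1 *; set t2 := Rintegral _ _ _ in a2 *.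
set t3 := Rintegral _ _ _ in a3 *.
rewrite (_ : t1 - t2 - t3 = (t1 - x * fine (m1 A)) - (t2 - x * fine (m2 A))
   - (t3 - x * (fine (m1 A) - fine (m2 A)))); last by ring.
rewrite (le_trans (ler_normB _ _))// (le_trans (lerD (ler_normB _ _) (lexx _)))// [leRHS]mulrDr lerD//.
by rewrite mulrDr lerD.
Qed.

End densities.

Section enorm_facts.
Context (R : realType) (n : nat).
Implicit Types u v : 'rV[R]_n.

Lemma dotv_ge0 u : 0 <= dotv u u.
Proof. by apply: sumr_ge0 => i _; rewrite -expr2 sqr_ge0. Qed.

Lemma enorm_ge0 u : 0 <= enorm u. Proof. exact: sqrtr_ge0. Qed.

Lemma enorm_sqr u : enorm u ^+ 2 = dotv u u.
Proof. by rewrite sqr_sqrtr// dotv_ge0. Qed.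

Lemma coord_le_enorm u i : `|u ord0 i| <= enorm u.
Proof.
rewrite -sqrtr_sqr ler_sqrt ?dotv_ge0// /dotv (bigD1 i)//= expr2 lerDl.
by apply: sumr_ge0 => j _; rewrite -expr2 sqr_ge0.
Qed.

Lemma enorm_le_sum u : enorm u <= \sum_i `|u ord0 i|.
Proof.
have s0 : 0 <= \sum_i `|u ord0 i| by apply: sumr_ge0.
rewrite -(ler_pXn2r (_ : (0 < 2)%N)) ?nnegrE ?enorm_ge0// enorm_sqr /dotv expr2 mulr_suml.
apply: ler_sum => i _; apply: le_trans (ler_norm _) _; rewrite normrM ler_wpM2l//.
by rewrite (bigD1 i)//= lerDl; apply: sumr_ge0.
Qed.

End enorm_facts.

Section vcharges.
Context (R : realType) (n : nat).
Local Notation S := (spacetime R n).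
Variable K : set (R * 'rV[R]_n).
Hypothesis cK : compact K.

Let mK : measurable (K : set S). Proof. exact: measurable_gen_compact. Qed.

(** Hides the chosen Hahn decomposition: of the two Jordan parts only their difference on Borel sets
    is remembered. *)
Lemma int_chargeE (nu : {charge set S -> \bar R}) (phi : S -> R) :
  exists m1 m2 : {finite_measure set S -> \bar R},
    int_charge nu K phi =
      (\int[m1]_(z in (K : set S)) phi z - \int[m2]_(z in (K : set S)) phi z)%R /\
    forall A, measurable A -> fine (m1 A) - fine (m2 A) = fine (nu A).
Proof.
rewrite /int_charge /=; set hPN := (X in jordan_pos X); have [[mP _] [mN _] _ _] := hPN.
exists (jordan_pos hPN), (jordan_neg hPN); split => // A mA.
have := jordan_decomp hPN mA; rewrite /cadd/= cscaleN1 => ->.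
by rewrite fineB ?fin_num_measure.
Qed.

Lemma int_charge_density (nu : {charge set S -> \bar R}) (mu : {finite_measure set S -> \bar R})
    (f : S -> R) (phi : R * 'rV[R]_n -> R) :
  mu.-integrable (K : set S) (EFin \o f) ->
  (forall A, measurable A -> nu A = (\int[mu]_(z in A `&` K) (f z)%:E)%E) ->
  {within K, continuous phi} ->
  int_charge nu K phi = (\int[mu]_(z in (K : set S)) (phi z * f z))%R.
Proof.
move=> intf nuE cphi; have [m1 [m2 [-> m12]]] := int_chargeE nu phi.
apply: Rintegral_jordan_density => // A mA AK.
by rewrite (m12 _ mA) (nuE _ mA) (setIidPl _ _).2.
Qed.

(** Each Jordan part has mass at most [C] on [K], being up to sign a value of [nu]; two parts with
    an error [2 e C] each give the factor 4. *)
Lemma int_charge_perturb (nu : {charge set S -> \bar R}) (phi psi : R * 'rV[R]_n -> R)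
    (C e : R) : (forall A, measurable A -> `|fine (nu A)| <= C) ->
  {within K, continuous psi} -> 0 <= e -> (forall z, K z -> `|phi z - psi z| <= e) ->
  `|int_charge nu K phi - int_charge nu K psi| <= 4 * e * C.
Proof.
move=> nuC cpsi e0 he; rewrite /int_charge /=; set hPN := (X in jordan_pos X); have [[mP _] [mN _] _ _] := hPN.
have [M _ psiM] := within_continuous_bound cK cpsi.
have mpsi := measurable_fun_within cK cpsi.
have b1 := @Rintegral_perturb _ S R (jordan_pos hPN) K phi psi _ e mK mpsi psiM e0 he.
have b2 := @Rintegral_perturb _ S R (jordan_neg hPN) K phi psi _ e mK mpsi psiM e0 he.
have m1 : fine (jordan_pos hPN K) <= C.
  rewrite jordan_posE cjordan_posE /crestr0 mem_set//.
  by rewrite (le_trans (ler_norm _))// nuC//; exact: measurableI.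
have m2 : fine (jordan_neg hPN K) <= C.
  rewrite jordan_negE cjordan_negE /crestr0 mem_set// fineN.
  by rewrite (le_trans (ler_norm _))// normrN nuC//; exact: measurableI.
set a := Rintegral _ _ _; set b := Rintegral _ _ _.
set a' := Rintegral _ _ _; set b' := Rintegral _ _ _.
rewrite (_ : a - b - (a' - b') = (a - a') - (b - b')); last by ring.
rewrite (le_trans (ler_normB _ _))// (le_trans (lerD b1 b2))// -mulrDr.
rewrite (_ : 4 * e * C = 2 * e * (C + C)); last by ring.
by rewrite ler_wpM2l ?mulr_ge0// lerD.
Qed.

Lemma density_charge_ex (mu : {finite_measure set S -> \bar R}) (f : S -> R) :
  mu.-integrable (K : set S) (EFin \o f) -> exists nu : {charge set S -> \bar R},
    forall A, measurable A -> nu A = (\int[mu]_(z in A `&` K) (f z)%:E)%E.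
Proof.
move=> intf; have intfK : mu.-integrable setT ((EFin \o f) \_ (K : set S)).
  by rewrite -integrable_mkcond.
exists (induced_charge intfK) => A mA; rewrite /= /induced_charge.
by rewrite [RHS](integral_mkcondr mu A (K : set S)).
Qed.

Lemma tv_norm_coord_le (sigma : vcharge R n) (C : R) (i : 'I_n) (A : set S) :
  (tv_norm sigma <= C%:E)%E -> measurable A -> `|fine (sigma i A)| <= C.
Proof.
move=> sC mA; rewrite -lee_fin; apply: le_trans sC.
apply: (@le_trans _ _ (enorm (vcharge_val sigma A))%:E).
  by rewrite lee_fin; have := coord_le_enorm (vcharge_val sigma A) i; rewrite mxE.
apply: ereal_sup_ubound; exists 1%N, (fun k => if k is 0%N then A else set0); split.
- by case.
- by move=> [|k] [|l] _ _ [z []].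
- by rewrite big_ord1.
Qed.

Section mass.
Let measurable_setDI (B P : set S) : measurable B -> measurable (B `&` P) ->
  measurable (B `\` P).
Proof.
move=> mB mBP; rewrite (_ : B `\` P = B `\` (B `&` P)); first exact: measurableD.
by apply/seteqP; split => z [Bz h]; split => //; [move=> []|move=> Pz; exact: h].
Qed.

Variables (nu : S -> 'rV[R]_n) (mu : {finite_measure set S -> \bar R}) (sigma : vcharge R n).
Hypothesis dens : has_density K nu mu sigma.
Hypothesis nu1 : forall z, K z -> enorm (nu z) = 1.

Let measurable_density_gt0 (B : set S) i : measurable B -> B `<=` K ->
  measurable (B `&` [set z | 0 < nu z ord0 i]).
Proof.
move=> mB BK; have mnu : measurable_fun (K : set S) (fun z => nu z ord0 i).
  by apply/measurable_EFinP; exact: (measurable_int _ (dens i).1).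
rewrite (_ : B `&` _ = B `&` (K `&` (fun z => nu z ord0 i) @^-1` `]0, +oo[%classic)).
  by apply: measurableI => //; exact: mnu.
apply/seteqP; split => z /=; rewrite in_itv/= andbT.
  by move=> [Bz h]; split => //; split => //; exact: BK.
by move=> [Bz [_ h]].
Qed.

(** A unit vector satisfies [1 <= sum |nu_i|], and the integral of [|nu_i|] is read off from
    [sigma i] by separating the points where [nu_i] is positive. *)
Lemma unit_density_mass_le (B : set S) : measurable B -> B `<=` K ->
  fine (mu B) <= \sum_i (fine (sigma i (B `&` [set z | 0 < nu z ord0 i]))
                       - fine (sigma i (B `\` [set z | 0 < nu z ord0 i]))).
Proof.
move=> mB BK; have iK i := (dens i).1; have mK' := mK.
have iB i : mu.-integrable B (EFin \o (fun z => nu z ord0 i)).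
  exact: integrableS (iK i).
have iN i : mu.-integrable B (EFin \o (fun z => `|nu z ord0 i|)).
  exact: integrable_norm (iB i).
have e1 : mu.-integrable B (EFin \o (fun=> 1 : R)).
  by apply: (@bounded_finite_integrable _ _ _ _ _ _ 1) => // z _; rewrite normr1.
have le1 : fine (mu B) <= \sum_i (\int[mu]_(z in B) `|nu z ord0 i|)%R.
  have sumE (I : seq 'I_n) : mu.-integrable B (EFin \o (fun z => \sum_(i <- I) `|nu z ord0 i|)) /\
      (\int[mu]_(z in B) (\sum_(i <- I) `|nu z ord0 i|))%R
      = \sum_(i <- I) (\int[mu]_(z in B) `|nu z ord0 i|)%R.
    elim: I => [|i I [IH1 IH2]].
      rewrite big_nil; under eq_fun do rewrite big_nil; split.
        by apply: (@bounded_finite_integrable _ _ _ _ _ _ 0) => // z _; rewrite normr0.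
      by rewrite Rintegral_cst// mul0r.
    under eq_fun do rewrite big_cons; rewrite big_cons; split.
      exact: (integrableD mB (iN i) IH1).
    by rewrite RintegralD// IH2.
  have [s1 s2] := sumE (index_enum 'I_n).
  rewrite -s2 -[leLHS]mul1r -Rintegral_cst//; apply: le_Rintegral => // z Bz.
  by rewrite -(nu1 (BK _ Bz)) enorm_le_sum.
apply: le_trans le1 _; apply: ler_sum => i _.
set P := [set z | 0 < nu z ord0 i].
have mBP : measurable (B `&` P) by exact: measurable_density_gt0.
have mBN : measurable (B `\` P) by exact: measurable_setDI.
have [_ se] := dens i; rewrite !se// (_ : B `&` P `&` K = B `&` P); last first.
  by apply/setIidPl => z [/BK].
rewrite (_ : (B `\` P) `&` K = B `\` P); last by apply/setIidPl => z [/BK].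
rewrite (Rintegral_setID mBP mBN)//.
have i1 : mu.-integrable (B `&` P) (EFin \o (fun z => nu z ord0 i)).
  by apply: integrableS (iB i) => // z [].
have i2 : mu.-integrable (B `\` P) (EFin \o (fun z => nu z ord0 i)).
  by apply: integrableS (iB i) => // z [].
apply: lerD.
  rewrite le_eqVlt; apply/orP; left; apply/eqP; apply: eq_Rintegral => z /set_mem[_ Pz].
  by rewrite gtr0_norm.
rewrite -[X in _ <= - X]/(\int[mu]_(z in B `\` P) (nu z ord0 i))%R -mulN1r -RintegralZl//.
rewrite le_eqVlt; apply/orP; left; apply/eqP; apply: eq_Rintegral => z /set_mem[_ /negP].
by rewrite -leNgt mulN1r => h; rewrite ler0_norm.
Qed.

Lemma unit_density_mass_bound (C : R) : (tv_norm sigma <= C%:E)%E ->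
  (mu K <= (2 * n%:R * C)%:E)%E.
Proof.
move=> tvC; rewrite -[X in (X <= _)%E](@fineK _ (mu K)) ?fin_num_measure// lee_fin.
apply: (le_trans (unit_density_mass_le mK (@subset_refl _ K))).
have -> : 2 * n%:R * C = \sum_(i < n) (C + C).
  by rewrite sumr_const card_ord -mulr_natl; ring.
apply: ler_sum => i _; have mP := measurable_density_gt0 i mK (@subset_refl _ K).
have mN := measurable_setDI mK mP.
apply: lerD; first by rewrite (le_trans (ler_norm _))// (tv_norm_coord_le _ tvC).
by rewrite (le_trans (ler_norm _))// normrN (tv_norm_coord_le _ tvC).
Qed.

(** Carries null sets over from the charge to [mu]: the sets in the preceding mass estimate all lie
    in [B], so every term vanishes. *)
Lemma unit_density_null (B : set S) : measurable B -> B `<=` K ->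
  (forall A : set S, measurable A -> A `<=` B -> vcharge_val sigma A = 0) -> mu B = 0%E.
Proof.
move=> mB BK h; have h' i (A : set S) : measurable A -> A `<=` B -> fine (sigma i A) = 0.
  by move=> mA AB; have /rowP/(_ i) := h A mA AB; rewrite !mxE.
rewrite -[LHS](@fineK _ (mu B)) ?fin_num_measure//; congr EFin.
apply/eqP; rewrite eq_le fine_ge0// andbT.
apply: (le_trans (unit_density_mass_le mB BK)); rewrite big1// => i _.
have mBP := measurable_density_gt0 i mB BK; have mBN := measurable_setDI mB mBP.
by rewrite !h' ?subr0// => z [].
Qed.

End mass.

End vcharges.

(** * Injectivity near the boundary *)

Section segment.
Context (R : realType) (n : nat).
Implicit Types (f : 'rV[R]_n -> R) (p q h : 'rV[R]_n).

Lemma deriveE_partial f a h : differentiable f a ->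
  'D_h f a = \sum_j h ord0 j * partial j f a.
Proof.
move=> df; rewrite deriveE// {1}(row_sum_delta h) linear_sum/=.
by apply: eq_bigr => j _; rewrite linearZ/= /partial deriveE.
Qed.

Lemma derive_line f p h t : differentiable f (p + t *: h) ->
  is_derive t 1 (fun s => f (p + s *: h)) ('D_h f (p + t *: h)).
Proof.
move=> df.
have E : (fun s : R => s^-1 *: (f (p + (s *: (1 : R) + t) *: h) - f (p + t *: h))) =
    (fun s => s^-1 *: (f (s *: h + (p + t *: h)) - f (p + t *: h))).
  apply/funext => s; congr (_ *: (f _ - _)).
  by rewrite scalerDl /GRing.scale/= mulr1 addrCA.
apply: DeriveDef; first by rewrite /derivable E; exact: diff_derivable.
by rewrite /derive E.
Qed.

(** Mean value theorem for [f] minus the linear form [a]. Differentiability is asked on the open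
    segment only, so that end points may lie on the boundary; the factor [n] comes from the max
    norm. *)
Lemma segment_mean_value f p q (a : 'I_n -> R) (d : R) :
  (forall t : R, 0 < t < 1 -> differentiable f (p + t *: (q - p)) /\
     forall j, `|partial j f (p + t *: (q - p)) - a j| <= d) ->
  {within `[0, 1]%classic, continuous (fun t : R => f (p + t *: (q - p)))} ->
  `|f q - f p - \sum_j a j * (q - p) ord0 j| <= n%:R * d * `|q - p|.
Proof.
move=> hd hc; set h := q - p.
have [t t01] := MVT (ltr01 : (0 : R) < 1) (fun t (ht : t \in `]0, 1[) =>
  derive_line (hd t ht).1) hc.
rewrite /= scale1r scale0r addr0 subr0 mulr1 [p + _]addrC subrK => ->.
have [dt dj] := hd t t01; rewrite deriveE_partial// -sumrB.
rewrite (le_trans (ler_norm_sum _ _ _))//.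
apply: (@le_trans _ _ (\sum_(j < n) d * `|h|)); last first.
  by rewrite sumr_const card_ord -[leLHS]mulr_natl mulrA.
apply: ler_sum => j _; rewrite mulrC -mulrBl normrM ler_pM// coord_le_norm//.
Qed.

End segment.

Section proj.
Context (R : realType) (n : nat).
Implicit Types (e u v : 'rV[R]_n).

Lemma dotvDl u v w : dotv (u + v) w = dotv u w + dotv v w :> R.
Proof. by rewrite -big_split/=; apply: eq_bigr => i _; rewrite mxE mulrDl. Qed.

Lemma dotvZl (c : R) u w : dotv (c *: u) w = c * dotv u w.
Proof. by rewrite mulr_sumr; apply: eq_bigr => i _; rewrite mxE mulrA. Qed.

Lemma dotvC u v : dotv u v = dotv v u :> R.
Proof. by apply: eq_bigr => i _; rewrite mulrC. Qed.

Lemma dotvBl u v w : dotv (u - v) w = dotv u w - dotv v w :> R.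
Proof. by rewrite dotvDl -scaleN1r dotvZl mulN1r. Qed.

Lemma dotv_le u v : `|dotv u v| <= n%:R * `|u| * `|v|.
Proof.
rewrite (le_trans (ler_norm_sum _ _ _))//.
apply: (@le_trans _ _ (\sum_(j < n) `|u| * `|v|)); last first.
  by rewrite sumr_const card_ord -[leLHS]mulr_natl mulrA.
by apply: ler_sum => j _; rewrite normrM ler_pM// coord_le_norm.
Qed.

Lemma unit_dotv e : enorm e = 1 -> dotv e e = 1 :> R.
Proof. by move=> e1; rewrite -enorm_sqr e1 expr1n. Qed.

Lemma norm_le_enorm u : `|u| <= enorm u.
Proof.
rewrite leNgt; apply/negP => h; have : `|u| < `|u|; last by rewrite ltxx.
by apply/rV_norm_ltP => [|i]; [exact: le_lt_trans (enorm_ge0 u) h|exact: le_lt_trans (coord_le_enorm u i) h].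
Qed.

Lemma unit_norm_le1 e : enorm e = 1 -> `|e| <= 1.
Proof. by move=> <-; exact: norm_le_enorm. Qed.

Lemma proj_perpD e u v : proj_perp e (u + v) = proj_perp e u + proj_perp e v.
Proof. by rewrite /proj_perp dotvDl scalerDl opprD addrACA. Qed.

Lemma proj_perpZ e (c : R) u : proj_perp e (c *: u) = c *: proj_perp e u.
Proof. by rewrite /proj_perp dotvZl scalerBr scalerA. Qed.

Lemma proj_perpB e u v : proj_perp e (u - v) = proj_perp e u - proj_perp e v.
Proof. by rewrite proj_perpD -scaleN1r proj_perpZ scaleN1r. Qed.

Lemma proj_perp_self e : enorm e = 1 -> proj_perp e e = 0.
Proof. by move=> e1; rewrite /proj_perp unit_dotv// scale1r subrr. Qed.

Lemma dotv_proj_perp e u : enorm e = 1 -> dotv (proj_perp e u) e = 0 :> R.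
Proof. by move=> e1; rewrite /proj_perp dotvBl dotvZl unit_dotv// mulr1 subrr. Qed.

Lemma norm_proj_perp_le e u : enorm e = 1 -> `|proj_perp e u| <= (n%:R + 1) * `|u|.
Proof.
move=> e1; rewrite (le_trans (ler_normB _ _))// normrZ mulrDl mul1r addrC lerD2r.
have e2 := unit_norm_le1 e1; rewrite -[leRHS]mulr1.
apply: ler_pM => //; rewrite (le_trans (dotv_le _ _))// -[leRHS]mulr1.
by rewrite ler_wpM2l// mulr_ge0.
Qed.

End proj.

Lemma dist_le_continuous (R : realType) (V W : normedModType R) (f : V -> W) (L : R) :
  (forall u v, `|f u - f v| <= L * `|u - v|) -> continuous f.
Proof.
move=> h u; apply/cvgrPdist_lt => d d0; near=> v.
have N0 : 0 < `|L| + 1 by rewrite ltr_wpDl.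
apply: le_lt_trans (h u v) _; apply: (@le_lt_trans _ _ ((`|L| + 1) * `|u - v|)).
  by rewrite ler_wpM2r// (le_trans (ler_norm L))// lerDl.
rewrite -ltr_pdivlMl//; near: v; apply: cvgr_dist_lt => //; by rewrite mulr_gt0// invr_gt0.
Unshelve. all: by end_near. Qed.

Lemma continuous_line (R : realType) (V : normedModType R) (p h : V) :
  continuous (fun t : R => p + t *: h).
Proof.
apply: (@dist_le_continuous _ R^o _ _ `|h|) => s t.
by rewrite opprD addrACA subrr add0r -scalerBl normrZ mulrC.
Qed.

Lemma continuous_dist_to (R : realType) (V : normedModType R) (x : V) :
  continuous (fun y : V => `|y - x|).
Proof.
apply: (@dist_le_continuous _ _ R^o _ 1) => u v; rewrite mul1r.
rewrite (_ : u - v = (u - x) - (v - x)) ?ler_dist_dist//.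
by rewrite opprB addrA subrK.
Qed.

Section chart.
Context (R : realType) (n : nat).
Local Notation Rn := 'rV[R]_n.

Lemma continuous_proj_perp (e : Rn) : enorm e = 1 -> continuous (proj_perp e).
Proof.
move=> e1; apply: (@dist_le_continuous _ _ _ _ (n%:R + 1)) => u v.
by rewrite -proj_perpB norm_proj_perp_le.
Qed.

Lemma continuous_dotv (e : Rn) : continuous (fun u : Rn => dotv u e : R).
Proof.
apply: (@dist_le_continuous _ _ _ _ (n%:R * `|e|)) => u v.
by rewrite -dotvBl (le_trans (dotv_le _ _))// mulrAC.
Qed.

(** In the unit ball the Hoelder condition bounds the gradient by its value at the centre plus
    [|L|]; the ball is convex, so the mean value inequality applies. *)
Lemma C1alpha_lipschitz_ball (alpha : R) (g : Rn -> R) (w : Rn) : 0 < alpha ->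
  C1alpha alpha g -> exists2 L : R, 0 <= L & forall u v, `|u - w| < 1 -> `|v - w| < 1 ->
    `|g u - g v| <= L * `|u - v|.
Proof.
move=> al0 [dg [L hL]]; pose M := `|sgrad g w| + `|L|.
exists (n%:R * M) => [|u v uw vw]; first by rewrite mulr_ge0// addr_ge0.
have := @segment_mean_value R n g v u (fun=> 0) M.
rewrite big1 ?subr0; last by move=> j _; rewrite mul0r.
apply.
  move=> t /andP[t0 t1]; split => // j; rewrite subr0; set z := v + _.
  have zw : `|z - w| < 1.
    rewrite (_ : z - w = (1 - t) *: (v - w) + t *: (u - w)); last first.
      rewrite /z; move: t0 t1 => _ _; apply/rowP => i; rewrite !mxE; ring.
    rewrite (le_lt_trans (ler_normD _ _))// !normrZ (gtr0_norm t0) gtr0_norm ?subr_gt0//.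
    apply: (@lt_le_trans _ _ ((1 - t) * 1 + t * 1)); last by rewrite !mulr1 subrK.
    by rewrite ltrD// ltr_pM2l// subr_gt0.
  have -> : partial j g z = sgrad g z ord0 j by rewrite mxE.
  rewrite (le_trans (coord_le_norm _ _))// (_ : sgrad g z = sgrad g w + (sgrad g z - sgrad g w)).
    rewrite (le_trans (ler_normD _ _))// lerD2l (le_trans (hL _ _))//.
    rewrite (le_trans (ler_wpM2r _ (ler_norm L)))// -[leRHS]mulr1 ler_wpM2l//.
    have h1 : (1 : R) `^ alpha = 1 by rewrite powR1.
    by rewrite -[leRHS]h1 ge0_ler_powR// ?nnegrE// ltW.
  by rewrite addrC subrK.
apply: continuous_subspaceT => t; apply: continuous_comp; last exact: differentiable_continuous.
exact: (@continuous_line _ _ v (u - v) t).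
Qed.

Lemma graph_chart_closure (alpha : R) (Q : set Rn) (x0 e : Rn) (g : Rn -> R) (r : R) :
  enorm e = 1 -> C1alpha alpha g ->
  (forall y, `|y - x0| < r -> (Q y <-> g (proj_perp e y) < dotv y e)) ->
  forall x, closure Q x -> `|x - x0| < r -> g (proj_perp e x) <= dotv x e.
Proof.
move=> e1 [dg _] hr x Qx xr; rewrite leNgt; apply/negP => lt.
have cont : continuous ((fun y => dotv y e) \- (g \o proj_perp e)).
  move=> y; apply: continuousB; first exact: (@continuous_dotv e y).
  by apply: continuous_comp; [exact: continuous_proj_perp|exact: differentiable_continuous].
have neg : \forall y \near x, dotv y e - g (proj_perp e y) < 0.
  by apply: (cvgr_lt _ (cont x)); rewrite subr_lt0.
have dist : \forall y \near x, `|y - x0| < r.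
  exact: (cvgr_lt _ (@continuous_dist_to _ _ x0 x)).
have [y [Qy [yneg yr]]] := Qx _ (filterI neg dist).
by have := (hr y yr).1 Qy; move: yneg => /=; rewrite subr_lt0 => /lt_trans h /h; rewrite ltxx.
Qed.

(* Two points near the boundary are joined inside Q by moving a multiple of their
   distance along [e], then parallel to the segment, and back. *)
Lemma graph_chart_path (alpha : R) (Q : set Rn) (x0 e : Rn) (g : Rn -> R) : 0 < alpha ->
  graph_chart alpha Q x0 e g -> exists rho Lam : R, [/\ 0 < rho, 0 < Lam &
    forall x y, closure Q x -> closure Q y -> `|x - x0| < rho -> `|y - x0| < rho -> x != y ->
      [/\ forall t : R, 0 < t <= 1 -> Q (x + t *: ((Lam * `|x - y|) *: e)),
          forall t : R, 0 <= t <= 1 -> Q ((x + (Lam * `|x - y|) *: e) + t *: (y - x)) &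
          forall t : R, 0 <= t <= 1 ->
            `|x + t *: ((Lam * `|x - y|) *: e) - x0| <= `|x - x0| + (Lam + 1) * `|x - y| /\
            `|(x + (Lam * `|x - y|) *: e) + t *: (y - x) - x0|
              <= `|x - x0| + (Lam + 1) * `|x - y|]].
Proof.
move=> al0 [e1 [Cg [r r0 hr]]].
have [L L0 gL] := C1alpha_lipschitz_ball (proj_perp e x0) al0 Cg.
have n0 : 0 <= n%:R :> R by exact: ler0n.
have n10 : 0 < n%:R + 1 :> R by rewrite ltr_wpDl.
(* Per unit of [|x - y|], the summand [n] pays for the change of height along [y - x], [L (n + 1)]
   for the change of the graph below, and 1 is the strict margin. *)
pose Lam : R := n%:R + L * (n%:R + 1) + 1.
have Lam0 : 0 < Lam by rewrite ltr_wpDl// addr_ge0// mulr_ge0// ltW.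
(* The second bound keeps projections in the unit ball where [g] is Lipschitz, since [proj_perp]
   expands distances by at most [n + 1]. *)
pose r' := Num.min r (n%:R + 1)^-1.
have r'0 : 0 < r' by rewrite lt_min r0 invr_gt0.
have c0 : 0 < 2 * Lam + 4 by lra.
(* With [|x - y| <= 2 rho], the path stays within [rho + 2 (Lam + 1) rho = (2 Lam + 3) rho] of [x0];
   4 instead of 3 makes this strictly less than [r']. *)
exists (r' / (2 * Lam + 4)), Lam; split => //; first by rewrite divr_gt0.
set rho := r' / _; have rho0 : 0 < rho by rewrite divr_gt0.
have rhor : (2 * Lam + 3) * rho < r'.
  by rewrite /rho mulrCA gtr_pMr// ltr_pdivrMr//; lra.
move=> x y Qx Qy xr yr xy.
have d0 : 0 < `|x - y| by rewrite normr_gt0 subr_eq0.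
have d2 : `|x - y| <= 2 * rho.
  by rewrite (le_trans (ler_distD x0 _ _))// (distrC x0); lra.
set s := Lam * `|x - y|; have s0 : 0 < s by rewrite mulr_gt0.
have sle : s <= 2 * Lam * rho by rewrite /s [2 * Lam]mulrC -mulrA ler_wpM2l// ltW.
have ee := unit_norm_le1 e1.
have tse (t : R) : 0 <= t <= 1 -> `|t *: (s *: e)| <= s.
  move=> /andP[t0 t1]; rewrite scalerA normrZ -[leRHS]mulr1 ler_pM//.
  by rewrite (ger0_norm (mulr_ge0 t0 (ltW s0))) ler_piMl// ltW.
have C1 (t : R) : 0 <= t <= 1 -> `|x + t *: (s *: e) - x0| <= `|x - x0| + (Lam + 1) * `|x - y|.
  move=> ht; rewrite addrAC (le_trans (ler_normD _ _))// mulrDl mul1r -/s.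
  by have := tse t ht; lra.
have C2 (t : R) : 0 <= t <= 1 ->
    `|(x + s *: e) + t *: (y - x) - x0| <= `|x - x0| + (Lam + 1) * `|x - y|.
  move=> ht; rewrite addrAC (le_trans (ler_normD _ _))// mulrDl mul1r -/s.
  have h1 : `|x + s *: e - x0| <= `|x - x0| + s.
    rewrite addrAC (le_trans (ler_normD _ _))// lerD//.
    by have := tse 1; rewrite scale1r; apply; rewrite ler01 lexx.
  have h2 : `|t *: (y - x)| <= `|x - y|.
    case/andP: ht => t0 t1; rewrite normrZ distrC (ger0_norm t0) -[leRHS]mul1r.
    by rewrite ler_wpM2r.
  by lra.
have C3 : `|x - x0| + (Lam + 1) * `|x - y| <= (2 * Lam + 3) * rho.
  by rewrite mulrDl mul1r -/s; lra.
have B1 (t : R) (ht : 0 <= t <= 1) := le_trans (C1 t ht) C3.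
have B2 (t : R) (ht : 0 <= t <= 1) := le_trans (C2 t ht) C3.
have rr z : `|z - x0| <= (2 * Lam + 3) * rho -> `|z - x0| < r /\ `|proj_perp e z - proj_perp e x0| < 1.
  move=> hz; have hz' : `|z - x0| < r' by exact: le_lt_trans rhor.
  split; first by rewrite (lt_le_trans hz')// ge_min lexx.
  rewrite -proj_perpB (le_lt_trans (norm_proj_perp_le _ e1))// -ltr_pdivlMl// mulr1.
  by rewrite (lt_le_trans hz')// ge_min lexx orbT.
have xx0 : `|x - x0| < r.
  by have := B1 0; rewrite scale0r addr0 lexx ler01 => /(_ isT)/rr[].
have gx := graph_chart_closure e1 Cg hr Qx xx0.
have px : `|proj_perp e x - proj_perp e x0| < 1.
  by have := B1 0; rewrite scale0r addr0 lexx ler01 => /(_ isT)/rr[].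
split=> [t /andP[t0 t1]|t ht|t ht]; last by split; [exact: C1|exact: C2].
  apply/hr; first by apply: (rr _ (B1 t _)).1; rewrite (ltW t0).
  rewrite proj_perpD scalerA proj_perpZ proj_perp_self// scaler0 addr0.
  by rewrite dotvDl dotvZl unit_dotv// mulr1 ltr_pwDr// mulr_gt0.
apply/hr; first exact: (rr _ (B2 t ht)).1.
set m := _ + t *: _.
have pm : `|proj_perp e m - proj_perp e x0| < 1 by exact: (rr _ (B2 t ht)).2.
have gm := gL _ _ pm px; case/andP: ht => t0 t1.
have pmx : `|proj_perp e m - proj_perp e x| <= (n%:R + 1) * `|x - y|.
  rewrite /m !proj_perpD proj_perpZ proj_perp_self// scaler0 addr0 [X in `|X|]addrC addrA.
  rewrite addNr add0r proj_perpZ normrZ ger0_norm// -[leRHS]mul1r ler_pM//.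
  by rewrite [X in _ <= _ * X]distrC norm_proj_perp_le.
have gm' : g (proj_perp e m) <= g (proj_perp e x) + L * ((n%:R + 1) * `|x - y|).
  rewrite -lerBlDl (le_trans (ler_norm _))// (le_trans gm)// ler_wpM2l//.
have de : - (n%:R * `|x - y|) <= t * dotv (y - x) e.
  rewrite lerNl -mulrN (le_trans (ler_norm _))// normrM normrN (ger0_norm t0) -[leRHS]mul1r.
  rewrite ler_pM// (le_trans (dotv_le _ _))// distrC -[leRHS]mulr1 ler_wpM2l// mulr_ge0//.
rewrite /m !dotvDl !dotvZl unit_dotv// mulr1 (le_lt_trans gm')//.
move: de gx; rewrite /s /Lam => de gx.
rewrite [L * (_ * _)]mulrA; move: d0 de gx; set w := `|x - y|; set a := t * _; set b := L * _.
by move=> d0 de gx; rewrite !mulrDl mul1r; lra.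
Qed.

Lemma entry_le_norm (m k : nat) (A : 'M[R]_(m, k)) i j : `|A i j| <= `|A|.
Proof.
rewrite [leRHS]/Num.norm/= mx_normrE; apply/bigmax_geP; right => /=.
by exists (i, j).
Qed.

Lemma norm_invmx_le (A : 'M[R]_n) (h : Rn) (c : R) : A \in unitmx ->
  (forall i, `|\sum_j A i j * h ord0 j| <= c) -> 0 <= c -> `|h| <= n%:R * `|invmx A| * c.
Proof.
move=> uA hc c0; have C0 : 0 <= n%:R * `|invmx A| * c by rewrite !mulr_ge0.
rewrite leNgt; apply/negP => lt; suff : `|h| < `|h| by rewrite ltxx.
apply/rV_norm_ltP => [|j]; first exact: le_lt_trans lt.
apply: le_lt_trans lt.
have -> : h ord0 j = \sum_i invmx A j i * (\sum_j A i j * h ord0 j).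
  have : h^T = invmx A *m (A *m h^T) by rewrite mulKmx.
  move=> /matrixP/(_ j ord0); rewrite !mxE => ->; apply: eq_bigr => i _; congr (_ * _).
  by rewrite mxE; apply: eq_bigr => l _; rewrite mxE.
rewrite (le_trans (ler_norm_sum _ _ _))//.
apply: (@le_trans _ _ (\sum_(i < n) `|invmx A| * c)); last first.
  by rewrite sumr_const card_ord -[leLHS]mulr_natl mulrA.
by apply: ler_sum => i _; rewrite normrM ler_pM// entry_le_norm.
Qed.

Lemma segment_grad_close (Q : set Rn) (f : Rn -> Rn) (A : 'M[R]_n) (x0 p h : Rn) (rho d : R) i :
  {within closure Q, continuous f} -> (forall x, Q x -> differentiable f x) ->
  (forall y, Q y -> `|y - x0| < rho -> `|grad f y - A| <= d) ->
  closure Q p -> (forall t : R, 0 < t <= 1 -> Q (p + t *: h)) ->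
  (forall t : R, 0 <= t <= 1 -> `|p + t *: h - x0| < rho) ->
  `|f (p + h) ord0 i - f p ord0 i - \sum_j A i j * h ord0 j| <= n%:R * d * `|h|.
Proof.
move=> cf df gf Qp Qt rt.
have hE : h = (p + h) - p by rewrite addrC addKr.
have := @segment_mean_value R n (coordf f i) p (p + h) (A i) d; rewrite -hE; apply.
  move=> t /andP[t0 t1]; have Qz : Q (p + t *: h) by apply: Qt; rewrite t0 ltW.
  split=> [|j].
    exact: (@differentiable_comp _ _ _ _ f (fun v : Rn => v ord0 i : R^o) _ (df _ Qz)
      (differentiable_coord _ _ _)).
  have -> : partial j (coordf f i) (p + t *: h) - A i j = (grad f (p + t *: h) - A) i j.
    by rewrite !mxE.
  rewrite (le_trans (entry_le_norm _ _ _))// gf// rt// (ltW t0) ltW//.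
have cQ t : `[0, 1]%classic t -> closure Q (p + t *: h).
  rewrite /= in_itv/= => /andP[t0 t1]; move: t0; rewrite le_eqVlt => /orP[/eqP <-|t0].
    by rewrite scale0r addr0.
  by apply: subset_closure; apply: Qt; rewrite t0.
apply/subspace_continuousP => t ht; apply/cvgrPdist_lt => e e0.
have /subspace_continuousP/(_ _ (cQ _ ht))/cvgrPdist_lt/(_ _ e0) := cf.
rewrite !near_withinE => hf.
have := @continuous_line R _ p h t _ hf.
move=> hn; near=> s => sI.
have hs : closure Q (p + s *: h) -> `|f (p + t *: h) - f (p + s *: h)| < e.
  by near: s; exact: hn.
apply: le_lt_trans (hs (cQ _ sI)).
have := coord_le_norm (f (p + t *: h) - f (p + s *: h)) i; rewrite !mxE; exact.
Unshelve. all: by end_near. Qed.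

(* [f - A] is a small Lipschitz perturbation along the three-segment paths, and
   their length is comparable to the distance of the end points. *)
Lemma graph_chart_injectivity (alpha : R) (Q : set Rn) (x0 e : Rn) (g : Rn -> R)
    (A : 'M[R]_n) : 0 < alpha -> graph_chart alpha Q x0 e g -> A \in unitmx ->
  exists2 d : R, 0 < d & forall rho : R, 0 < rho -> exists2 rho' : R, 0 < rho' &
    forall f : Rn -> Rn, {within closure Q, continuous f} ->
      (forall x, Q x -> differentiable f x) ->
      (forall y, Q y -> `|y - x0| < rho -> `|grad f y - A| <= d) ->
      forall x y, closure Q x -> closure Q y -> `|x - x0| < rho' -> `|y - x0| < rho' ->
        f x = f y -> x = y.
Proof.
move=> al0 hc uA; have e1 := hc.1.
(* Later [c] is the common value of a component of [f] at [x] and [y], [a] and [b] its values at the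
   two raised points, and [X] the linear part of the raising, which is the same for both and
   cancels. Only [Y], from [A (y - x)], remains. *)
have tri (a b c X Y u v w : R) : `|a - c - X| <= u -> `|b - c - X| <= v ->
    `|b - a - Y| <= w -> `|Y| <= u + v + w.
  rewrite !ler_norml => /andP[? ?] /andP[? ?] /andP[? ?]; apply/andP; split; lra.
have [r [Lam [r0 Lam0 path]]] := graph_chart_path al0 hc.
(* The three segments have total length at most [(2 Lam + 1) |x - y|]; inverting [A] gives
   [|x - y| <= N d |x - y|], a contradiction for [d = 1/(N + 1)]. *)
pose N : R := n%:R * `|invmx A| * (n%:R * (2 * Lam + 1)).
have N0 : 0 <= N by rewrite !mulr_ge0// addr_ge0// mulr_ge0// ltW.
have N10 : 0 < N + 1 by rewrite ltr_wpDl.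
exists (N + 1)^-1; first by rewrite invr_gt0.
move=> rho rho0; have c0 : 0 < 2 * Lam + 3 by lra.
exists (Num.min r (rho / (2 * Lam + 3))); first by rewrite lt_min r0 divr_gt0.
move=> f cf df gf x y Qx Qy; rewrite !lt_min => /andP[xr xrho] /andP[yr yrho] fxy.
apply/eqP; apply: contrapT => /negP xy.
have yx : y != x by rewrite eq_sym.
have [Px Pxy Bx] := path x y Qx Qy xr yr xy.
have [Py _ By] := path y x Qy Qx yr xr yx; rewrite (distrC y x) in Py By.
have d0 : 0 < `|x - y| by rewrite normr_gt0 subr_eq0.
have d2 : `|x - y| < 2 * (rho / (2 * Lam + 3)).
  by rewrite (le_lt_trans (ler_distD x0 _ _))// (distrC x0); lra.
have lt (z : Rn) : `|z - x0| < rho / (2 * Lam + 3) ->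
    `|z - x0| + (Lam + 1) * `|x - y| < rho.
  move=> hz; rewrite -[ltRHS](@divfK _ (2 * Lam + 3)) ?gt_eqF//.
  set w := rho / _ in xrho yrho d2 hz *.
  have : (Lam + 1) * `|x - y| <= (Lam + 1) * (2 * w) by rewrite ler_wpM2l//; lra.
  by move=> h; rewrite (_ : w * (2 * Lam + 3) = w + (Lam + 1) * (2 * w)); [lra|ring].
set s := Lam * `|x - y| in Px Pxy Bx Py By.
have s0 : 0 < s by rewrite mulr_gt0.
have se : `|s *: e| <= s.
  by rewrite normrZ gtr0_norm// ler_piMr ?(ltW s0)// unit_norm_le1.
set d := (N + 1)^-1 in gf; have dd0 : 0 < d by rewrite invr_gt0.
have Qx1 : closure Q (x + s *: e).
  by apply: subset_closure; have := Px 1; rewrite scale1r; apply; rewrite ltr01 lexx.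
have key i : `|\sum_j A i j * (y - x) ord0 j| <= d * (n%:R * (2 * Lam + 1)) * `|x - y|.
  have k1 := segment_grad_close i cf df gf Qx Px (fun t ht => le_lt_trans (Bx t ht).1 (lt x xrho)).
  have k2 := segment_grad_close i cf df gf Qy Py (fun t ht => le_lt_trans (By t ht).1 (lt y yrho)).
  have k3 := segment_grad_close i cf df gf Qx1
    (fun t (ht : 0 < t <= 1) => Pxy t (introT andP (conj (ltW (andP ht).1) (andP ht).2)))
    (fun t ht => le_lt_trans (Bx t ht).2 (lt x xrho)).
  have yE : x + s *: e + (y - x) = y + s *: e by rewrite addrC addrA subrK.
  rewrite yE in k3.
  have nd0 : 0 <= n%:R * d by rewrite mulr_ge0// ltW.
  have k1' := le_trans k1 (ler_wpM2l nd0 se); have k2' := le_trans k2 (ler_wpM2l nd0 se).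
  rewrite fxy in k1'; rewrite (distrC y x) in k3.
  rewrite (_ : d * _ * _ = n%:R * d * s + n%:R * d * s + n%:R * d * `|x - y|); last first.
    by rewrite /s; ring.
  move: k1' k2' k3; set X := \sum_j _; set Y := \sum_j A i j * (y - x) ord0 j.
  exact: tri.
have := norm_invmx_le uA key; rewrite (distrC y x) => /(_ _) hN.
have : `|x - y| < `|x - y|; last by rewrite ltxx.
apply: (le_lt_trans (hN _)).
  by rewrite !mulr_ge0 ?(ltW dd0)//; lra.
rewrite (_ : _ * _ * _ = N * d * `|x - y|); last by rewrite /N; ring.
by rewrite gtr_pMl// /d ltr_pdivrMr// mul1r ltrDl.
Qed.

End chart.

(** * Deformed normals *)

Section matrix_continuity.
Context (R : realType).

Lemma mx_norm_le (m k : nat) (A : 'M[R]_(m, k)) (c : R) : 0 <= c ->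
  (forall i j, `|A i j| <= c) -> `|A| <= c.
Proof.
by move=> c0 h; rewrite {1}/Num.norm/= mx_normrE; apply/bigmax_leP; split => // -[i j] _ /=.
Qed.

Lemma continuous_entry (m k : nat) (i : 'I_m) (j : 'I_k) : continuous (fun A : 'M[R]_(m, k) => A i j).
Proof.
apply: (@dist_le_continuous _ _ R^o _ 1) => A B; rewrite mul1r.
by have := entry_le_norm (A - B) i j; rewrite !mxE.
Qed.

Lemma continuous_cmul (V : normedModType R) (c : R) (F : V -> R) :
  continuous F -> continuous (fun x => c * F x).
Proof. by move=> h x; apply: (@continuousM _ _ (fun=> c)); [exact: cvg_cst|exact: h]. Qed.

Lemma continuous_det (m : nat) : continuous (fun A : 'M[R]_m => \det A).
Proof.
apply: continuous_big => [|s _]; first exact: add_continuous.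
apply: continuous_cmul; apply: continuous_big => [|i _]; first exact: mul_continuous.
exact: continuous_entry.
Qed.

Lemma continuous_cofactor (m : nat) (i j : 'I_m) : continuous (fun A : 'M[R]_m => cofactor A i j).
Proof.
have cmin : continuous (fun A : 'M[R]_m => row' i (col' j A)).
  apply: (@dist_le_continuous _ _ _ _ 1) => A B; rewrite mul1r.
  by apply: mx_norm_le => // k l; have := entry_le_norm (A - B) (lift i k) (lift j l); rewrite !mxE.
apply: continuous_cmul => A.
exact: (@continuous_comp _ _ _ (fun A : 'M[R]_m => row' i (col' j A)) _ _ (cmin A) (@continuous_det _ _)).
Qed.

Lemma continuous_finite_near (V : normedModType R) (I : finType) (F : I -> V -> R) (a : V)
    (e : R) : (forall i, continuous (F i)) -> 0 < e ->
  exists2 d : R, 0 < d & forall b, `|a - b| < d -> forall i, `|F i a - F i b| < e.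
Proof.
move=> cF e0; have : \forall b \near a, forall i, `|F i a - F i b| < e.
  by apply: filter_forall => i; have /cvgrPdist_lt/(_ _ e0) := cF i a.
move=> /nbhs_ballP[d /= d0 dB]; exists d => // b ab; apply: dB.
by rewrite -ball_normE.
Qed.

Lemma cofactor_mx_near (m : nat) (A : 'M[R]_m) (e : R) : 0 < e ->
  exists2 d : R, 0 < d & forall B : 'M[R]_m, `|A - B| < d ->
    `|cofactor_mx A - cofactor_mx B| <= e.
Proof.
move=> e0; have [d d0 dB] := @continuous_finite_near _ _ (fun ij (B : 'M[R]_m) =>
  cofactor B ij.1 ij.2) A e (fun ij => @continuous_cofactor m ij.1 ij.2) e0.
exists d => // B AB; apply: mx_norm_le; first exact: ltW.
by move=> i j; rewrite /cofactor_mx !mxE ltW//; exact: (dB B AB (i, j)).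
Qed.

End matrix_continuity.

Section normals.
Context (R : realType) (n : nat).
Local Notation Rn := 'rV[R]_n.
Implicit Types u v w : Rn.

Lemma enorm_normalize u : u != 0 -> enorm (normalize u) = 1.
Proof.
move=> u0; have e0 : 0 < enorm u.
  by apply: lt_le_trans (norm_le_enorm u); rewrite normr_gt0.
rewrite /enorm /normalize dotvZl dotvC dotvZl -enorm_sqr mulrA -expr2 -exprMn.
by rewrite mulVf ?gt_eqF// expr1n sqrtr1.
Qed.

(** The difference of the squared norms is the scalar product of [u - w] and [u + w]; dividing by
    the sum of the norms requires the case where this sum is 0 to be set apart. *)
Lemma enorm_dist u w : `|enorm u - enorm w| <= n%:R * `|u - w|.
Proof.
have nd : 0 <= n%:R * `|u - w| by rewrite mulr_ge0.
have [s0|s0] := eqVneq (enorm u + enorm w) 0.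
  have : enorm u = 0 /\ enorm w = 0 by have := enorm_ge0 u; have := enorm_ge0 w; lra.
  by move=> [-> ->]; rewrite subrr normr0.
have sp : 0 < enorm u + enorm w by rewrite lt_neqAle eq_sym s0 addr_ge0 ?enorm_ge0.
rewrite -(ler_pM2r sp) -{1}(gtr0_norm sp) -normrM.
have -> : (enorm u - enorm w) * (enorm u + enorm w) = dotv (u - w) (u + w).
  rewrite -subr_sqr !enorm_sqr dotvBl (dotvC u) (dotvC w) !dotvDl (dotvC w u); ring.
rewrite (le_trans (dotv_le _ _))// ler_wpM2l// (le_trans (ler_normD _ _))//.
by rewrite lerD// norm_le_enorm.
Qed.

Lemma normalize_dist u w (m : R) : 0 < m -> m <= `|u| -> m <= `|w| ->
  `|normalize u - normalize w| <= (n%:R + 1) / m * `|u - w|.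
Proof.
move=> m0 mu mw; have eu : m <= enorm u by rewrite (le_trans mu)// norm_le_enorm.
have ew : m <= enorm w by rewrite (le_trans mw)// norm_le_enorm.
have eu0 : 0 < enorm u by exact: lt_le_trans eu.
have ew0 : 0 < enorm w by exact: lt_le_trans ew.
rewrite (_ : normalize u - normalize w =
   (enorm u)^-1 *: (u - w) + ((enorm u)^-1 * ((enorm w - enorm u) / enorm w)) *: w); last first.
  rewrite /normalize scalerBr -addrA; congr (_ + _).
  rewrite mulrBl divff ?gt_eqF// mulrBr mulr1 mulrA mulVf ?gt_eqF// mul1r.
  by rewrite scalerBl addKr.
rewrite (le_trans (ler_normD _ _))// !normrZ mulrDl mulrDl addrC.
have iu : `|(enorm u)^-1| <= m^-1 by rewrite gtr0_norm ?invr_gt0// lef_pV2.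
apply: lerD; last by rewrite div1r ler_wpM2r.
have hX : `|enorm w - enorm u| <= n%:R * `|u - w| by rewrite distrC enorm_dist.
have hw : `|(enorm w)^-1| * `|w| <= 1.
  by rewrite normfV (gtr0_norm ew0) mulrC ler_pdivrMr// mul1r norm_le_enorm.
rewrite (_ : _ * _ * `|w| =
  (`|(enorm u)^-1| * `|enorm w - enorm u|) * (`|(enorm w)^-1| * `|w|)); last by ring.
rewrite (_ : n%:R / m * _ = m^-1 * (n%:R * `|u - w|) * 1); last by ring.
by rewrite !ler_pM// mulr_ge0.
Qed.

Lemma mulmx_tr_norm_le (A : 'M[R]_n) v : `|(A *m v^T)^T| <= n%:R * `|A| * `|v|.
Proof.
apply: mx_norm_le; first by rewrite !mulr_ge0.
move=> i j; rewrite !mxE (le_trans (ler_norm_sum _ _ _))//.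
apply: (@le_trans _ _ (\sum_(k < n) `|A| * `|v|)); last first.
  by rewrite sumr_const card_ord -[leLHS]mulr_natl mulrA.
by apply: ler_sum => k _; rewrite normrM !mxE ler_pM// ?entry_le_norm// coord_le_norm.
Qed.

Lemma unit_norm_ge v : enorm v = 1 -> 1 <= n%:R * `|v|.
Proof.
move=> v1; rewrite -[leLHS]v1 (le_trans (enorm_le_sum _))//.
apply: (@le_trans _ _ (\sum_(k < n) `|v|)).
  by apply: ler_sum => k _; exact: coord_le_norm.
by rewrite sumr_const card_ord -[leLHS]mulr_natl.
Qed.

Definition push_normal (A : 'M[R]_n) v : Rn := normalize (cofactor_mx A *m v^T)^T.

(* [A^T cof(A) = det(A)] bounds [cof(A) v] from below uniformly in the unit vector [v]. *)
Lemma cofactor_mx_unit_ge (A : 'M[R]_n) v : \det A != 0 -> enorm v = 1 ->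
  `|\det A| <= n%:R * n%:R * `|A| * `|(cofactor_mx A *m v^T)^T|.
Proof.
move=> dA v1; set w := (_ *m _)^T.
have E : (A^T *m w^T)^T = \det A *: v.
  rewrite /w trmxK mulmxA /cofactor_mx -trmx_mul mul_adj_mx tr_scalar_mx mul_scalar_mx.
  by rewrite linearZ/= trmxK.
have AT : `|A^T| <= `|A| by apply: mx_norm_le => // i j; rewrite mxE entry_le_norm.
have := mulmx_tr_norm_le A^T w; rewrite E normrZ => h.
have n0 : 0 <= n%:R :> R by [].
have h2 := ler_wpM2l (normr_ge0 (\det A)) (unit_norm_ge v1); rewrite mulr1 in h2.
apply: (le_trans h2); rewrite mulrCA -!mulrA ler_wpM2l//.
by rewrite (le_trans h)// -mulrA !ler_wpM2l// ler_wpM2r.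
Qed.

(** The radius is independent of [v]: the lower bound on the cofactor image is uniform over unit
    vectors, and normalization is Lipschitz away from 0. *)
Lemma push_normal_near (A : 'M[R]_n) (e : R) : (0 < n)%N -> \det A != 0 -> 0 < e ->
  exists2 d : R, 0 < d & forall B B' v, `|A - B| < d -> `|A - B'| < d -> enorm v = 1 ->
    enorm (push_normal B v) = 1 /\ `|push_normal B v - push_normal B' v| <= e.
Proof.
move=> n0 dA e0; have n1 : 0 < n%:R :> R by rewrite ltr0n.
pose m := `|\det A| / (n%:R * n%:R * `|A| + 1).
have m0 : 0 < m by rewrite divr_gt0 ?normr_gt0// ltr_wpDl// !mulr_ge0.
have m20 : 0 < m / 2 by rewrite divr_gt0.
pose c := (n%:R + 1) / (m / 2).
have c0 : 0 < c by rewrite divr_gt0// ltr_wpDl.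
(* The first bound keeps perturbed vectors longer than [m / 2], where normalization has Lipschitz
   constant [c]; the second makes two errors [t] cost at most [e]. *)
pose t := Num.min (m / 2) (e / c / 2).
have t0 : 0 < t by rewrite lt_min m20 divr_gt0// divr_gt0.
have tn0 : 0 < t / n%:R by rewrite divr_gt0.
have [d d0 hd] := cofactor_mx_near A tn0.
pose W (B : 'M[R]_n) v := (cofactor_mx B *m v^T)^T.
have WA v : enorm v = 1 -> m <= `|W A v|.
  move=> v1; rewrite /m ler_pdivrMr; last by rewrite ltr_wpDl// !mulr_ge0.
  rewrite (le_trans (cofactor_mx_unit_ge dA v1))// mulrDr mulr1 mulrC lerDl//.
have WB B v : `|A - B| < d -> enorm v = 1 -> `|W A v - W B v| <= t.
  move=> AB v1; rewrite /W -linearB/= -mulmxBl (le_trans (mulmx_tr_norm_le _ _))//.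
  have -> : t = n%:R * (t / n%:R) * 1 by rewrite mulr1 mulrC divfK// gt_eqF.
  apply: ler_pM; rewrite ?mulr_ge0//; last exact: unit_norm_le1.
  by rewrite ler_wpM2l// hd.
have Wge B v : `|A - B| < d -> enorm v = 1 -> m / 2 <= `|W B v|.
  move=> AB v1; have := WA v v1; have := WB B v AB v1.
  have := ler_normD (W A v - W B v) (W B v); rewrite subrK.
  have : t <= m / 2 by rewrite ge_min lexx.
  by lra.
exists d => // B B' v AB AB' v1; split.
  by apply: enorm_normalize; rewrite -normr_gt0 (lt_le_trans m20)// Wge.
rewrite (le_trans (normalize_dist m20 (Wge _ _ AB v1) (Wge _ _ AB' v1)))// -/c.
rewrite -ler_pdivlMl// mulrC.
have := WB B v AB v1; have := WB B' v AB' v1; have : t <= e / c / 2 by rewrite ge_min lexx orbT.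
rewrite -/(W B v) -/(W B' v) => h1 h2 h3.
by rewrite (le_trans (ler_distD (W A v) _ _))// (distrC (W B v)); lra.
Qed.

End normals.

(** * Boundary charts and inner unit normals of the reference domain *)

Section boundary.
Context (R : realType) (n : nat) (alpha : R).
Local Notation Rn := 'rV[R]_n.
Implicit Types Q : set Rn.

Lemma bounded_C1alpha_open Q : bounded_C1alpha_domains alpha Q -> open Q.
Proof.
by move=> [N [D [hD _ ->]]]; apply: bigcup_open => i _; have [[]] := hD i.
Qed.

Lemma bounded_C1alpha_bounded Q : bounded_C1alpha_domains alpha Q -> bounded_set Q.
Proof.
move=> [N [D [hD _ ->]]].
have hM i : exists M : R, forall x, D i x -> `|x| <= M.
  by have [_ [M [Mr h]]] := hD i; exists (M + 1) => x Dx; apply: (h (M + 1)) => //; rewrite ltrDl.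
pose f i := proj1_sig (cid (hM i)).
have fP i x : D i x -> `|x| <= f i by exact: (proj2_sig (cid (hM i))).
exists (\sum_i `|f i|); split; [exact: num_real|].
move=> y hy x [i _ Dx] /=; rewrite (le_trans (fP _ _ Dx))// (le_trans _ (ltW hy))//.
by rewrite (le_trans (ler_norm _))// (bigD1 i)//= lerDl; apply: sumr_ge0.
Qed.

Lemma bounded_closure_compact Q : bounded_set Q -> compact (closure Q).
Proof.
move=> [M [Mr hM]]; apply: bounded_closed_compact; last exact: closed_closure.
exists M; split => // c Mc x cx; apply/ler_addgt0Pr => s s0.
have [y [Qy xy]] := cx _ (nbhsx_ballx x s s0).
have := hM c Mc y Qy => /= hy; move: xy; rewrite -ball_normE/= => xy.
by rewrite -(subrK y x) addrC (le_trans (ler_normD _ _))// lerD// ltW.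
Qed.

Lemma bounded_bd_compact Q : bounded_set Q -> compact (bd Q).
Proof.
move=> bQ; apply: (subclosed_compact _ (bounded_closure_compact bQ)); last by move=> x [].
by apply: closedI; [exact: closed_closure|apply: open_closedC; exact: open_interior].
Qed.

(** Exactly one component has [x] in its closure; the other finitely many stay at positive distance,
    so on a smaller ball a chart of that component is a chart of [Q]. *)
Lemma bd_chart Q x : bounded_C1alpha_domains alpha Q -> bd Q x ->
  exists e g, graph_chart alpha Q x e g.
Proof.
move=> dQ; have oQ := bounded_C1alpha_open dQ; case: dQ => N [D [hD dis QE]].
move=> [cQx nQx]; have nQ : ~ Q x.
  by move=> Qx; apply: nQx; exact: open_nbhs_nbhs.
have sepi j : ~ closure (D j) x -> exists2 r : R, 0 < r & forall y, `|y - x| < r -> ~ D j y.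
  move=> h; have : nbhs x (~` closure (D j)).
    by apply: open_nbhs_nbhs; split => //; apply: closed_openC; exact: closed_closure.
  move=> /nbhs_ballP[r /= r0 rD]; exists r => // y yx Dy.
  by apply: (rD y); [rewrite -ball_normE/= distrC|exact: subset_closure].
have sep (P : pred 'I_N.+1) : (forall j, P j -> ~ closure (D j) x) ->
    exists2 r : R, 0 < r & forall y, `|y - x| < r -> forall j, P j -> ~ D j y.
  move=> h; have hr j : exists2 r : R, 0 < r & forall y, `|y - x| < r -> P j -> ~ D j y.
    have [Pj|Pj] := boolP (P j); last by exists 1.
    by have [r r0 hr] := sepi j (h j Pj); exists r => // y yx _; exact: hr.
  pose r j := proj1_sig (cid2 (hr j)).
  have r0 j : 0 < r j by rewrite /r; case: cid2.
  have rP j y : `|y - x| < r j -> P j -> ~ D j y by rewrite /r; case: cid2 => /= ? _; exact.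
  exists (\big[Num.min/1]_j r j) => [|y yx j Pj].
    by elim/big_ind: _ => // a b a0 b0; rewrite lt_min a0.
  apply: rP => //; apply: lt_le_trans yx _.
  exact: bigmin_le_cond.
have [i cDi] : exists i, closure (D i) x.
  apply: contrapT => /forallNP h.
  have [r r0 hr] := sep xpredT (fun j _ => h j).
  have [y [Qy yx]] := cQx _ (nbhsx_ballx x r r0).
  by move: Qy; rewrite QE => -[j _]; apply: hr; rewrite // -opprB normrN; move: yx; rewrite -ball_normE.
have bDi : bd (D i) x.
  by split => // /nbhs_singleton Dx; apply: nQ; rewrite QE; exists i.
have [[_ _ _ /(_ _ bDi)[e [g [e1 [Cg [r r0 hr]]]]]] _] := hD i.
exists e, g; split => //; split => //.
have [j ji|r1 r10 hr1] := sep (fun j => j != i).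
  by move=> cj; have : (closure (D j) `&` closure (D i)) x by []; rewrite dis.
exists (Num.min r r1); first by rewrite lt_min r0.
move=> y; rewrite lt_min => /andP[yr yr1]; rewrite -hr// QE; split => [[j _ Dj]|Di]; last by exists i.
by have [<-//|ji] := eqVneq j i; have := hr1 y yr1 j ji.
Qed.

(** Holds for whichever chart [get] selects: the conormal has component 1 along the chart direction,
    so it is nonzero. *)
Lemma inner_normal_unit Q x : bounded_C1alpha_domains alpha Q -> bd Q x ->
  enorm (inner_normal alpha Q x) = 1.
Proof.
move=> dQ bx; have [e [g hc]] := bd_chart dQ bx.
have : [set nu | exists e g, graph_chart alpha Q x e g /\ nu = normalize (chart_conormal e g x)]
    (inner_normal alpha Q x).
  by apply: getI; exists e, g.
move=> [e' [g' [[e1 _] ->]]]; apply: enorm_normalize; apply/eqP => h.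
have : dotv (chart_conormal e' g' x) e' = 0.
  by rewrite h /dotv big1// => i _; rewrite mxE mul0r.
rewrite /chart_conormal dotvBl unit_dotv// dotv_proj_perp// subr0 => /eqP.
by rewrite oner_eq0.
Qed.

End boundary.

(** * Extension of gradients to the closure of the domain *)

Section boundary_gradient.
Context (R : realType) (n : nat) (p : R).
Hypothesis pn : n%:R < p.
Local Notation Rn := 'rV[R]_n.
Implicit Types (Q : set Rn) (f : Rn -> Rn).

Let gamma0 : 0 < 1 - n%:R / p.
Proof. by rewrite subr_gt0 ltr_pdivrMr ?mul1r// (le_lt_trans _ pn). Qed.

Lemma closure_near Q x (P : Rn -> Prop) : closure Q x -> (\forall y \near within Q (nbhs x), P y) ->
  forall r : R, 0 < r -> exists y, [/\ Q y, `|y - x| < r & P y].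
Proof.
move=> cQ; rewrite near_withinE => hP r r0.
have [y [Qy [hy yr]]] := cQ _ (filterI hP (nbhsx_ballx x r r0)).
by exists y; split => //; [move: yr; rewrite -ball_normE/= distrC|exact: hy].
Qed.

(** On [Q] the gradient is Hoelder continuous with the exponent [1 - n/p], positive because [p > n],
    hence Cauchy when a point of the closure is approached. *)
Lemma cgrad_cvg Q f x : C1gamma_closure p Q f -> closure Q x ->
  grad f y @[y --> within Q (nbhs x)] --> cgrad Q f x.
Proof.
move=> [_ _ [L hL]] cQ; have PF : ProperFilter (within Q (nbhs x)).
  by apply: within_nbhs_proper.
suff : cauchy (grad f y @[y --> within Q (nbhs x)]) by move/cauchy_cvg.
apply: cauchy_exP => e e0.
have eL : 0 < e / (`|L| + 1) by rewrite divr_gt0// ltr_wpDl.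
have [d d0 hd] := powR_normr_small gamma0 eL.
have d20 : 0 < d / 2 by rewrite divr_gt0.
have [y0 [Qy0 y0x]] := cQ _ (nbhsx_ballx x _ d20).
exists (grad f y0).
change (\forall y \near x, Q y -> ball (grad f y0) e (grad f y)).
have : \forall y \near x, ball x (d / 2) y by exact: nbhsx_ballx.
move: y0x; rewrite -!ball_normE/= => y0x; apply: filterS => y /= yx Qy.
rewrite (le_lt_trans (hL _ _ Qy0 Qy))//.
have yy : `|y0 - y| < d.
  by rewrite (le_lt_trans (ler_distD x _ _))// (distrC y0); lra.
have := hd `|y0 - y|; rewrite normr_id => /(_ yy).
rewrite ltr_pdivlMr ?ltr_wpDl// => h; apply: le_lt_trans h; rewrite mulrC ler_wpM2l ?powR_ge0//.
by rewrite (le_trans (ler_norm _))// lerDl.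
Qed.

Lemma cgrad_approx Q f x (e r : R) : C1gamma_closure p Q f -> closure Q x -> 0 < e -> 0 < r ->
  exists y, [/\ Q y, `|y - x| < r & `|cgrad Q f x - grad f y| < e].
Proof.
move=> hf cQ e0 r0; have /cvgrPdist_lt/(_ _ e0) h := cgrad_cvg hf cQ.
exact: closure_near h _ r0.
Qed.

Lemma cgrad_dist_le Q f x0 x (A : 'M[R]_n) (r d : R) : C1gamma_closure p Q f -> closure Q x ->
  `|x - x0| < r -> (forall y, Q y -> `|y - x0| < r -> `|grad f y - A| <= d) ->
  `|cgrad Q f x - A| <= d.
Proof.
move=> hf cQ xr h; apply/ler_addgt0Pr => e e0.
have r0 : 0 < r - `|x - x0| by rewrite subr_gt0.
have [y [Qy yx ye]] := cgrad_approx hf cQ e0 r0.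
have yr : `|y - x0| < r.
  by rewrite (le_lt_trans (ler_distD x _ _))//; lra.
by rewrite (le_trans (ler_distD (grad f y) _ _))// addrC lerD ?h// ltW.
Qed.

Lemma cgrad_det_ge Q f x (e0 : R) : C1gamma_closure p Q f -> closure Q x ->
  (forall y, Q y -> e0 <= \det (grad f y)) -> e0 <= \det (cgrad Q f x).
Proof.
move=> hf cQ h; apply/ler_addgt0Pr => e ep.
have /cvgrPdist_lt/(_ _ ep)/nbhs_ballP[d /= d0 dB] := @continuous_det R n (cgrad Q f x).
have [y [Qy _ yd]] := cgrad_approx hf cQ d0 ltr01.
have := dB (grad f y); rewrite -ball_normE => /(_ yd).
by have := h _ Qy; rewrite ltr_norml => h1 /andP[h2 h3]; lra.
Qed.

Lemma closure_dist_le Q (f g : Rn -> Rn) (x : Rn) (e : R) : {within closure Q, continuous f} ->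
  {within closure Q, continuous g} -> (forall y, Q y -> `|f y - g y| <= e) ->
  closure Q x -> `|f x - g x| <= e.
Proof.
move=> cf cg h cQ; apply/ler_addgt0Pr => d d0.
have d20 : 0 < d / 2 by rewrite divr_gt0.
have /subspace_continuousP/(_ _ cQ)/cvgrPdist_lt/(_ _ d20) hf := cf.
have /subspace_continuousP/(_ _ cQ)/cvgrPdist_lt/(_ _ d20) hg := cg.
move: hf hg; rewrite !near_withinE => hf hg.
have [y [Qy [yf yg]]] := cQ _ (filterI hf hg).
have := yf (subset_closure Qy); have := yg (subset_closure Qy) => /= {}yg {}yf.
have := ler_distD (f y) (f x) (g x); have := ler_distD (g y) (f y) (g x).
by have := h _ Qy; rewrite (distrC (g y)); lra.
Qed.

End boundary_gradient.

(** * Convergence of normals and of contact sets *)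

Section deformation_limit.
Context (R : realType) (n : nat) (alpha p : R).
Local Notation Rn := 'rV[R]_n.
Hypotheses (n_gt0 : (0 < n)%N) (alpha_gt0 : 0 < alpha) (pn : n%:R < p).
Variables (Q : set Rn) (J : set R) (eta : R -> Rn -> Rn) (etak : nat -> R -> Rn -> Rn).
Hypotheses (dQ : bounded_C1alpha_domains alpha Q)
  (eta_C1 : forall t, J t -> C1gamma_closure p Q (eta t))
  (etak_C1 : forall k t, J t -> C1gamma_closure p Q (etak k t))
  (eta_time : C1_continuous_in_time Q J eta) (etak_cvg : C1_uniform_cvg Q J etak eta).
Variable eps0 : R.
Hypotheses (eps0_gt0 : 0 < eps0)
  (eta_det : forall t x, J t -> Q x -> eps0 <= \det (grad (eta t) x))
  (etak_det : forall k t x, J t -> Q x -> eps0 <= \det (grad (etak k t) x)).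

Let cont t (Jt : J t) : {within closure Q, continuous (eta t)}.
Proof. by case: (eta_C1 Jt). Qed.

Let contk k t (Jt : J t) : {within closure Q, continuous (etak k t)}.
Proof. by case: (etak_C1 k Jt). Qed.

Lemma eta_time_closure t0 (e : R) : J t0 -> 0 < e -> exists2 d : R, 0 < d &
  forall t x, J t -> `|t - t0| < d -> closure Q x -> `|eta t x - eta t0 x| <= e.
Proof.
move=> Jt0 e0; have [d d0 hd] := eta_time Jt0 e0; exists d => // t x Jt td.
apply: closure_dist_le; [exact: cont|exact: cont|].
by move=> y Qy; have [] := hd t Jt td y Qy.
Qed.

Lemma etak_cvg_closure (e : R) : 0 < e -> exists N : nat, forall k t x, (N <= k)%N -> J t ->
  closure Q x -> `|etak k t x - eta t x| <= e.
Proof.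
move=> e0; have [N hN] := etak_cvg e0; exists N => k t x Nk Jt.
apply: closure_dist_le; [exact: contk|exact: cont|].
by move=> y Qy; have [] := hN k t Nk Jt y Qy.
Qed.

Lemma eta_near t0 x0 (e : R) : J t0 -> closure Q x0 -> 0 < e -> exists2 d : R, 0 < d &
  forall t x, J t -> `|t - t0| < d -> closure Q x -> `|x - x0| < d ->
    `|eta t x - eta t0 x0| <= e.
Proof.
move=> Jt0 cx0 e0; have e20 : 0 < e / 2 by rewrite divr_gt0.
have [d d0 hd] := eta_time_closure Jt0 e20.
have /subspace_continuousP/(_ _ cx0)/cvgrPdist_lt/(_ _ e20) := cont Jt0.
rewrite near_withinE => /nbhs_ballP[r /= r0 rB].
exists (Num.min d r) => [|t x Jt]; first by rewrite lt_min d0.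
rewrite !lt_min => /andP[td _] cx /andP[_ xr].
have h1 : `|eta t0 x0 - eta t0 x| < e / 2.
  by apply: rB => //; rewrite -ball_normE/= distrC.
have h2 := hd t x Jt td cx.
by rewrite (le_trans (ler_distD (eta t0 x) _ _))// (distrC (eta t0 x)); lra.
Qed.

(** Supplies one reference matrix for all gradients near [(t0, x0)], those of [eta] and of [etak k]
    with [k] large alike; normals and injectivity are both treated as perturbations of it. *)
Lemma grad_near t0 x0 (e : R) : J t0 -> closure Q x0 -> 0 < e ->
  exists (d : R) (N : nat), 0 < d /\ forall t x, J t -> `|t - t0| < d -> Q x -> `|x - x0| < d ->
    `|grad (eta t) x - cgrad Q (eta t0) x0| <= e /\
    forall k, (N <= k)%N -> `|grad (etak k t) x - cgrad Q (eta t0) x0| <= e.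
Proof.
move=> Jt0 cx0 e0; have e30 : 0 < e / 3 by rewrite divr_gt0.
have [d d0 hd] := eta_time Jt0 e30; have [N hN] := etak_cvg e30.
have /cvgrPdist_lt/(_ _ e30) := cgrad_cvg pn (eta_C1 Jt0) cx0.
rewrite near_withinE => /nbhs_ballP[r /= r0 rB].
exists (Num.min d r), N; split => [|t x Jt]; first by rewrite lt_min d0.
rewrite !lt_min => /andP[td _] Qx /andP[_ xr].
have h1 : `|cgrad Q (eta t0) x0 - grad (eta t0) x| < e / 3.
  by apply: rB => //; rewrite -ball_normE/= distrC.
have [_ h2] := hd t Jt td x Qx.
have h3 : `|grad (eta t) x - cgrad Q (eta t0) x0| <= e / 3 + e / 3.
  by rewrite (le_trans (ler_distD (grad (eta t0) x) _ _))// lerD// distrC ltW.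
have ee : e = e / 3 + (e / 3 + e / 3) by field.
split => [|k Nk]; first by rewrite (le_trans h3)// [leRHS]ee lerDr ltW.
have [_ h4] := hN k t Nk Jt x Qx.
by rewrite (le_trans (ler_distD (grad (eta t) x) _ _))// [leRHS]ee lerD.
Qed.

Lemma etak_normal_unit k t x : J t -> bd Q x -> enorm (deformed_normal alpha Q (etak k t) x) = 1.
Proof.
move=> Jt bx; have cx : closure Q x by case: bx.
have := cgrad_det_ge pn (etak_C1 k Jt) cx (fun y => @etak_det k _ y Jt) => dA.
have dA0 : \det (cgrad Q (etak k t) x) != 0 by rewrite gt_eqF// (lt_le_trans eps0_gt0).
have [d d0 hd] := push_normal_near n_gt0 dA0 (ltr01 : (0 : R) < 1).
have := hd (cgrad Q (etak k t) x) (cgrad Q (etak k t) x) (inner_normal alpha Q x).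
by rewrite subrr normr0 => /(_ d0 d0 (inner_normal_unit dQ bx))[].
Qed.

(** Compactness reduces the claim to a neighbourhood of one point. There both normals arise from the
    same inner normal at the same point, so only the two gradients differ, and both are close to the
    reference matrix. *)
Lemma normal_uniform_cvg (e : R) : compact (J `*` bd Q) -> 0 < e ->
  exists N : nat, forall k t x, (N <= k)%N -> J t -> bd Q x ->
    `|deformed_normal alpha Q (etak k t) x - deformed_normal alpha Q (eta t) x| <= e.
Proof.
move=> cK e0; have /compact_near_coveringP/near_covering_withinP ncK := cK.
have [|N _ hN] := ncK nat \oo (fun k z => `|deformed_normal alpha Q (etak k z.1) z.2
    - deformed_normal alpha Q (eta z.1) z.2| <= e) _; last first.
  by exists N => k t x Nk Jt bx; exact: (hN k Nk (t, x)).
move=> [t0 x0] [/= Jt0 bx0]; have cx0 : closure Q x0 by case: bx0.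
have dA := cgrad_det_ge pn (eta_C1 Jt0) cx0 (fun y => @eta_det _ y Jt0).
have dA0 : \det (cgrad Q (eta t0) x0) != 0 by rewrite gt_eqF// (lt_le_trans eps0_gt0).
have [d d0 hd] := push_normal_near n_gt0 dA0 e0.
have d20 : 0 < d / 2 by rewrite divr_gt0.
have d2d : d / 2 < d by rewrite gtr_pMr// invf_lt1// ltr1n.
have [r [N [r0 hr]]] := grad_near Jt0 cx0 d20.
have nz : \forall z \near (t0, x0), ball (t0, x0) r z by exact: nbhsx_ballx.
near=> z k => -[Jz bz].
have cz : closure Q z.2 by case: bz.
have [tz xz] : ball (t0, x0) r z by near: z.
have Nk : (N <= k)%N by near: k; exact: nbhs_infty_ge.
have {}tz : `|z.1 - t0| < r by move: tz; rewrite -ball_normE/= distrC.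
have {}xz : `|z.2 - x0| < r by move: xz; rewrite -ball_normE/= distrC.
have a1 : `|cgrad Q (eta z.1) z.2 - cgrad Q (eta t0) x0| <= d / 2.
  apply: (cgrad_dist_le pn (eta_C1 Jz) cz xz) => y Qy yr.
  by have [] := hr z.1 y Jz tz Qy yr.
have a2 : `|cgrad Q (etak k z.1) z.2 - cgrad Q (eta t0) x0| <= d / 2.
  apply: (cgrad_dist_le pn (etak_C1 k Jz) cz xz) => y Qy yr.
  by have [_] := hr z.1 y Jz tz Qy yr; apply.
apply: (hd _ _ _ _ _ (inner_normal_unit dQ bz)).2; rewrite distrC.
  exact: le_lt_trans a2 d2d.
exact: le_lt_trans a1 d2d.
Unshelve. all: by end_near. Qed.

(** Absence of contact is made quantitative: [m0] is a distance from the image point to [bd Omega],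
    and [m1] one from it to the image of the points of the closure away from [x0]. Points near [x0]
    are separated by local injectivity instead. *)
Lemma contact_set_near (Omega : set Rn) t0 x0 : J t0 -> bd Q x0 ->
  ~ contact_set Q Omega (eta t0) x0 -> exists (d : R) (N : nat), 0 < d /\
    forall k t x, (N <= k)%N -> J t -> `|t - t0| < d -> closure Q x -> `|x - x0| < d ->
      ~ contact_set Q Omega (etak k t) x.
Proof.
move=> Jt0 bx0 nC; have cx0 : closure Q x0 by case: bx0.
set y0 := eta t0 x0.
have [m0 m00 hm0] : exists2 m : R, 0 < m & forall y, `|y - y0| < m -> ~ bd Omega y.
  have : nbhs y0 (~` bd Omega).
    apply: open_nbhs_nbhs; split.
      rewrite /bd setCD; apply: openU; last exact: open_interior.
      by apply: closed_openC; exact: closed_closure.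
    by move=> h; apply: nC; split => //; left.
  move=> /nbhs_ballP[m /= m0 hm]; exists m => // y hy.
  by apply: hm; rewrite -ball_normE/= distrC.
have inj : closure Q `&` eta t0 @^-1` [set y0] = [set x0].
  by apply: contrapT => h; apply: nC; split => //; right.
have dA := cgrad_det_ge pn (eta_C1 Jt0) cx0 (fun y => @eta_det _ y Jt0).
have uA : cgrad Q (eta t0) x0 \in unitmx by rewrite unitmxE unitfE gt_eqF// (lt_le_trans eps0_gt0).
have [e [g hc]] := bd_chart dQ bx0.
have [d d0 hd] := graph_chart_injectivity alpha_gt0 hc uA.
have [r [N1 [r0 hr]]] := grad_near Jt0 cx0 d0.
have [r' r'0 hinj] := hd r r0.
pose L := closure Q `\` ball x0 r'.
have cL : compact L.
  have bQ := bounded_closure_compact (bounded_C1alpha_bounded dQ).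
  apply: (subclosed_compact _ bQ); last by move=> z [].
  by apply: closedI; [exact: closed_closure|apply: open_closedC; exact: ball_open].
have [m1 m10 hm1] : exists2 m : R, 0 < m & forall y, L y -> m <= `|eta t0 y - y0|.
  have cimg : compact (eta t0 @` L).
    apply: continuous_compact => //; apply: continuous_subspaceW (cont Jt0).
    by move=> z [].
  have : nbhs y0 (~` (eta t0 @` L)).
    apply: open_nbhs_nbhs; split.
      by apply: closed_openC; exact: compact_closed cimg.
    move=> [y [cy ny] yE]; apply: ny.
    have -> : y = x0 by have : [set x0] y by rewrite -inj.
    exact: ballxx.
  move=> /nbhs_ballP[m /= m0' hm]; exists m => // y Ly; rewrite leNgt; apply/negP => h.
  by apply: (hm (eta t0 y)); [rewrite -ball_normE/= distrC|exists y].
(* If a point [y] far from [x0] had the image of [x], then [eta t0 y] would be within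
   [m + m + 2 m = 4 m] of [y0]; dividing by 5 makes this a strict contradiction. *)
pose m := Num.min m0 m1 / 5.
have m_gt0 : 0 < m by rewrite divr_gt0// lt_min m00.
have mm0 : 5 * m <= m0 by rewrite /m mulrC divfK// ge_min lexx.
have mm1 : 5 * m <= m1 by rewrite /m mulrC divfK// ge_min lexx orbT.
have [d1 d10 hd1] := eta_near Jt0 cx0 m_gt0.
have [d2 d20 hd2] := eta_time_closure Jt0 m_gt0.
have [N2 hN2] := etak_cvg_closure m_gt0.
exists (Num.min (Num.min r r') (Num.min d1 d2)), (maxn N1 N2).
split; first by rewrite !lt_min r0 r'0 d10.
move=> k t x; rewrite geq_max => /andP[N1k N2k] Jt.
rewrite !lt_min => /andP[/andP[tr _] /andP[td1 td2]] cx /andP[/andP[xr xr'] /andP[xd1 _]].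
have fx : `|etak k t x - y0| <= 2 * m.
  have := hN2 k t x N2k Jt cx; have := hd1 t x Jt td1 cx xd1.
  by move=> h1 h2; rewrite (le_trans (ler_distD (eta t x) _ _))//; lra.
move=> [_ [bO|]]; first by apply: (hm0 _ _ bO); lra.
apply; apply/seteqP; split => [y [cy fy]|_ ->]; last by split.
have [yr'|yr'] := ltP `|y - x0| r'.
  apply: (hinj (etak k t)) => //.
  - exact: contk.
  - by case: (etak_C1 k Jt).
  - by move=> w Qw wr; have [_] := hr t w Jt tr Qw wr; apply.
have Ly : L y by split => //; rewrite -ball_normE/= distrC => h; move: yr'; rewrite leNgt h.
have := hm1 y Ly; have := hd2 t y Jt td2 cy; have := hN2 k t y N2k Jt cy; rewrite (_ : etak k t y = etak k t x)//.
move=> h1 h2 h3.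
have := ler_distD (eta t y) (eta t0 y) y0; have := ler_distD (etak k t x) (eta t y) y0.
by rewrite (distrC (eta t0 y) (eta t y)) (distrC (eta t y) (etak k t x)) => h4 h5; exfalso; lra.
Qed.

End deformation_limit.

(** * Passage to the limit *)

Section weak_limits.
Context (R : realType) (V : normedModType R).
Local Notation S := (g_sigma_algebraType (@open V)).
Variables (K : set V) (mu_ : nat -> {finite_measure set S -> \bar R})
  (mu : {finite_measure set S -> \bar R}).
Hypotheses (cK : compact K) (mu_cvg : forall f : V -> R, {within K, continuous f} ->
  (\int[mu_ k]_(z in (K : set S)) f z)%R @[k --> \oo] --> (\int[mu]_(z in (K : set S)) f z)%R).

Let mK : measurable (K : set S). Proof. exact: measurable_gen_compact. Qed.

(** Bounded masses absorb the uniform error of the densities, after which a fixed continuous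
    integrand is tested. *)
Lemma Rintegral_density_cvg (B : R) (g_ : nat -> S -> R) (g phi : V -> R) :
  (forall k, (mu_ k K <= B%:E)%E) ->
  (forall k, (mu_ k).-integrable (K : set S) (EFin \o g_ k)) ->
  {within K, continuous g} -> {within K, continuous phi} ->
  (forall e : R, 0 < e -> exists N, forall k z, (N <= k)%N -> K z -> `|g_ k z - g z| <= e) ->
  (\int[mu_ k]_(z in (K : set S)) (phi z * g_ k z))%R @[k --> \oo] -->
  (\int[mu]_(z in (K : set S)) (phi z * g z))%R.
Proof.
move=> muB ig cg cphi gcvg.
have muB' k : fine (mu_ k K) <= B by rewrite -lee_fin fineK ?fin_num_measure.
have B0 : 0 <= B by rewrite (le_trans _ (muB' 0%N))// fine_ge0.
have [M M0 phiM] := within_continuous_bound cK cphi.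
have mphi := measurable_fun_within cK cphi.
have cpg : {within K, continuous (fun z => phi z * g z)}.
  by move=> z; apply: continuousM; [exact: cphi|exact: cg].
apply/cvgrPdist_le => e e0; have e20 : 0 < e / 2 by rewrite divr_gt0.
have MB0 : 0 < M * (B + 1) by rewrite mulr_gt0// ltr_wpDl.
have d0 : 0 < e / 2 / (M * (B + 1)) by rewrite divr_gt0.
have [N hN] := gcvg _ d0.
have /cvgrPdist_le/(_ _ e20) h1 := mu_cvg cpg.
near=> k; have Nk : (N <= k)%N by near: k; exact: nbhs_infty_ge.
have h2 : `|\int[mu]_(z in (K : set S)) (phi z * g z) -
    \int[mu_ k]_(z in (K : set S)) (phi z * g z)| <= e / 2 by near: k; exact: h1.
have i1 : (mu_ k).-integrable (K : set S) (EFin \o (fun z => phi z * g_ k z)).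
  exact: (bounded_mul_integrable cK (ig k) mphi phiM).
have i2 := within_integrable (mu_ k) cK cpg.
have i12 : (mu_ k).-integrable (K : set S) (EFin \o (fun z => phi z * g z - phi z * g_ k z)).
  rewrite (_ : _ \o _ = (fun z => (phi z * g z)%:E - (phi z * g_ k z)%:E)%E)//.
  exact: integrableB.
have h3 : `|\int[mu_ k]_(z in (K : set S)) (phi z * g z) -
    \int[mu_ k]_(z in (K : set S)) (phi z * g_ k z)| <= e / 2.
  rewrite -RintegralB// (le_trans (le_normr_Rintegral _ i12))//.
  apply: (@le_trans _ _ (\int[mu_ k]_(z in (K : set S)) (M * (e / 2 / (M * (B + 1)))))%R).
    apply: le_Rintegral => //; first exact: (integrable_norm i12).
      by apply: (@within_integrable _ _ _ _ (fun=> _)) => // z; exact: cvg_cst.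
    move=> z Kz; rewrite -mulrBr normrM ler_pM ?phiM//.
    by rewrite distrC; exact: hN.
  rewrite Rintegral_cst//; apply: (@le_trans _ _ (M * (e / 2 / (M * (B + 1))) * (B + 1))).
    by rewrite ler_wpM2l ?(le_trans (muB' k))// ?lerDl// mulr_ge0// ltW.
  have B1 : B + 1 != 0 by rewrite gt_eqF// ltr_wpDl.
  have M1 : M != 0 by rewrite gt_eqF.
  by rewrite le_eqVlt; apply/orP; left; apply/eqP; field; rewrite B1 M1.
rewrite (le_trans (ler_distD (\int[mu_ k]_(z in (K : set S)) (phi z * g z)) _ _))//.
by rewrite [leRHS]splitr lerD.
Unshelve. all: by end_near. Qed.

(** Tested with the tent function [max 0 (r - |z - z0|)], whose integrals vanish for large [k]. It
    is at least [r / 2] on the half ball, hence the loss of radius. *)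
Lemma weak_limit_null_ball (z0 : V) (r : R) (N : nat) : 0 < r ->
  (forall k, (N <= k)%N -> mu_ k (K `&` [set z | `|z - z0| <= r]) = 0%E) ->
  mu (K `&` [set z | `|z - z0| < r / 2]) = 0%E.
Proof.
move=> r0 h; have r20 : 0 < r / 2 by rewrite divr_gt0.
pose chi (z : V) : R := Num.max 0 (r - `|z - z0|).
have cchi : continuous chi.
  apply: (@dist_le_continuous _ _ R^o _ 1) => u v; rewrite mul1r.
  have : `|(`|u - z0| - `|v - z0|)| <= `|u - v|.
    rewrite (_ : u - v = (u - z0) - (v - z0)) ?ler_dist_dist//.
    by rewrite opprB addrA subrK.
  rewrite /chi !ler_norml => /andP[h1 h2].
  by case: (leP 0 (r - `|u - z0|)); case: (leP 0 (r - `|v - z0|)) => h3 h4; apply/andP; split; lra.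
have cK' : {within K, continuous chi} by exact: continuous_subspaceT.
have chi0 z : 0 <= chi z by rewrite le_max lexx.
have mball (e : R) : measurable ([set z | `|z - z0| <= e] : set S).
  rewrite -[X in measurable X]setCK; apply: measurableC; apply: measurable_gen_open.
  rewrite openE => z /= /negP; rewrite -ltNge => ez.
  apply/nbhs_ballP; exists (`|z - z0| - e); first by rewrite /= subr_gt0.
  move=> w; rewrite -ball_normE/= => zw; apply/negP; rewrite -ltNge.
  have := ler_normD (z - w) (w - z0); rewrite addrA subrK; lra.
have mball2 (e : R) : measurable ([set z | `|z - z0| < e] : set S).
  apply: measurable_gen_open; rewrite (_ : [set z | _] = ball z0 e); first exact: ball_open.
  by apply/seteqP; split => z; rewrite -ball_normE/= distrC.
have Z k : (N <= k)%N -> (\int[mu_ k]_(z in (K : set S)) chi z)%R = 0.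
  move=> Nk; have mKB : measurable (K `&` [set z | `|z - z0| <= r] : set S) by exact: measurableI.
  have mKD : measurable (K `\` [set z | `|z - z0| <= r] : set S) by exact: measurableD.
  have iK := within_integrable (mu_ k) cK cK'.
  rewrite (Rintegral_setID mKB mKD)//.
  rewrite {2}/Rintegral (@eq_integral _ _ _ _ _ (fun=> 0%E)); last first.
    move=> z /set_mem[_ /negP]; rewrite -ltNge => rz; congr EFin.
    by rewrite /chi max_l//; lra.
  rewrite integral0 addr0 /Rintegral.
  have iKB : (mu_ k).-integrable (K `&` [set z | `|z - z0| <= r] : set S) (EFin \o chi).
    by apply: integrableS iK => // z [].
  by rewrite (null_set_integral mKB (measurable_int _ iKB) (h k Nk)).
have I0 : (\int[mu]_(z in (K : set S)) chi z)%R = 0.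
  apply: (cvg_unique _ (mu_cvg cK')); first exact: norm_hausdorff.
  by apply: cvg_near_cst; exists N => // k /= /Z.
have mB : measurable (K `&` [set z | `|z - z0| < r / 2] : set S) by exact: measurableI.
apply/eqP; rewrite eq_le measure_ge0 andbT.
rewrite -[leLHS](@fineK _ (mu _)) ?fin_num_measure// lee_fin.
rewrite -(ler_pM2l r20) mulr0 -I0 -Rintegral_cst//.
have iK := within_integrable mu cK cK'.
rewrite /Rintegral; apply: fine_le.
- by apply: integrable_fin_num => //; apply: (@bounded_finite_integrable _ _ _ _ _ _ `|r / 2|).
- exact: integrable_fin_num iK.
apply: (@le_trans _ _ (\int[mu]_(z in K `&` [set z | (`|z - z0| < r / 2)%R]) (chi z)%:E)%E).
  apply: ge0_le_integral => //.
  - by move=> z _; rewrite lee_fin ltW.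
  - by apply/measurable_EFinP; apply: measurable_funS (measurable_fun_within cK cK') => // z [].
  - by move=> z [_ /=] hz; rewrite lee_fin /chi le_max; apply/orP; right; lra.
apply: ge0_subset_integral => //.
- by apply/measurable_EFinP; exact: measurable_fun_within.
- by move=> z _; rewrite lee_fin.
Qed.

End weak_limits.

Lemma compact_open_subcover (R : realType) (V : normedModType R) (L : set V) (U : V -> set V) :
  compact L -> (forall z, open (U z)) -> (forall z, L z -> U z z) ->
  exists l : seq V, forall z, L z -> exists2 w, w \in l & U w z.
Proof.
rewrite compact_cover => cL oU LU; have [|D _ LD] := cL _ setT U (fun z _ => oU z).
  by move=> z Lz; exists z => //; exact: LU.
by exists (finmap.enum_fset D) => z /LD[w wD zw]; exists w.
Qed.

Section support.
Context (R : realType) (n : nat).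
Local Notation S := (spacetime R n).
Variables (K : set (R * 'rV[R]_n)) (nu : S -> 'rV[R]_n)
  (mu : {finite_measure set S -> \bar R}) (sigma : vcharge R n).
Hypotheses (cK : compact K) (dens : has_density K nu mu sigma)
  (nu1 : forall z, K z -> enorm (nu z) = 1).

Lemma notin_vsupp (z : R * 'rV[R]_n) : ~ vsupp sigma z -> exists U : set (R * 'rV[R]_n),
  [/\ open U, U z & forall A : set S, measurable A -> A `<=` U -> vcharge_val sigma A = 0].
Proof.
move=> h; apply: contrapT => /forallNP hU; apply: h => U oU Uz.
apply: contrapT => /forallNP hA; apply: (hU U); split => // A mA AU.
by apply: contrapT => hv; apply: (hA A).
Qed.

(** Finitely many open sets on whose Borel subsets the charge vanishes cover [L]; cut into disjoint
    pieces they become null for [mu] by [unit_density_null]. *)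
Lemma notin_vsupp_null (L : set (R * 'rV[R]_n)) : compact L -> L `<=` K ->
  (forall z, L z -> ~ vsupp sigma z) -> mu (L : set S) = 0%E.
Proof.
move=> cL LK hL; have mL : measurable (L : set S) by exact: measurable_gen_compact.
have hU z : exists U : set (R * 'rV[R]_n), [/\ open U, L z -> U z &
    forall A : set S, measurable A -> A `<=` U -> vcharge_val sigma A = 0].
  have [Lz|Lz] := pselect (L z).
    by have [U [oU Uz hA]] := notin_vsupp (hL z Lz); exists U.
  (* Off [L] the empty set makes the choice of neighbourhoods total. *)
  exists set0; split => //.
  move=> A mA A0; apply/rowP => i; rewrite !mxE (_ : A = set0) ?charge0//.
  by apply/seteqP; split.
pose U z := proj1_sig (cid (hU z)).
have [oU [LU hA]] : (forall z, open (U z)) /\ ((forall z, L z -> U z z) /\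
   forall z (A : set S), measurable A -> A `<=` U z -> vcharge_val sigma A = 0).
  by split; [|split] => z; rewrite /U; case: cid => /= W [].
have [D LD] := compact_open_subcover cL oU LU.
pose l : seq (set S) := [seq (U z : set S) | z <- D].
have i1 : mu.-integrable (L : set S) (EFin \o (fun=> 1 : R)).
  by apply: (@bounded_finite_integrable _ _ _ _ _ _ 1) => // z _; rewrite normr1.
have [||PA _ PM] := @piecesP _ _ L l mu (fun=> 1) mL _ _ i1.
- by move=> _ /mapP[z _ ->]; apply: measurable_gen_open.
- by move=> z /LD[w wD zw]; exists (U w) => //; apply/mapP; exists w.
rewrite -[LHS](@fineK _ (mu _)) ?fin_num_measure// PM big_seq big1// => A /PA[mA [AL [_ /mapP[w _ ->] AU]]].
rewrite (unit_density_null cK dens nu1 mA)//; first exact: subset_trans LK.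
by move=> A' mA' A'A; apply: (hA w) => //; exact: subset_trans AU.
Qed.

End support.

Section zero_extension.
Context (R : realType) (n : nat).
Local Notation Rn := 'rV[R]_n.

(** Contact points can be mapped to [bd Omega], outside the open set [Omega] where the test field is
    assumed continuous; its compact support makes the extension continuous there too. *)
Lemma zero_extension_continuous (J : set R) (Omega : set Rn) (L : set (R * Rn)) (phi : R * Rn -> Rn) :
  open Omega -> compact L -> L `<=` J `*` Omega -> (forall z, ~ L z -> phi z = 0) ->
  {within J `*` Omega, continuous phi} -> {within J `*` setT, continuous phi}.
Proof.
move=> oO cL LJ phi0 cphi; apply/subspace_continuousP => -[t x] [/= Jt _].
have [Ox|Ox] := pselect (Omega x).
  have /subspace_continuousP/(_ (t, x) (conj Jt Ox)) h := cphi.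
  apply/cvgrPdist_lt => e e0; move/cvgrPdist_lt/(_ _ e0) : h; rewrite !near_withinE => h.
  have : \forall z \near (t, x), Omega z.2.
    have : nbhs x Omega by exact: open_nbhs_nbhs.
    move=> /nbhs_ballP[r /= r0 rO]; apply/nbhs_ballP; exists r => // z [_ xz]; exact: rO.
  move=> hO; near=> z => -[Jz _].
  have Oz : Omega z.2 by near: z; exact: hO.
  have hz : (J `*` Omega) z -> `|phi (t, x) - phi z| < e by near: z; exact: h.
  exact: hz.
have nL : ~ L (t, x) by move=> /LJ[].
have : \forall z \near (t, x), ~ L z.
  apply: (@open_nbhs_nbhs _ (t, x) (~` L)); split => //.
  by apply: closed_openC; apply: compact_closed cL.
move=> hn; apply/cvgrPdist_lt => e e0; rewrite near_withinE; near=> z => _.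
have Lz : ~ L z by near: z; exact: hn.
by rewrite /from_subspace !phi0// subrr normr0.
Unshelve. all: by end_near. Qed.

End zero_extension.

Lemma coord_dist_le (R : realType) (n : nat) (u v : 'rV[R]_n) (i : 'I_n) :
  `|u ord0 i - v ord0 i| <= `|u - v|.
Proof. by have := coord_le_norm (u - v) i; rewrite !mxE. Qed.

Lemma within_continuous_coord (R : realType) (V : normedModType R) (n : nat) (K : set V)
    (f : V -> 'rV[R]_n) (i : 'I_n) : {within K, continuous f} ->
  {within K, continuous (fun z => f z ord0 i)}.
Proof.
move=> cf; apply/subspace_continuousP => z Kz; apply/cvgrPdist_lt => e e0.
have /subspace_continuousP/(_ _ Kz)/cvgrPdist_lt/(_ _ e0) := cf.
rewrite !near_withinE => h; near=> w => Kw.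
have hw : K w -> `|f z - f w| < e by near: w; exact: h.
exact: le_lt_trans (coord_dist_le _ _ _) (hw Kw).
Unshelve. all: by end_near. Qed.

Section action_reaction_limit.
Context (R : realType) (n : nat).
Local Notation Rn := 'rV[R]_n.
Variables (Q Omega : set Rn) (J : set R) (eta : R -> Rn -> Rn) (etak : nat -> R -> Rn -> Rn)
  (sigmak : nat -> vcharge R n) (sigma : vcharge R n) (C : R).
Let K := J `*` bd Q.
Hypotheses (oO : open Omega) (cK : compact K)
  (eta_cont : forall t0 x0 (e : R), J t0 -> closure Q x0 -> 0 < e -> exists2 d : R, 0 < d &
    forall t x, J t -> `|t - t0| < d -> closure Q x -> `|x - x0| < d ->
      `|eta t x - eta t0 x0| <= e)
  (etak_cvg : forall e : R, 0 < e -> exists N : nat, forall k t x, (N <= k)%N -> J t ->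
    closure Q x -> `|etak k t x - eta t x| <= e)
  (sigmak_bounded : forall k i A, measurable A -> `|fine (sigmak k i A)| <= C)
  (sigma_cvg : weak_star_cvg K sigmak sigma).

Let Phi (z : R * Rn) : R * Rn := (z.1, eta z.1 z.2).

Let cPhi : {within K, continuous Phi}.
Proof.
apply/subspace_continuousP => -[t0 x0] [/= Jt0 bx0]; have cx0 : closure Q x0 by case: bx0.
apply/cvgrPdist_lt => e e0; have e20 : 0 < e / 2 by rewrite divr_gt0.
have e2e : e / 2 < e by rewrite gtr_pMr// invf_lt1// ltr1n.
have [d d0 hd] := eta_cont Jt0 cx0 e20.
have de0 : 0 < Num.min d e by rewrite lt_min d0.
rewrite near_withinE; near=> z => -[Jz bz]; have cz : closure Q z.2 by case: bz.
have : `|(t0, x0) - z| < Num.min d e by near: z; exact: cvgr_dist_lt.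
rewrite prod_normE/= gt_max !lt_min => /andP[/andP[h1 h2] /andP[h3 _]].
rewrite /from_subspace /Phi prod_normE/= gt_max h2/=.
rewrite distrC in h1; rewrite distrC in h3.
by rewrite distrC (le_lt_trans (hd z.1 z.2 Jz h1 cz h3)).
Unshelve. all: by end_near. Qed.

Lemma action_reaction_limit : (forall k, action_reaction Q Omega J (etak k) (sigmak k)) ->
  action_reaction Q Omega J eta sigma.
Proof.
move=> AR phi cphi hL; have [L [cL LJ phi0]] := hL.
have cphi' := zero_extension_continuous oO cL LJ phi0 cphi.
pose M := Phi @` K; have cM : compact M by exact: continuous_compact.
have MD : M `<=` J `*` setT by move=> _ [z [Jz _] <-].
pose psi z := phi (Phi z).
have cpsi : {within K, continuous psi}.
  apply/subspace_continuousP => z Kz; apply/cvgrPdist_lt => e e0.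
  have MPz : M (Phi z) by exists z.
  have [d d0 hd] := within_uniformly_continuous cM MD cphi' e0.
  have /subspace_continuousP/(_ _ Kz)/cvgrPdist_lt/(_ _ d0) := cPhi.
  rewrite !near_withinE => h; near=> w => Kw.
  have zw : K w -> `|Phi z - Phi w| < d by near: w; exact: h.
  by apply: hd; [exact: MPz|apply: MD; exists w|exact: zw].
have := sigma_cvg cpsi; rewrite -/K.
have : int_vcharge (sigmak k) K psi @[k --> \oo] --> (0 : R).
  apply/cvgrPdist_le => e e0.
  (* Each of the [n] components contributes the factor [4 |C|] of [int_charge_perturb]. *)
  pose c : R := n%:R * (4 * `|C|) + 1; have c0 : 0 < c by rewrite ltr_wpDl// !mulr_ge0.
  have d0 : 0 < e / c by rewrite divr_gt0.
  have [r r0 hr] := within_uniformly_continuous cM MD cphi' d0.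
  have r20 : 0 < r / 2 by rewrite divr_gt0.
  have r2r : r / 2 < r by rewrite gtr_pMr// invf_lt1// ltr1n.
  have [N hN] := etak_cvg r20.
  near=> k; have Nk : (N <= k)%N by near: k; exact: nbhs_infty_ge.
  (* The limit 0 is rewritten as the integral that vanishes for [etak k], so that two integrals
     against the same charge are compared. *)
  rewrite -(AR k phi cphi hL) -/K /int_vcharge -sumrB (le_trans (ler_norm_sum _ _ _))//.
  apply: (@le_trans _ _ (\sum_(i < n) (4 * (e / c) * `|C|))).
    apply: ler_sum => i _; apply: (int_charge_perturb cK).
    - by move=> A mA; rewrite (le_trans _ (ler_norm C))// sigmak_bounded.
    - exact: within_continuous_coord.
    - exact: ltW.
    move=> z [Jz bz]; have cz : closure Q z.2 by case: bz.
    rewrite distrC; apply: (le_trans (coord_dist_le _ _ _)); apply/ltW; apply: hr; [by exists z|by []|].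
    rewrite /Phi prod_normE/= subrr normr0 gt_max r0/= distrC.
    by rewrite (le_lt_trans (hN k z.1 z.2 Nk Jz cz)).
  rewrite sumr_const card_ord -[leLHS]mulr_natl.
  rewrite (_ : _ * _ = e * (n%:R * (4 * `|C|) / c)); last by field; rewrite gt_eqF.
  by rewrite ler_piMr ?(ltW e0)// ler_pdivrMr// mul1r /c lerDl.
by move=> h1 h2; exact: (cvg_unique _ h2 h1).
Unshelve. all: by end_near. Qed.

End action_reaction_limit.

Theorem theorem3p9 (R : realType) (n : nat) (alpha p : R)
  (n_gt0 : (0 < n)%N) (alpha_gt0 : 0 < alpha) (alpha_le1 : alpha <= 1)
  (p_gtn : n%:R < p)
  (Q Omega Gamma : set 'rV[R]_n)
  (Q_dom : bounded_C1alpha_domains alpha Q)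
  (Omega_dom : C1alpha_domain alpha Omega)
  (Gamma_bd : Gamma `<=` bd Q)
  (Gamma_meas : (hausdorff n.-1).-caratheodory Gamma)
  (eta0 : 'rV[R]_n -> 'rV[R]_n)
  (eta0_adm : admissible p Q Omega Gamma eta0 eta0)
  (eta0_inj : forall x y, Gamma x -> Gamma y -> eta0 x = eta0 y -> x = y)
  (eta0_Gamma : eta0 @` Gamma `&` bd Omega = set0)
  (E : ('rV[R]_n -> 'rV[R]_n) -> \bar R) (Emin : R)
  (DE : ('rV[R]_n -> 'rV[R]_n) -> ('rV[R]_n -> 'rV[R]_n) -> R)
  (E_energy : elastic_energy p Q Gamma E Emin DE)
  (a b : R) (ab : a <= b) (E0 : R)
  (etak : nat -> R -> 'rV[R]_n -> 'rV[R]_n)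
  (eta : R -> 'rV[R]_n -> 'rV[R]_n)
  (etak_adm : forall k t, t \in `[a, b] ->
     admissible p Q Omega Gamma eta0 (etak k t))
  (eta_adm : forall t, t \in `[a, b] -> admissible p Q Omega Gamma eta0 (eta t))
  (etak_energy : forall k t, t \in `[a, b] -> (E (etak k t) <= E0%:E)%E)
  (eta_energy : forall t, t \in `[a, b] -> (E (eta t) <= E0%:E)%E)
  (etak_cvg : C1_uniform_cvg Q `[a, b]%classic etak eta)
  (etak_borel : forall k, borel_in_time p Q `[a, b]%classic (etak k))
  (eta_time : C1_continuous_in_time Q `[a, b]%classic eta)
  (eta_normal : {within `[a, b]%classic `*` bd Q,
     continuous (fun z : R * 'rV[R]_n => deformed_normal alpha Q (eta z.1) z.2)})
  (sigmak : nat -> vcharge R n)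
  (sigmak_force : forall k, contact_force alpha p Q Omega Gamma eta0 `[a, b]%classic
     (etak k) (sigmak k))
  (C : R) (sigmak_bounded : forall k, (tv_norm (sigmak k) <= C%:E)%E) :
  exists (s : nat -> nat) (sigma : vcharge R n),
    [/\ {homo s : i j / (i < j)%N},
        vmeasure_on (`[a, b]%classic `*` bd Q) sigma,
        weak_star_cvg (`[a, b]%classic `*` bd Q) (fun k => sigmak (s k)) sigma,
        contact_force alpha p Q Omega Gamma eta0 `[a, b]%classic eta sigma &
        (forall k, action_reaction Q Omega `[a, b]%classic
                     (etak (s k)) (sigmak (s k))) ->
        action_reaction Q Omega `[a, b]%classic eta sigma].
Proof.
set J := `[a, b]%classic; set K := J `*` bd Q.
have JP t : J t -> t \in `[a, b] by [].
have p1 : 1 < p by rewrite (le_lt_trans _ p_gtn)// ler1n.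
have oQ := bounded_C1alpha_open Q_dom; have bQ := bounded_C1alpha_bounded Q_dom.
have cK : compact K.
  by apply: compact_setX; [exact: segment_compact|exact: bounded_bd_compact].
have mK : measurable (K : set (spacetime R n)) by exact: measurable_gen_compact.
have clK : closed K by apply: compact_closed cK.
have eta_W2 t : J t -> W2p p Q (eta t) by move=> /JP/eta_adm[].
have etak_W2 k t : J t -> W2p p Q (etak k t) by move=> /JP/(etak_adm k)[].
have eta_C1 t : J t -> C1gamma_closure p Q (eta t) by move=> /eta_W2[].
have etak_C1 k t : J t -> C1gamma_closure p Q (etak k t) by move=> /(etak_W2 k)[].
(* The determinant bound is stated for levels at least [Emin], so the energy level is raised
   accordingly. *)
have E1 : Emin <= Num.max E0 Emin by rewrite le_max lexx orbT.
have [eps0 eps0_gt0 hdet] := energy_det E_energy E1.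
have E01 : (E0%:E <= (Num.max E0 Emin)%:E)%E by rewrite lee_fin le_max lexx.
have eta_det t x : J t -> Q x -> eps0 <= \det (grad (eta t) x).
  by move=> Jt; apply: hdet; [exact: eta_W2|exact: le_trans (eta_energy _ (JP _ Jt)) E01].
have etak_det k t x : J t -> Q x -> eps0 <= \det (grad (etak k t) x).
  by move=> Jt; apply: hdet; [exact: etak_W2|exact: le_trans (etak_energy k _ (JP _ Jt)) E01].
pose nuk k (z : spacetime R n) := deformed_normal alpha Q (etak k z.1) z.2.
pose nu (z : spacetime R n) := deformed_normal alpha Q (eta z.1) z.2.
have nuk1 k z : K z -> enorm (nuk k z) = 1.
  by move=> [Jz bz]; exact: (etak_normal_unit n_gt0 p_gtn Q_dom etak_C1 eps0_gt0 etak_det).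
have hmu k : exists mu : {finite_measure set (spacetime R n) -> \bar R},
    has_density K (nuk k) mu (sigmak k).
  by have [_ _ _ _ [mu _ hd]] := sigmak_force k; exists mu.
pose muk k := proj1_sig (cid (hmu k)).
have dens k : has_density K (nuk k) (muk k) (sigmak k) := proj2_sig (cid (hmu k)).
have muB k : (muk k K <= (2 * n%:R * C)%:E)%E.
  exact: (unit_density_mass_bound cK (dens k) (nuk1 k) (sigmak_bounded k)).
have [s [mu [sh muK mucvg]]] := finite_measure_weak_compactness cK muB.
(* Thresholds [N] found for the full sequence thus remain valid along the subsequence. *)
have sge k : (k <= s k)%N by elim: k => // k IH; rewrite (leq_ltn_trans IH)// sh.
have cnu i : {within K, continuous (fun z => nu z ord0 i)}.
  exact: within_continuous_coord eta_normal.
have inu i : mu.-integrable (K : set (spacetime R n)) (EFin \o (fun z => nu z ord0 i)).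
  exact: within_integrable.
pose sigma : vcharge R n := fun i => proj1_sig (cid (density_charge_ex cK (inu i))).
have sigmaE i A : measurable A -> sigma i A = (\int[mu]_(z in A `&` K) (nu z ord0 i)%:E)%E.
  exact: (proj2_sig (cid (density_charge_ex cK (inu i)))).
have vmK : vmeasure_on K sigma.
  by move=> i A mA AK; rewrite sigmaE// AK integral_set0.
have weak : weak_star_cvg K (fun k => sigmak (s k)) sigma.
  move=> phi cphi; rewrite /int_vcharge; apply: cvg_big => [|i _]; first exact: add_continuous.
  have cphii : {within K, continuous (fun z => phi z ord0 i)}.
    exact: within_continuous_coord.
  rewrite (int_charge_density cK (inu i) (sigmaE i) cphii).
  under eq_fun do rewrite (int_charge_density cK (dens _ i).1 (dens _ i).2 cphii).
  apply: (@Rintegral_density_cvg _ _ _ _ _ cK mucvg _ _ _ _ (fun k => muB (s k))) => //.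
    by move=> k; exact: (dens (s k) i).1.
  move=> e e0; have [N hN] := normal_uniform_cvg n_gt0 p_gtn Q_dom eta_C1 etak_C1 eta_time
    etak_cvg eps0_gt0 eta_det cK e0.
  exists N => k z Nk [Jz bz].
  apply: (le_trans (coord_dist_le (nuk (s k) z) (nu z) i)).
  by apply: hN => //; exact: leq_trans (sge k).
have supp : vsupp sigma `<=` contact_set_time Q Omega J eta.
  (* A point off [K] has the open complement of [K] as a neighbourhood on which the charge vanishes,
     so it cannot lie in the support. *)
  move=> z0 sz0; have [Kz0|nKz0] := pselect (K z0); last first.
    have : open (~` K) by exact: closed_openC.
    move=> /sz0/(_ nKz0)[A [mA AK []]]; apply/rowP => i; rewrite !mxE vmK//.
    by apply/seteqP; split => // z [/AK].
  apply: contrapT => nC; have [Jz0 bz0] := Kz0.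
  have nC' : ~ contact_set Q Omega (eta z0.1) z0.2 by move=> h; exact: nC.
  have [d [N [d0 hd]]] := contact_set_near alpha_gt0 p_gtn Q_dom eta_C1 etak_C1 eta_time
    etak_cvg eps0_gt0 eta_det Jz0 bz0 nC'.
  have d20 : 0 < d / 2 by rewrite divr_gt0.
  have d2d : d / 2 < d by rewrite gtr_pMr// invf_lt1// ltr1n.
  have d40 : 0 < d / 2 / 2 by rewrite divr_gt0.
  (* The closed ball gives a compact set, as the covering argument requires, and its radius stays
     strictly below [d], within which [etak (s k)] has no contact. *)
  have null k : (N <= k)%N -> muk (s k) (K `&` [set z | `|z - z0| <= d / 2]) = 0%E.
    move=> Nk; apply: (notin_vsupp_null cK (dens (s k)) (nuk1 (s k))); last 2 first.
    - by move=> z [].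
    - move=> z [[Jz bz] /= zd] sz; have [_ _ _ supk _] := sigmak_force (s k).
      have [_ cz] := supk _ sz; have clz : closure Q z.2 by case: bz.
      move: zd; rewrite prod_normE/= ge_max => /andP[z1 z2].
      apply: (hd (s k) z.1 z.2 _ Jz _ clz _ cz).
      + exact: leq_trans (sge k).
      + exact: le_lt_trans d2d.
      + exact: le_lt_trans d2d.
    apply: (subclosed_compact _ cK); last by move=> z [].
    apply: closedI; first exact: clK.
    rewrite (_ : [set z | _] = (fun z => `|z - z0|) @^-1` [set x | x <= d / 2])//.
    apply: preimage_closed; last exact: closed_le.
    by move=> z _; exact: continuous_dist_to.
  have mu0 := weak_limit_null_ball cK mucvg d20 null.
  have oB : open (ball z0 (d / 2 / 2)) by exact: ball_open.
  have [A [mA AB []]] := sz0 _ oB (ballxx z0 d40).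
  apply/rowP => i; rewrite !mxE sigmaE// null_set_integral//.
  - exact: measurableI.
  - by apply: measurable_funS (measurable_int _ (inu i)) => // z [].
  - apply/eqP; rewrite eq_le measure_ge0 andbT -mu0 le_measure ?inE//.
    + exact: measurableI.
    + apply: measurableI => //; apply: measurable_gen_open.
      rewrite (_ : [set z | _] = ball z0 (d / 2 / 2))//.
      by apply/seteqP; split => z; rewrite -ball_normE/= distrC.
    + move=> z [Az Kz]; split => //; have := AB _ Az.
      by rewrite -ball_normE/= distrC.
have force : contact_force alpha p Q Omega Gamma eta0 J eta sigma.
  split => //.
  - by apply: C1_continuous_borel_in_time => //; exact: interval_closed.
  - by exists mu => // i; split; [exact: inu|exact: sigmaE].
exists s, sigma; split => // AR.
have oO : open Omega by case: Omega_dom.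
apply: (@action_reaction_limit R n Q Omega J eta (fun k => etak (s k)) (fun k => sigmak (s k))
  sigma C oO cK) => //.
- by move=> t0 x0 e; exact: (eta_near eta_C1 eta_time).
- move=> e e0; have [N hN] := etak_cvg_closure eta_C1 etak_C1 etak_cvg e0.
  by exists N => k t x Nk; apply: hN; exact: leq_trans (sge k).
- by move=> k i A mA; exact: tv_norm_coord_le (sigmak_bounded (s k)) mA.
Qed.
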